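(* Let $N\ge 3$, let $a:[0,1)\to(0,+\infty)$ be continuous on $[0,1)$ and of class $\mathcal C^1$ on $(0,1)$, with $\lim_{s\to 1^-}a(s)=+\infty$ and $a$ increasing. Let $\rho>0$ and $2<p<2+\frac4N$. Then there exists a nonnegative radial $u\in\mathcal X$ which is a solution, for some $\lambda\in\mathbb R$, of $$\begin{cases}-\mathrm{div}\big(a(|\nabla u|^2)\nabla u\big)=|u|^{p-2}u-\lambda u & \text{in }\mathbb R^N,\\ u(x)\to 0 & \text{as }|x|\to+\infty,\\ \int_{\mathbb R^N}|u|^2\,dx=\rho^2.&\end{cases}$$
   Context: $\mathcal X=H^1(\mathbb R^N)\cap D^{1,q}(\mathbb R^N)$ for some $q>N$, i.e. the completion of $\mathcal C_0^\infty(\mathbb R^N)$ with respect to the norm $\|u\|_{\mathcal X}=(\|\nabla u\|_2^2+\|u\|_2^2+\|\nabla u\|_q^2)^{1/2}$. Solutions are understood in the weak sense: $|\nabla u|<1$ a.e. (so that $a(|\nabla u|^2)$ makes sense) and $\int_{\mathbb R^N}a(|\nabla u|^2)\nabla u\cdot\nabla\phi\,dx=\int_{\mathbb R^N}(|u|^{p-2}u-\lambda u)\phi\,dx$ for all $\phi\in\mathcal C_0^\infty(\mathbb R^N)$. The number $\lambda$ is part of the unknown (it arises as a Lagrange multiplier). *)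

(* Defs.v *)
From HB Require Import structures.
From mathcomp Require Import all_boot all_order all_algebra.
From mathcomp Require Import all_classical all_reals all_analysis.
From mathcomp Require Import measurable_realfun.

Set Implicit Arguments.
Unset Strict Implicit.
Unset Printing Implicit Defensive.

Import Order.TTheory GRing.Theory Num.Theory.
Import numFieldNormedType.Exports.

Local Open Scope classical_set_scope.
Local Open Scope ring_scope.

Definition borel_rV (R : realType) (n : nat) :=
  g_sigma_algebraType (@open 'rV[R]_n).

HB.instance Definition _ (R : realType) (n : nat) :=
  Measurable.on (borel_rV R n).

Section lebesgue_rV.
Variable R : realType.

Lemma measurable_coord n (i : 'I_n) :
  measurable_fun [set: borel_rV R n]
    (fun x : borel_rV R n => (x : 'rV[R]_n) ord0 i : measurableTypeR R).
Proof.
apply: (measurability (@RGenOpens.G R)); first exact: RGenOpens.measurableE.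
move=> _ [_ [a [b ->]] <-]; rewrite setTI.
apply: sub_sigma_algebra; apply: open_comp; last exact: interval_open.
by move=> x _; exact: coord_continuous.
Qed.

Lemma measurable_rV d (T : measurableType d) n (f : T -> borel_rV R n) :
  (forall i, measurable_fun [set: T]
     (fun t => (f t : 'rV[R]_n) ord0 i : measurableTypeR R)) ->
  measurable_fun [set: T] f.
Proof.
move=> mf.
have sG : @measurable _ (borel_rV R n) = <<s @open 'rV[R]_n >> by [].
apply: (@measurability _ _ T (borel_rV R n) setT f _ sG).
move=> _ [U oU <-]; rewrite setTI.
pose B (q : 'rV[rat]_n * nat) : set 'rV[R]_n :=
  ball (map_mx ratr q.1 : 'rV[R]_n) (q.2.+1%:R^-1 : R).
pose F q : set 'rV[R]_n := if `[< B q `<=` U >] then B q else set0.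
have -> : U = \bigcup_q F q.
  apply/seteqP; split => [x Ux|x [q _]]; last first.
    by rewrite /F; case: asboolP => // BU; exact: BU.
  have /nbhs_ballP[e /= e0 xeU] : nbhs x U by exact: open_nbhs_nbhs.
  have [k ke] : exists k : nat, k.+1%:R^-1 + k.+1%:R^-1 < e.
    exists (Num.truncn (e / 2)^-1).
    by rewrite [ltRHS]splitr ltrD// -[ltRHS]invrK ltf_pV2 ?posrE ?invr_gt0
      ?divr_gt0// truncnS_gt.
  have k0 : 0 < (k.+1%:R^-1 : R) by rewrite invr_gt0.
  have /choice[q qP] : forall j : 'I_n, exists q : rat,
      `|x ord0 j - ratr q| < k.+1%:R^-1.
    move=> j.
    have [q] : exists q, ratr q \in
        `](x ord0 j - k.+1%:R^-1), (x ord0 j + k.+1%:R^-1)[.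
      by apply: rat_in_itvoo; rewrite ltrD2l gtrN.
    rewrite in_itv /= => /andP[h1 h2]; exists q.
    by rewrite distrC ltr_distl h1 h2.
  exists (\row_j q j, k) => //; rewrite /F.
  have Bx : B (\row_j q j, k) x.
    split => // i j; rewrite !mxE (ord1 i).
    by rewrite /ball/= distrC.
  case: asboolP => // -[]; apply: subset_trans xeU => y [_ yB].
  split => // i j; apply: (le_ball (ltW ke)).
  apply: (@ball_triangle _ _ ((map_mx ratr (\row_j q j) : 'rV[R]_n) i j)).
    by apply: ball_sym; case: Bx.
  exact: yB.
rewrite preimage_bigcup; apply: countable_bigcupT_measurable => [|q].
  exact: countableP.
rewrite /F; case: asboolP => _; last by rewrite preimage_set0.
have -> : f @^-1` B q = \bigcap_(j in [set: 'I_n])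
    ((fun t => (f t : 'rV[R]_n) ord0 j : measurableTypeR R) @^-1`
       ball (ratr (q.1 ord0 j) : R) (q.2.+1%:R^-1)).
  apply/seteqP; split => t /=.
    by move=> [_ h] j _; have := h ord0 j; rewrite mxE.
  move=> h; split; first by rewrite invr_gt0.
  by move=> i j; rewrite (ord1 i) mxE; exact: h.
apply: fin_bigcap_measurable => // j _.
by rewrite -[X in measurable X]setTI; apply: mf => //; exact: measurable_ball.
Qed.

Definition rV_cons n (p : measurableTypeR R * borel_rV R n) :
    borel_rV R n.+1 :=
  \row_(i < n.+1)
    (if unlift ord0 i is Some j then (p.2 : 'rV[R]_n) ord0 j else p.1).

Definition rV_uncons n (x : borel_rV R n.+1) :
    (measurableTypeR R * borel_rV R n)%type :=
  ((x : 'rV[R]_n.+1) ord0 ord0, \row_j (x : 'rV[R]_n.+1) ord0 (lift ord0 j)).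

Lemma rV_consK n : cancel (@rV_cons n) (@rV_uncons n).
Proof.
move=> [a v]; rewrite /rV_uncons /rV_cons; congr (_, _).
  by rewrite mxE unlift_none.
by apply/rowP => j; rewrite !mxE liftK.
Qed.

Lemma measurable_rV_cons n : measurable_fun setT (@rV_cons n).
Proof.
apply: measurable_rV => i; rewrite /rV_cons.
under eq_fun do rewrite mxE.
case: unliftP => [j _|_]; last exact: measurable_fst.
exact: (measurableT_comp (measurable_coord j) measurable_snd).
Qed.

Lemma measurable_rV_uncons n : measurable_fun setT (@rV_uncons n).
Proof.
apply: measurable_fun_pair; first exact: measurable_coord.
apply: measurable_rV => i; under eq_fun do rewrite mxE.
exact: measurable_coord.
Qed.

Section cons_measure.
Variables (n : nat) (mu : {sigma_finite_measure set (borel_rV R n) -> \bar R}).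

Definition cons_measure : set (borel_rV R n.+1) -> \bar R :=
  pushforward ((@lebesgue_measure R) \x mu)%E (@rV_cons n).

Lemma cons_measureE A : cons_measure A =
  (((@lebesgue_measure R) \x mu)%E (@rV_cons n @^-1` A)).
Proof. by []. Qed.

Let measurable_pre (A : set (borel_rV R n.+1)) :
  measurable A -> measurable (@rV_cons n @^-1` A).
Proof.
by move=> mA; rewrite -[X in measurable X]setTI; exact: measurable_rV_cons.
Qed.

Let cons_measure0 : cons_measure set0 = 0%E.
Proof. by rewrite cons_measureE preimage_set0 measure0. Qed.

Let cons_measure_ge0 A : (0 <= cons_measure A)%E.
Proof. by rewrite cons_measureE measure_ge0. Qed.

Let cons_measure_sigma_additive : semi_sigma_additive cons_measure.
Proof.
move=> F mF tF mUF; rewrite cons_measureE preimage_bigcup.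
rewrite /cons_measure /pushforward; apply: measure_semi_sigma_additive.
- by move=> k; apply: measurable_pre; exact: mF.
- apply/trivIsetP => /= i j _ _ ij; rewrite -preimage_setI.
  by move/trivIsetP : tF => /(_ _ _ _ _ ij) ->//; rewrite preimage_set0.
- by rewrite -preimage_bigcup; exact: measurable_pre.
Qed.

HB.instance Definition _ := isMeasure.Build _ _ _ cons_measure
  cons_measure0 cons_measure_ge0 cons_measure_sigma_additive.

Let cons_measure_sigma_finite : sigma_finite setT cons_measure.
Proof.
have [F FT mF] : sigma_finite setT ((@lebesgue_measure R) \x mu)%E.
  have /sigma_finiteP[F [TF ndF Foo]] := sigma_finiteT (@lebesgue_measure R).
  have /sigma_finiteP[G [TG ndG Goo]] := sigma_finiteT mu.
  exists (fun k => F k `*` G k).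
    rewrite -setXTT TF TG predeqE => -[x y]; split; last first.
      by move=> [k _ []/= ? ?]; split; exists k.
    move=> [/= [k _ Fkx] [l _ Gly]]; exists (maxn k l) => //; split.
    - by move: x Fkx; exact/subsetPset/ndF/leq_maxl.
    - by move: y Gly; exact/subsetPset/ndG/leq_maxr.
  move=> k; have [? ?] := Foo k; have [? ?] := Goo k.
  split; first exact: measurableX.
  by rewrite product_measure1E// lte_mul_pinfty// ge0_fin_numE.
exists (fun k => @rV_uncons n @^-1` F k).
  by rewrite -preimage_bigcup -FT preimage_setT.
move=> k; have [mFk Fk] := mF k; split.
  by rewrite -[X in measurable X]setTI; exact: measurable_rV_uncons.
rewrite cons_measureE -comp_preimage.
suff -> : @rV_uncons n \o @rV_cons n = id by rewrite preimage_id.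
by apply/funext => p /=; rewrite rV_consK.
Qed.

HB.instance Definition _ := Measure_isSigmaFinite.Build _ _ _ cons_measure
  cons_measure_sigma_finite.

End cons_measure.

Fixpoint lebesgue_rV (n : nat) :
    {sigma_finite_measure set (borel_rV R n) -> \bar R} :=
  match n with
  | 0%N => dirac ((0 : 'rV[R]_0) : borel_rV R 0)
  | m.+1 => cons_measure (lebesgue_rV m)
  end.

Lemma lebesgue_rV_box n (a b : 'rV[R]_n) : (forall i, a ord0 i <= b ord0 i) ->
  lebesgue_rV n [set x : 'rV[R]_n |
    forall i, a ord0 i <= x ord0 i <= b ord0 i] =
  (\prod_(i < n) (b ord0 i - a ord0 i))%:E.
Proof.
elim: n a b => [|n IH] a b ab.
  rewrite big_ord0 /= diracE mem_set//= => -[] //.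
rewrite big_ord_recl/=.
pose a' : 'rV[R]_n := \row_j a ord0 (lift ord0 j).
pose b' : 'rV[R]_n := \row_j b ord0 (lift ord0 j).
set A' := [set x : 'rV[R]_n | forall i, a' ord0 i <= x ord0 i <= b' ord0 i].
have mA' : measurable (A' : set (borel_rV R n)).
  have -> : A' = \bigcap_(j in [set: 'I_n])
      ((fun x : borel_rV R n => (x : 'rV[R]_n) ord0 j : measurableTypeR R) @^-1`
       `[a' ord0 j, b' ord0 j]).
    apply/seteqP; split => t /= h j; first by move=> _; rewrite /= in_itv/= h.
    by have := h j I; rewrite /= in_itv.
  apply: fin_bigcap_measurable => // j _.
  by rewrite -[X in measurable X]setTI; exact: measurable_coord.
rewrite cons_measureE (_ : _ @^-1` _ = `[a ord0 ord0, b ord0 ord0] `*` A').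
  rewrite product_measure1E//= lebesgue_measure_itv/= lte_fin.
  rewrite IH; last by move=> i; rewrite !mxE.
  rewrite EFinM.
  congr (_ * (_)%:E)%E.
    have := ab ord0; rewrite le_eqVlt => /predU1P[->|->//].
    by rewrite ltxx subrr.
  by apply: eq_bigr => i _; rewrite !mxE.
apply/seteqP; split => -[y v] /=.
  move=> h; split.
    by have := h ord0; rewrite mxE unlift_none in_itv.
  by move=> i; have := h (lift ord0 i); rewrite !mxE liftK.
move=> [h1 h2] i; rewrite /rV_cons mxE.
case: unliftP => [j ->|->]; first by have := h2 j; rewrite !mxE.
by move: h1; rewrite in_itv.
Qed.

End lebesgue_rV.

Section sobolev.
Variables (R : realType) (N : nat).
Local Notation leb := (lebesgue_rV R N).

Definition dotv (x y : 'rV[R]_N) : R := \sum_(i < N) x ord0 i * y ord0 i.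

(* The library norm `|x| on 'rV[R]_N is the sup norm. *)
Definition enorm (x : 'rV[R]_N) : R := Num.sqrt (dotv x x).

Definition partial (i : 'I_N) (f : 'rV[R]_N -> R) : 'rV[R]_N -> R :=
  fun x => 'D_(delta_mx ord0 i) f x.

Definition grad (f : 'rV[R]_N -> R) (x : 'rV[R]_N) : 'rV[R]_N :=
  \row_(i < N) partial i f x.

Definition smooth (f : 'rV[R]_N -> R) : Prop :=
  forall (s : seq 'I_N) (x : 'rV[R]_N), differentiable (foldr partial f s) x.

Definition test_function (f : 'rV[R]_N -> R) : Prop :=
  smooth f /\ compact (closure [set x | f x != 0]).

Definition normX (q : R) (u : 'rV[R]_N -> R) (v : 'rV[R]_N -> 'rV[R]_N) :
    \bar R :=
  ((Lnorm leb 2%:E (fun x => (enorm (v x))%:E) ^+ 2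
    + Lnorm leb 2%:E (fun x => (u x)%:E) ^+ 2
    + Lnorm leb q%:E (fun x => (enorm (v x))%:E) ^+ 2) `^ 2^-1)%E.

(* [inX q u v]: u represents an element of the completion X of the test
   functions, and v represents its gradient. As the norm of X controls
   the L^2 norm of u and the L^2 and L^q norms of the gradient, a Cauchy
   sequence of test functions converges in X exactly when it converges in
   these norms to such a pair (u, v). *)
Definition inX (q : R) (u : 'rV[R]_N -> R) (v : 'rV[R]_N -> 'rV[R]_N) : Prop :=
  [/\ measurable_fun [set: borel_rV R N] (u : borel_rV R N -> measurableTypeR R),
      measurable_fun [set: borel_rV R N] (v : borel_rV R N -> borel_rV R N) &
      exists phi : nat -> 'rV[R]_N -> R,
        (forall k, test_function (phi k)) /\
        normX q (fun x => phi k x - u x) (fun x => grad (phi k) x - v x)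
          @[k --> \oo] --> 0%E].

(* v stands for the gradient of u. *)
Definition weak_solution (a : R -> R) (p lambda : R)
    (u : 'rV[R]_N -> R) (v : 'rV[R]_N -> 'rV[R]_N) : Prop :=
  {ae leb, forall x, enorm (v x) < 1} /\
  forall phi, test_function phi ->
    [/\ leb.-integrable setT
          (fun x => (a (enorm (v x) ^+ 2) * dotv (v x) (grad phi x))%:E),
        leb.-integrable setT
          (fun x => ((`|u x| `^ (p - 2) * u x - lambda * u x) * phi x)%:E) &
        (\int[leb]_x (a (enorm (v x) ^+ 2) * dotv (v x) (grad phi x))%:E =
         \int[leb]_x
           ((`|u x| `^ (p - 2) * u x - lambda * u x) * phi x)%:E)%E].

Definition radial (u : 'rV[R]_N -> R) : Prop :=
  forall x y, enorm x = enorm y -> u x = u y.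

Definition vanishes_at_infinity (u : 'rV[R]_N -> R) : Prop :=
  forall e : R, 0 < e -> exists M : R, forall x, M <= enorm x -> `|u x| < e.

End sobolev.

(* Main.v *)
(** The solution is radial and is found by minimisation.  Encode a radially
    nonincreasing function with slope at most 1 by [W = -U'], [0 <= W <= 1], so
    that [U = tail W], and let [nu] be the push-forward of Lebesgue measure under
    the Euclidean norm.  Replace [a] by its truncation [s |-> a (min s s0)] and let
    [B] be the primitive of [w |-> a (min (w^2) s0) w].  One minimises
    [\int B(W) dnu - p^-1 \int U^p dnu] under [\int U^2 dnu <= rho^2].  Strong
    convexity of [B] makes minimising sequences converge a.e.; as [p < 2 + 4/N] the
    infimum is negative, and a dilation argument shows that the mass constraint is
    saturated.

    Convexity also allows one to linearise: [W] minimises [\int (B(V) - h V) dnu],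
    where [h(r) = r^(1-N) \int_0^r (U^(p-1) - lambda U) s^(N-1) ds], so that [W(r)]
    minimises [B(v) - h(r) v] over [0 <= v <= 1] for almost every [r].  One has
    [0 <= h <= H] with [H] independent of [s0]; if [s0] is chosen with
    [a(s0) sqrt(s0) > H], then [W < sqrt(s0)], the truncation is not active and
    [a(W^2) W = h].  Integrating a test function along rays turns this identity
    into the weak equation. *)
From HB Require Import structures.
Require Import Defs.
From mathcomp Require Import all_boot all_order all_algebra.
From mathcomp Require Import all_classical all_reals all_analysis.
From mathcomp Require Import measurable_realfun ring lra.

Set Implicit Arguments.
Unset Strict Implicit.
Unset Printing Implicit Defensive.

Import Order.TTheory GRing.Theory Num.Theory.
Import numFieldNormedType.Exports.

Local Open Scope classical_set_scope.
Local Open Scope ring_scope.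

(** * Integration in R^N *)

(** Taking the slope [W] as unknown puts monotonicity, nonnegativity and the bound 1 on the gradient
    into a convex set of competitors. All tails are then 1-Lipschitz and decay at a rate fixed by
    the mass, so that compactness is plain uniform convergence. The price is that minimality gives
    only a variational inequality with the two obstacles [0 <= W] and [W <= 1], and each must be
    shown inactive. The upper one: with [C = tail_bound N (rho^2)] one has [H = C^(p-2) C], which
    involves [N], [p], [rho] only, so [s0] is fixed before any minimiser exists. The estimate
    [h <= H] uses [lambda >= 0]; this sign is the reason for imposing the mass as an inequality and
    proving saturation separately. The lower one: since [U] is nonincreasing, [U^(p-1) - lambda U]
    changes sign at most once, from plus to minus, and wherever [h] is negative [W] vanishes;
    together these exclude a negative [h]. The action is not convex, because of [- U^p]. The tangent
    inequality of the power replaces this term by a linear one and keeps [W] minimal, after which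
    the multiplier comes from convexity alone. *)

Section scaling.
Variable R : realType.

(** The push-forward of Lebesgue measure under [x |-> t x], multiplied by [t], gives half-open
    intervals their length; hence it is Lebesgue measure by uniqueness. *)
Lemma ge0_integral_scale1 (t : R) (f : R -> \bar R) : 0 < t ->
  measurable_fun [set: R] f -> (forall x, 0 <= f x)%E ->
  (\int[@lebesgue_measure R]_x f (t * x)%R =
   t^-1%:E * \int[@lebesgue_measure R]_x f x)%E.
Proof.
move=> t0 mf f0.
pose sc (x : measurableTypeR R) : measurableTypeR R := t * x.
have mt : measurable_fun [set: measurableTypeR R] sc.
  exact: measurable_funM.
have tpos : (0 <= t) by exact: ltW.
pose nn : {nonneg R} := NngNum tpos.
have [P PE] : exists P : {measure set (measurableTypeR R) -> \bar R},
    forall A, P A = pushforward (@lebesgue_measure R) sc A.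
  by unshelve eexists (pushforward (@lebesgue_measure R) sc : {measure set _ -> \bar R}).
have key A : measurable A -> lebesgue_measure A = mscale nn P A.
  move: A; apply: lebesgue_measure_unique.
  move=> _ [[a b]] _ <-.
  pose I := `]a, b]%classic : set R.
  pose J := (fun x : R => t * x) @^-1` I.
  change (lebesgue_measure I = t%:E * P I)%E; rewrite PE.
  change (lebesgue_measure I = t%:E * lebesgue_measure J)%E.
  have -> : J = `]a / t, b / t]%classic.
    apply/seteqP; split => x; rewrite /J/I/= !in_itv /= ltr_pdivrMr // ler_pdivlMr //;
      by rewrite mulrC.
  rewrite !lebesgue_measure_itv /= !lte_fin.
  rewrite ltr_pM2r ?invr_gt0//; case: ifP => _; last by rewrite mule0.
  rewrite -!EFinB -EFinM; congr (_%:E); field.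
  by rewrite gt_eqF.
have -> : (\int[@lebesgue_measure R]_x f x = \int[mscale nn P]_x f x)%E.
  by apply: (eq_measure_integral (mscale nn P)) => A mA _; first [exact: key|exact/esym/key].
rewrite ge0_integral_mscale//=.
rewrite (_ : (P : set _ -> \bar R) = pushforward (@lebesgue_measure R) sc); last exact/funext.
rewrite ge0_integral_pushforward//.
by rewrite preimage_setT muleA -EFinM mulVf ?mul1e// gt_eqF.
Qed.

Lemma measurable_rV_scale n (t : R) :
  measurable_fun [set: borel_rV R n] (fun x : borel_rV R n => (t *: (x : 'rV[R]_n)) : borel_rV R n).
Proof.
apply: measurable_rV => i; under eq_fun do rewrite mxE.
by apply: measurable_funM => //; exact: measurable_coord.
Qed.

Lemma ge0_integral_rV_recl n (f : borel_rV R n.+1 -> \bar R) :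
  measurable_fun setT f -> (forall x, 0 <= f x)%E ->
  (\int[lebesgue_rV R n.+1]_x f x =
   \int[@lebesgue_measure R]_y \int[lebesgue_rV R n]_v f (rV_cons (y, v)))%E.
Proof.
move=> mf f0.
transitivity (\int[(@lebesgue_measure R \x lebesgue_rV R n)%E]_p f (rV_cons p))%E.
  have := @ge0_integral_pushforward _ _ _ _ R (@rV_cons R n) (@measurable_rV_cons R n)
    (@lebesgue_measure R \x lebesgue_rV R n)%E setT f measurableT mf.
  by rewrite preimage_setT => <- //.
rewrite fubini_tonelli1 //.
exact: (measurableT_comp mf (@measurable_rV_cons R n)).
Qed.

(** Induction on the dimension by Tonelli, each coordinate contributing a factor [t^-1]. *)
Lemma ge0_integral_scale n (t : R) (f : borel_rV R n -> \bar R) : 0 < t ->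
  measurable_fun setT f -> (forall x, 0 <= f x)%E ->
  (\int[lebesgue_rV R n]_x f (t *: (x : 'rV[R]_n))%R =
   (t^-1 ^+ n)%:E * \int[lebesgue_rV R n]_x f x)%E.
Proof.
move=> t0; elim: n f => [|n IH] f mf f0.
  rewrite expr0 mul1e; apply: eq_integral => x _; congr (f _).
  by apply/rowP => -[].
have ms := @measurable_rV_scale n.+1 t.
rewrite !ge0_integral_rV_recl //; last first.
  exact: (measurableT_comp mf ms).
have E y (v : borel_rV R n) : t *: (rV_cons (y, v) : 'rV[R]_n.+1) = rV_cons (t * y, t *: (v : 'rV[R]_n)).
  by apply/rowP => i; rewrite /rV_cons !mxE; case: unliftP => [j _|_] //=; rewrite !mxE.
under eq_integral => y _.
  under eq_integral => v _ do rewrite E.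
  rewrite (IH (fun v => f (rV_cons (t * y, v)))) //; last first.
    apply: (measurableT_comp mf); apply: (measurableT_comp (@measurable_rV_cons R n)).
    exact: measurable_pair1.
  over.
have mi : measurable_fun [set: R] (fun y : R => \int[lebesgue_rV R n]_v f (rV_cons (y, v)))%E.
  apply: (@measurable_fun_fubini_tonelli_F _ _ _ _ _ (lebesgue_rV R n) (fun p => f (rV_cons p))) => //.
  exact: (measurableT_comp mf (@measurable_rV_cons R n)).
have i0 y : (0 <= \int[lebesgue_rV R n]_v f (rV_cons (y, v)))%E.
  exact: integral_ge0.
rewrite ge0_integralZl //; last 2 first.
- by apply: (measurableT_comp mi); exact: measurable_funM.
- by rewrite lee_fin exprn_ge0// invr_ge0 ltW.
rewrite (ge0_integral_scale1 t0 mi) // muleA -EFinM.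
by rewrite exprSr.
Qed.

End scaling.

Section density.
Context d (T : measurableType d) (R : realType).
Variables (mu nu : {measure set T -> \bar R}) (g : T -> R).
Hypotheses (g0 : forall x, 0 <= g x) (mg : measurable_fun setT g).
Hypothesis nuE : forall A, measurable A -> nu A = (\int[mu]_(x in A) (g x)%:E)%E.
Import HBNNSimple.
Local Open Scope ereal_scope.

(** Both sides pass to the limit along increasing simple functions, by monotone convergence;
    linearity then reduces the claim to indicators, where it is [nuE]. *)
Lemma ge0_integral_density (f : T -> \bar R) : measurable_fun setT f ->
  (forall x, 0 <= f x) ->
  \int[nu]_x f x = \int[mu]_x (f x * (g x)%:E).
Proof.
move=> mf f0.
have mgE : measurable_fun setT (EFin \o g) by exact/measurable_EFinP.
pose h := nnsfun_approx measurableT mf.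
have -> : \int[nu]_x f x = lim (\int[nu]_x (EFin \o h n) x @[n --> \oo]).
  have fE x : setT x -> f x = lim ((EFin \o h n) x @[n --> \oo]).
    by move=> Ex; apply/esym/cvg_lim => //; exact: cvg_nnsfun_approx.
  under eq_integral => x /[!inE] /fE -> //.
  apply: monotone_convergence => //.
  - move=> n; apply/measurable_EFinP; exact: measurable_funP.
  - by move=> n x Ex //=; rewrite lee_fin.
  - by move=> x Ex a b ab; rewrite lee_fin; exact/lefP/nd_nnsfun_approx.
have -> : \int[mu]_x (f x * (g x)%:E) =
    lim (\int[mu]_x ((EFin \o h n) x * (g x)%:E) @[n --> \oo]).
  have fg x : setT x -> f x * (g x)%:E = lim ((EFin \o h n) x * (g x)%:E @[n --> \oo]).
    by move=> Ex; apply/esym/cvg_lim => //; apply: cvgeZr => //;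
      exact: cvg_nnsfun_approx.
  under eq_integral => x /[!inE] /fg -> //.
  apply: monotone_convergence => //.
  - move=> n; apply/emeasurable_funM => //; apply/measurable_EFinP; exact: measurable_funP.
  - by move=> n x Ex /=; rewrite mule_ge0 ?lee_fin.
  - by move=> x Ex a b ab/=; rewrite lee_wpmul2r ?lee_fin//; exact/lefP/nd_nnsfun_approx.
congr (lim _); apply/funext => n /=; congr (nbhs _) => {}.
suff suf k : \int[nu]_x (EFin \o h k) x = \int[mu]_x ((EFin \o h k) x * (g x)%:E).
  by under eq_fun do rewrite suf.
transitivity (\int[nu]_x
   (\sum_(y \in range (h k)) (y * \1_(h k @^-1` [set y]) x)%:E)).
  by apply: eq_integral => t tE; rewrite /= fimfunE -fsumEFin.
have indich m r : measurable_fun setT (fun x => (r * \1_(h m @^-1` [set r]) x)%:E).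
  by apply/measurable_EFinP; exact: measurable_funM.
rewrite ge0_integral_fsum//; last by move=> y x Ey; exact: nnfun_muleindic_ge0.
transitivity (\int[mu]_x (\sum_(y \in range (h k))
    (y * \1_(h k @^-1` [set y]) x)%:E * (g x)%:E)); last first.
  apply: eq_integral => x _; rewrite -ge0_mule_fsuml => [|y]; last exact: nnfun_muleindic_ge0.
  by rewrite fsumEFin // -(fimfunE _ x).
rewrite ge0_integral_fsum//; last 2 first.
  - by move=> y; exact: emeasurable_funM.
  - by move=> m y Ey; rewrite mule_ge0 ?lee_fin// -lee_fin nnfun_muleindic_ge0.
apply: eq_fsbigr => r rhn.
have r0 : (0 <= r)%R by move: rhn; rewrite inE => -[t _ <-].
rewrite integralZl_indic_nnsfun//.
under [RHS]eq_integral do rewrite EFinM -muleA.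
rewrite ge0_integralZl//; last 2 first.
- by apply: emeasurable_funM => //; apply/measurable_EFinP.
- by move=> t Et; rewrite mule_ge0 ?lee_fin.
congr (_ * _).
rewrite integral_indic// setIT nuE//.
rewrite integral_mkcond; apply: eq_integral => x _.
by rewrite epatch_indic muleC.
Qed.

End density.

Section calculus.
Variable R : realType.
Implicit Types f F : R -> R.

Lemma integral_FTC2 f F (a b : R) : a <= b ->
  (forall x : R, a <= x <= b -> is_derive x (1 : R) F (f x)) ->
  (forall x : R, a <= x <= b -> {for x, continuous f}) ->
  (\int[@lebesgue_measure R]_(x in `[a, b]) (f x)%:E = (F b - F a)%:E)%E.
Proof.
rewrite le_eqVlt => /predU1P[->|ab] dF cf.
  by rewrite set_itv1 integral_set1 subrr.
have cF (x : R) : a <= x <= b -> {for x, continuous F}.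
  by move=> /dF[d _]; apply: differentiable_continuous; apply/derivable1_diffP.
rewrite (@continuous_FTC2 R f F)//.
- by apply: continuous_in_subspaceT => x; rewrite inE/= in_itv/=; exact: cf.
- split.
  + by move=> x; rewrite in_itv/= => /andP[ax xb]; have [] := dF x; rewrite ?(ltW ax) ?(ltW xb).
  + by apply: cvg_at_right_filter; apply: cF; rewrite lexx ltW.
  + by apply: cvg_at_left_filter; apply: cF; rewrite lexx ltW.
- move=> x; rewrite in_itv/= => /andP[ax xb]; rewrite derive1E.
  by have [_ ->] := dF x (introT andP (conj (ltW ax) (ltW xb))).
Qed.

Lemma integral_exprn (n : nat) (r : R) : 0 <= r ->
  (\int[@lebesgue_measure R]_(x in `[0%R, r]) (x ^+ n)%:E = (r ^+ n.+1 / n.+1%:R)%:E)%E.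
Proof.
move=> r0.
have dF (x : R) : is_derive x (1 : R) (fun x => x ^+ n.+1 / n.+1%:R) (x ^+ n).
  have -> : (fun x : R => x ^+ n.+1 / n.+1%:R) = horner (n.+1%:R^-1 *: 'X^(n.+1) : {poly R}).
    by apply/funext => y; rewrite hornerZ hornerXn mulrC.
  apply: is_derive_eq.
  by rewrite derivZ derivXn hornerZ hornerMn hornerXn /= -[x ^+ n *+ _]mulr_natr mulrCA mulVf ?mulr1 // pnatr_eq0.
rewrite (@integral_FTC2 _ _ 0 r r0 (fun x _ => dF x)); last by move=> x _; exact: exprn_continuous.
by rewrite expr0n /= mul0r subr0.
Qed.

End calculus.

Section enorm.
Variables (R : realType) (N : nat).
Implicit Types x y : 'rV[R]_N.

Lemma dotvv_ge0 x : 0 <= dotv x x.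
Proof. by apply: sumr_ge0 => i _; rewrite -expr2 sqr_ge0. Qed.

Lemma dotvZl (t : R) x y : dotv (t *: x) y = t * dotv x y.
Proof. by rewrite /dotv mulr_sumr; apply: eq_bigr => i _; rewrite mxE mulrA. Qed.

Lemma dotvZr (t : R) x y : dotv x (t *: y) = t * dotv x y.
Proof. by rewrite /dotv mulr_sumr; apply: eq_bigr => i _; rewrite mxE mulrCA. Qed.

Lemma enorm_ge0 x : 0 <= enorm x.
Proof. exact: sqrtr_ge0. Qed.

Lemma enorm_sqr x : enorm x ^+ 2 = dotv x x.
Proof. by rewrite sqr_sqrtr// dotvv_ge0. Qed.

Lemma enormZ (t : R) x : enorm (t *: x) = `|t| * enorm x.
Proof.
by rewrite /enorm dotvZl dotvZr mulrA -expr2 sqrtrM ?sqr_ge0// sqrtr_sqr.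
Qed.

Lemma enorm0 : enorm (0 : 'rV[R]_N) = 0.
Proof. by rewrite -(scale0r (0 : 'rV[R]_N)) enormZ normr0 mul0r. Qed.

Lemma le_coord_enorm x i : `|x ord0 i| <= enorm x.
Proof.
rewrite -sqrtr_sqr /enorm ler_wsqrtr// /dotv (bigD1 i)//= expr2 lerDl.
by apply: sumr_ge0 => j _; rewrite -expr2 sqr_ge0.
Qed.

Lemma enorm_eq0 x : enorm x = 0 -> x = 0.
Proof.
move=> x0; apply/rowP => i; rewrite mxE; apply/eqP.
by rewrite -normr_eq0 eq_le normr_ge0 andbT -x0 le_coord_enorm.
Qed.

Lemma enorm_le x (M : R) : 0 <= M -> (forall i, `|x ord0 i| <= M) ->
  enorm x <= N%:R * M.
Proof.
move=> M0 xM; rewrite -(@ler_pXn2r _ 2)// ?nnegrE ?enorm_ge0 ?mulr_ge0//.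
rewrite enorm_sqr (le_trans (y := N%:R * M ^+ 2))//.
  rewrite /dotv (le_trans (ler_sum _ (G := fun=> M ^+ 2) _))//.
    by move=> i _; rewrite -expr2 -real_normK ?num_real// lerXn2r ?nnegrE.
  by rewrite sumr_const card_ord mulr_natl.
rewrite exprMn ler_wpM2r ?sqr_ge0// -natrX ler_nat.
by case: (N) => // n; rewrite leq_pmulr.
Qed.

Lemma measurable_dotv d (T : measurableType d) (f g : T -> borel_rV R N) :
  measurable_fun setT f -> measurable_fun setT g ->
  measurable_fun setT (fun t => dotv (f t) (g t)).
Proof.
move=> mf mg; apply: measurable_sum => i; apply: measurable_funM.
- exact: (measurableT_comp (measurable_coord i) mf).
- exact: (measurableT_comp (measurable_coord i) mg).
Qed.

Lemma measurable_enorm :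
  measurable_fun [set: borel_rV R N] (@enorm R N : borel_rV R N -> measurableTypeR R).
Proof.
apply: (measurableT_comp (f := @Num.sqrt R)).
  by apply: continuous_measurable_fun => x; exact: sqrt_continuous.
exact: measurable_dotv.
Qed.

Definition radm : set (measurableTypeR R) -> \bar R :=
  pushforward (lebesgue_rV R N) (@enorm R N : borel_rV R N -> measurableTypeR R).

Let radm_measure : {measure set (measurableTypeR R) -> \bar R}.
Proof.
unshelve eapply (pushforward (lebesgue_rV R N)
  (@enorm R N : borel_rV R N -> measurableTypeR R) : {measure set _ -> \bar R}).
exact: measurable_enorm.
Defined.

Let radm0 : radm set0 = 0%E.
Proof. exact: (measure0 radm_measure). Qed.
Let radm_ge0 A : (0 <= radm A)%E.
Proof. exact: (measure_ge0 radm_measure). Qed.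
Let radm_sigma_additive : semi_sigma_additive radm.
Proof. exact: (@measure_semi_sigma_additive _ _ _ radm_measure). Qed.

HB.instance Definition _ := isMeasure.Build _ _ _ radm radm0 radm_ge0 radm_sigma_additive.

Lemma ge0_integral_radm (f : R -> \bar R) : measurable_fun [set: R] f ->
  (forall r, 0 <= f r)%E ->
  (\int[radm]_r f r = \int[lebesgue_rV R N]_x f (enorm x))%E.
Proof.
move=> mf f0.
by rewrite (ge0_integral_pushforward measurable_enorm)//.
Qed.

Lemma ge0_integral_radm_scale (t : R) (f : R -> \bar R) : 0 < t ->
  measurable_fun [set: R] f -> (forall r, 0 <= f r)%E ->
  (\int[radm]_r f (t * r)%R = (t^-1 ^+ N)%:E * \int[radm]_r f r)%E.
Proof.
move=> t0 mf f0; rewrite !ge0_integral_radm//; last first.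
  by apply: (measurableT_comp mf); exact: measurable_funM.
have E := @ge0_integral_scale R N t (f \o @enorm R N) t0 (measurableT_comp mf measurable_enorm) (fun x => f0 _).
rewrite -E.
by apply: eq_integral => x _ /=; rewrite enormZ gtr0_norm.
Qed.

End enorm.

(** * Polar coordinates for radial functions *)

Section polar.
Variables (R : realType) (N : nat).
Hypothesis N0 : (0 < N)%N.
Local Notation nu := (@radm R N).
Local Notation leb := (@lebesgue_measure R).

Let box (a b : R) := [set x : 'rV[R]_N |
  forall i, (const_mx a : 'rV[R]_N) ord0 i <= x ord0 i <= (const_mx b : 'rV[R]_N) ord0 i].

Let box_measure (a b : R) : a <= b ->
  lebesgue_rV R N (box a b) = ((b - a) ^+ N)%:E.
Proof.
move=> ab; rewrite lebesgue_rV_box; last by move=> i; rewrite !mxE.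
by congr (_%:E); under eq_bigr do rewrite !mxE; rewrite prodr_const card_ord.
Qed.

Let measurable_box a b : measurable (box a b : set (borel_rV R N)).
Proof.
rewrite (_ : box a b = \bigcap_(j in [set: 'I_N])
      ((fun x : borel_rV R N => (x : 'rV[R]_N) ord0 j : measurableTypeR R) @^-1`
       `[a, b])).
  apply: fin_bigcap_measurable => // j _.
  by rewrite -[X in measurable X]setTI; exact: measurable_coord.
apply/seteqP; split => t /= h j; first by move=> _; have := h j; rewrite !mxE /= in_itv.
by have := h j I; rewrite /= !mxE in_itv.
Qed.

Let mball (x : R) : measurable ((@enorm R N : borel_rV R N -> measurableTypeR R) @^-1` `]-oo, x[).
Proof. by rewrite -[X in measurable X]setTI; exact: measurable_enorm. Qed.

Let le_leb (A B : set (borel_rV R N)) : measurable A -> measurable B ->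
  A `<=` B -> (lebesgue_rV R N A <= lebesgue_rV R N B)%E.
Proof. by move=> mA mB AB; apply: le_measure; rewrite ?inE. Qed.

(** The volume of the unit ball. Its value is never computed; only finiteness and positivity
    matter. *)
Definition ballc : R := fine (nu `]-oo, 1[).

(** The unit ball lies in the cube [[-1, 1]^N] and contains the cube [[0, (2 N)^-1]^N], whose
    volumes are known. *)
Let ballcE : nu `]-oo, 1[ = ballc%:E /\ 0 < ballc.
Proof.
have fin : (nu `]-oo, 1%R[ < +oo)%E.
  have : (lebesgue_rV R N (box (-1) 1) < +oo)%E by rewrite box_measure ?ltry// ; lra.
  apply: le_lt_trans; rewrite /radm /pushforward.
  apply: le_leb => // x /=.
  rewrite in_itv /= => x1 i; rewrite !mxE.
  by have := le_lt_trans (le_coord_enorm x i) x1; rewrite ltr_norml => /andP[/ltW -> /ltW ->].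
have pos : (0 < nu `]-oo, 1%R[)%E.
  have p0 : 0 < (2 * N%:R : R)^-1 by rewrite invr_gt0 mulr_gt0// ltr0n.
  have : (0 < lebesgue_rV R N (box 0 (2 * N%:R)^-1))%E.
    by rewrite box_measure ?ltW// subr0 lte_fin exprn_gt0.
  move=> /lt_le_trans; apply; rewrite /radm /pushforward.
  apply: le_leb => // x /= bx.
  rewrite in_itv /=; apply: (le_lt_trans (enorm_le (ltW p0) _)).
    by move=> i; have := bx i; rewrite !mxE => /andP[x0 x1]; rewrite ger0_norm.
  rewrite invfM mulrCA divff ?pnatr_eq0 -?lt0n// mulr1 invf_lt1//; lra.
have fn : nu `]-oo, 1[ \is a fin_num by rewrite ge0_fin_numE.
by rewrite /ballc fineK//; split => //; rewrite fine_gt0// pos.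
Qed.

Lemma ballc_gt0 : 0 < ballc. Proof. by have [] := ballcE. Qed.

(** The dilation by [x] maps the unit ball to the ball of radius [x] and multiplies volumes by
    [x^N]. *)
Lemma radm_itv (x : R) : 0 < x -> nu `]-oo, x[ = (ballc * x ^+ N)%:E.
Proof.
move=> x0; have [b1 _] := ballcE.
have mi (z : R) : measurable_fun [set: R] (fun y : R => (\1_(`]-oo, z[ : set R) y : R)%:E).
  by apply/measurable_EFinP; exact: measurable_indic.
have E := @ge0_integral_radm_scale R N x^-1 (fun y => (\1_(`]-oo, 1[ : set R) y)%:E) _ (mi 1) _.
rewrite -[X in nu X = _]setIT -integral_indic//.
transitivity (\int[nu]_r (\1_(`]-oo, 1%R[ : set R) (x^-1 * r)%R)%:E)%E.
  apply: eq_integral => r _; congr (_%:E); rewrite !indicE !mem_setE !in_itv/=.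
  by rewrite mulrC ltr_pdivrMr// mul1r.
rewrite E ?invr_gt0//.
  have -> : (\int[nu]_r (\1_(`]-oo, 1%R[ : set R) r : R)%:E = ballc%:E)%E.
    by rewrite integral_indic// setIT; exact: b1.
  by rewrite invrK -EFinM mulrC.
Qed.

(** The factor [ballc * N] is the area of the unit sphere. *)
Definition polar_density (r : R) : R := if r < 0 then 0 else ballc * N%:R * r ^+ N.-1.

Lemma polar_density_ge0 r : 0 <= polar_density r.
Proof.
by rewrite /polar_density; case: ltP => // r0; rewrite !mulr_ge0 ?exprn_ge0// ltW// ballc_gt0.
Qed.

Lemma measurable_polar_density : measurable_fun [set: R] polar_density.
Proof.
apply: measurable_fun_ifT => //; first exact: measurable_fun_ltr.
by apply: measurable_funM => //; exact: measurable_funX.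
Qed.

Definition polar_measure (A : set (measurableTypeR R)) : \bar R := (\int[leb]_(x in A) (polar_density x)%:E)%E.
Let pdens0 : polar_measure set0 = 0%E. Proof. exact: integral_set0. Qed.
Let pdens_ge0 A : (0 <= polar_measure A)%E.
Proof. by apply: integral_ge0 => x _; rewrite lee_fin polar_density_ge0. Qed.
Let dens_sigma_additive : semi_sigma_additive polar_measure.
Proof.
move=> F mF tF mUF; rewrite /polar_measure ge0_integral_bigcup//=.
- apply: is_cvg_ereal_nneg_natsum_cond => n _ _.
  by apply: integral_ge0 => /= x ?; rewrite lee_fin polar_density_ge0.
- by apply/measurable_EFinP; apply: measurable_funTS; exact: measurable_polar_density.
- by move=> x _; rewrite lee_fin polar_density_ge0.
Qed.
HB.instance Definition _ := isMeasure.Build _ _ _ polar_measure pdens0 pdens_ge0 dens_sigma_additive.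

Let dens_itv (x : R) : 0 < x -> polar_measure `]-oo, x[ = (ballc * x ^+ N)%:E.
Proof.
move=> x0; rewrite /polar_measure.
rewrite (_ : `]-oo, x[%classic = `]-oo, 0[ `|` `[0, x[); last first.
  by apply/seteqP; split => y /=; rewrite !in_itv/=; [move=> yx; case: (ltP y 0) => y0; [left|right]; rewrite ?yx ?andbT//|move=> [|/andP[_ //]]; lra].
have md (A : set R) : measurable A -> measurable_fun A (fun x => (polar_density x)%:E).
  move=> mA; apply/measurable_EFinP; apply: measurable_funTS; exact: measurable_polar_density.
rewrite ge0_integral_setU//=; last 3 first.
- by apply: md; exact: measurableU.
- by move=> y _; rewrite lee_fin polar_density_ge0.
- by apply/disj_setPS => y /=; rewrite !in_itv/=; lra.
rewrite integral0_eq ?add0e; last first.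
  by move=> y /=; rewrite in_itv/= /polar_density => ->.
rewrite (integral_itv_bndo_bndc (md _ _))//.
transitivity (\int[leb]_(y in `[0%R, x]) ((ballc * N%:R)%:E * (y ^+ N.-1)%:E))%E.
  apply: eq_integral => y; rewrite inE /= in_itv /= /polar_density => /andP[y0 _].
  by rewrite ltNge y0.
rewrite ge0_integralZl//.
- rewrite integral_exprn ?ltW// -EFinM prednK//; congr (_%:E).
  by field; rewrite pnatr_eq0 -lt0n.
- by apply/measurable_EFinP; exact: measurable_funX.
- by move=> y /=; rewrite in_itv/= => /andP[y0 _]; rewrite lee_fin exprn_ge0.
- by rewrite lee_fin mulr_ge0// ltW// ballc_gt0.
Qed.

(** The half-lines []-oo, x[] form a generating class stable under intersection. Both measures give
    them [ballc x^N], or 0 when [x <= 0], and uniqueness of measures applies. *)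
Let nu_dens A : measurable A -> nu A = polar_measure A.
Proof.
move: A; apply: (@measure_unique _ R (measurableTypeR R) (@RGenInftyO.G R) (fun k => `]-oo, k%:R[%classic) _ _ _ _ nu polar_measure) => //.
- exact: RGenInftyO.measurableE.
- move=> _ _ [x ->] [y ->]; exists (Num.min x y).
  by apply/seteqP; split => z /=; rewrite !in_itv/= lt_min; [move=> [-> ->]|move=> /andP[]].
- by move=> i; exists i%:R.
- apply/seteqP; split => // x _; exists (Num.truncn `|x|).+1 => //=; rewrite in_itv/=.
  by rewrite (le_lt_trans (ler_norm x))// truncnS_gt.
- move=> _ [x ->]; have [x0|x0] := ltP 0 x; first by
    transitivity (ballc * x ^+ N)%:E; [exact: radm_itv|exact/esym/dens_itv].
  transitivity (0%E : \bar R); last first.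
    apply/esym/integral0_eq => y /=.
    by rewrite in_itv/= /polar_density => yx; rewrite ifT//; lra.
  suff z : nu (`]-oo, x[%classic : set (measurableTypeR R)) = 0%E by exact: z.
  transitivity (lebesgue_rV R N set0); last exact: measure0.
  congr (lebesgue_rV R N _).
  apply/seteqP; split => // y /=; rewrite in_itv/= => yx.
  by have := enorm_ge0 y; lra.
- move=> k; case: k => [|k].
    apply: (@le_lt_trans _ _ (nu `]-oo, 1%R[)%E); last by have [b1 _] := ballcE; apply: (@eq_ind_r _ _ (fun z => z < +oo)%E _ _ b1); rewrite ltry.
    by apply: le_measure; rewrite ?inE// => y /=; rewrite !in_itv/=; lra.
  by apply: (@eq_ind_r _ _ (fun z => z < +oo)%E _ _ (radm_itv _)); rewrite ?ltry ?ltr0n.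
Qed.

Lemma ge0_integral_polar (f : R -> \bar R) : measurable_fun [set: R] f ->
  (forall r, 0 <= f r)%E ->
  (\int[nu]_r f r = \int[leb]_r (f r * (polar_density r)%:E))%E.
Proof.
move=> mf f0.
exact: (@ge0_integral_density _ (measurableTypeR R) R leb nu polar_density polar_density_ge0 measurable_polar_density nu_dens f mf f0).
Qed.

End polar.

(** * Radial profiles *)

Section real_integrals.
Context d (T : measurableType d) (R : realType) (mu : {measure set T -> \bar R}).
Implicit Types f g : T -> R.
Local Notation L1 f := (mu.-integrable setT (EFin \o f)).

Lemma L1_measurable f : L1 f -> measurable_fun setT f.
Proof. by move=> /measurable_int /measurable_EFinP. Qed.

Lemma L1_dominated f g : measurable_fun setT f -> L1 g ->
  (forall x, `|f x| <= g x) -> L1 f.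
Proof.
move=> mf ig fg; apply: (le_integrable measurableT _ _ ig).
  exact/measurable_EFinP.
by move=> x _ /=; rewrite lee_fin (le_trans (fg x))// ler_norm.
Qed.

Lemma L1D f g : L1 f -> L1 g -> L1 (fun x => f x + g x).
Proof. by move=> fi gi; have := integrableD measurableT fi gi. Qed.

Lemma L1B f g : L1 f -> L1 g -> L1 (fun x => f x - g x).
Proof. by move=> fi gi; have := integrableB measurableT fi gi. Qed.

Lemma L1Z (k : R) f : L1 f -> L1 (fun x => k * f x).
Proof. by move=> fi; have := @integrableZl _ _ _ mu _ measurableT k _ fi. Qed.

Lemma L1_fin f : measurable_fun setT f -> (forall x, 0 <= f x) ->
  (\int[mu]_x (f x)%:E < +oo)%E -> L1 f.
Proof.
move=> mf f0 fi; apply/integrableP; split; first exact/measurable_EFinP.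
by under eq_integral do rewrite /= ger0_norm//.
Qed.

Lemma L1_EFin f : L1 f -> (\int[mu]_x (f x)%:E)%E = (\int[mu]_x f x)%:E.
Proof. by move=> fi; rewrite /Rintegral fineK//; exact: integrable_fin_num fi. Qed.

Lemma L1_ae_eq f : L1 f -> (forall x, 0 <= f x) -> \int[mu]_x f x <= 0 ->
  {ae mu, forall x, f x = 0}.
Proof.
move=> fi f0 If.
have mf := L1_measurable fi.
have I0 : (\int[mu]_x `|(EFin \o f) x| = 0)%E.
  under eq_integral do rewrite /= ger0_norm//.
  rewrite L1_EFin//; congr (_%:E); apply/eqP; rewrite eq_le If/=.
  exact: Rintegral_ge0.
have mfE : measurable_fun setT (EFin \o f) by exact/measurable_EFinP.
have /(ae_eq_integral_abs mu measurableT mfE) := I0.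
by apply: filterS => x /(_ I) /= [].
Qed.

Lemma ge0_le_L1 f g : (forall x, 0 <= f x <= g x) -> measurable_fun setT f ->
  L1 g -> L1 f.
Proof.
move=> fg mf gi; apply: (L1_dominated mf gi) => x.
by have /andP[f0 fgx] := fg x; rewrite ger0_norm.
Qed.

Lemma L1_prod f g : measurable_fun setT f -> measurable_fun setT g ->
  L1 (fun x => f x ^+ 2) -> L1 (fun x => g x ^+ 2) -> L1 (fun x => f x * g x).
Proof.
move=> mf mg f2 g2; apply: (L1_dominated _ (L1D f2 g2)).
  exact: measurable_funM.
move=> x; rewrite normrM -[f x ^+ 2]real_normK ?num_real// -[g x ^+ 2]real_normK ?num_real//.
have := sqr_ge0 (`|f x| - `|g x|); have := sqr_ge0 (`|f x| + `|g x|); nra.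
Qed.

Lemma RintegralT_le f g : L1 f -> L1 g -> (forall x, f x <= g x) ->
  \int[mu]_x f x <= \int[mu]_x g x.
Proof. by move=> fi gi fg; apply: le_Rintegral. Qed.

Lemma RintegralT_D f g : L1 f -> L1 g ->
  \int[mu]_x (f x + g x) = \int[mu]_x f x + \int[mu]_x g x.
Proof. exact: RintegralD. Qed.

Lemma RintegralT_B f g : L1 f -> L1 g ->
  \int[mu]_x (f x - g x) = \int[mu]_x f x - \int[mu]_x g x.
Proof. exact: RintegralB. Qed.

Lemma RintegralT_Z (k : R) f : L1 f ->
  \int[mu]_x (k * f x) = k * \int[mu]_x f x.
Proof. exact: RintegralZl. Qed.

End real_integrals.

(** * Tails of slope densities *)

Section tail.
Variable R : realType.
Local Notation leb := (@lebesgue_measure R).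
Implicit Types (W V : R -> R) (r s : R).

Definition tail W r : R := \int[leb]_(t in `[r, +oo[) W t.

(** The slope is a function on all of [R], set to zero at negative radii, so that its tail is
    constant there and no restriction to the half-line is carried around. *)
Definition density_profile W := [/\ measurable_fun [set: R] W,
  (forall t, 0 <= W t <= 1), (forall t, t < 0 -> W t = 0) &
  leb.-integrable setT (EFin \o W)].

Let integrable_sub W (D : set R) : leb.-integrable setT (EFin \o W) -> measurable D ->
  leb.-integrable D (EFin \o W).
Proof. by move=> iW mD; apply: integrableS iW. Qed.

Lemma tail_split W r s : leb.-integrable setT (EFin \o W) -> r <= s ->
  tail W r = \int[leb]_(t in `[r, s[) W t + tail W s.
Proof.
move=> iW rs; rewrite /tail (_ : `[r, +oo[%classic = `[r, s[ `|` `[s, +oo[).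
  rewrite Rintegral_setU//; first by apply: integrable_sub => //; exact: measurableU.
  by apply/disj_setPS => y /= []; rewrite !in_itv/= andbT; lra.
apply/seteqP; split => y /=; rewrite !in_itv/= ?andbT.
  by move=> ry; case: (ltP y s) => ys; [left|right]; rewrite ?ry.
by move=> [/andP[]//|]; lra.
Qed.

Lemma tail_ge0 W r : (forall t, 0 <= W t) -> 0 <= tail W r.
Proof. by move=> W0; exact: Rintegral_ge0. Qed.

Lemma Rintegral_itv_cst r s : r <= s -> \int[leb]_(_ in `[r, s[) 1 = s - r.
Proof.
move=> rs; rewrite Rintegral_cst// mul1r.
transitivity (fine (lebesgue_measure (`[r, s[%classic : set R))) => //.
rewrite lebesgue_measure_itv/= lte_fin.
by case: ltP => //= sr; apply/esym/eqP; rewrite subr_eq0 eq_le rs sr.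
Qed.

Lemma integrable_itv_cst r s (k : R) : leb.-integrable `[r, s[ (EFin \o fun=> k).
Proof.
apply: measurable_bounded_integrable => //.
- apply: (@le_lt_trans _ _ (lebesgue_measure (`[r, s[%classic : set R))) => //.
  by rewrite lebesgue_measure_itv/=; case: ifP => // _; rewrite -EFinB ltry.
- by exists `|k|; split => // x kx y _ /=; exact: ltW.
Qed.

Lemma tail_lip W r s : density_profile W -> r <= s ->
  0 <= tail W r - tail W s <= s - r.
Proof.
move=> [mW W01 _ iW] rs; rewrite (tail_split iW rs) addrK.
rewrite Rintegral_ge0/=; last by move=> x _; have /andP[] := W01 x.
rewrite -(Rintegral_itv_cst rs) le_Rintegral//.
- exact: integrable_sub.
- exact: integrable_itv_cst.
- by move=> x _; have /andP[] := W01 x.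
Qed.

Lemma tail_lip_norm W r s : density_profile W -> `|tail W r - tail W s| <= `|r - s|.
Proof.
move=> dW; wlog rs : r s / r <= s.
  by move=> H; have [/H//|/ltW/H] := leP r s; rewrite distrC [X in _ <= X]distrC.
have /andP[h1 h2] := tail_lip dW rs.
by rewrite ger0_norm// distrC ger0_norm// subr_ge0.
Qed.

Lemma tail_nonincr W r s : density_profile W -> r <= s -> tail W s <= tail W r.
Proof. by move=> dW rs; have /andP[] := tail_lip dW rs; rewrite subr_ge0. Qed.

Lemma continuous_tail W : density_profile W -> continuous (tail W).
Proof.
move=> dW x; apply/cvgrPdist_lt => e e0.
apply: filterS (nbhsx_ballx x e e0) => y; rewrite /ball/= => xy.
exact: le_lt_trans (tail_lip_norm _ _ dW) xy.
Qed.

Lemma measurable_tail W : density_profile W -> measurable_fun [set: R] (tail W).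
Proof. by move=> dW; apply: continuous_measurable_fun; exact: continuous_tail. Qed.

Lemma tail_neg W r : density_profile W -> r <= 0 -> tail W r = tail W 0.
Proof.
move=> [_ _ Wn iW] r0; rewrite (tail_split iW r0) (@eq_Rintegral _ _ _ _ _ (cst 0)).
  by rewrite Rintegral_cst// mul0r add0r.
by move=> x; rewrite inE/= in_itv/= => /andP[_ x0]; rewrite Wn.
Qed.

Lemma tail_comb W V (a b : R) : leb.-integrable setT (EFin \o W) ->
  leb.-integrable setT (EFin \o V) ->
  forall r, tail (fun t => a * W t + b * V t) r = a * tail W r + b * tail V r.
Proof.
move=> iW iV r; rewrite /tail.
rewrite RintegralD//; last 2 first.
- by apply: integrable_sub => //; have := L1Z a iW.
- by apply: integrable_sub => //; have := L1Z b iV.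
by rewrite !RintegralZl//; exact: integrable_sub.
Qed.

Lemma profile_comb W V (a b : R) : density_profile W -> density_profile V ->
  0 <= a -> 0 <= b -> a + b = 1 -> density_profile (fun t => a * W t + b * V t).
Proof.
move=> [mW W01 Wn iW] [mV V01 Vn iV] a0 b0 ab; split.
- by apply: measurable_funD; exact: measurable_funM.
- by move=> t; have /andP[? ?] := W01 t; have /andP[? ?] := V01 t; apply/andP; split; nra.
- by move=> t t0; rewrite Wn// Vn// !mulr0 addr0.
- by apply: L1D; exact: L1Z.
Qed.

Lemma ge0_tailE W r : measurable_fun [set: R] W -> (forall t, 0 <= W t) ->
  leb.-integrable setT (EFin \o W) ->
  (\int[leb]_(t in `[r, +oo[) (W t)%:E = (tail W r)%:E)%E.
Proof.
move=> mW W0 iW; rewrite /tail /Rintegral fineK//.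
by apply: integrable_fin_num => //; exact: integrable_sub.
Qed.

End tail.

Section powers.
Variable R : realType.
Implicit Types x y p C : R.

Lemma powR_split1 x p : 0 <= x -> 2 < p -> x `^ (p - 1) = x `^ (p - 2) * x.
Proof.
by move=> x0 p2; rewrite -(mulr_powRB1 x0 (p := p - 1)) ?subr_gt0; [rewrite mulrC; congr (_ `^ _ * _); ring|lra].
Qed.

Lemma powR_split x p : 0 <= x -> 2 < p -> x `^ p = x `^ (p - 2) * x ^+ 2.
Proof.
move=> x0 p2; rewrite -(mulr_powRB1 x0 (p := p)); last lra.
by rewrite powR_split1// mulrC -mulrA -expr2.
Qed.

(** Convexity of the power, read off from Young's inequality for [x] and [y^(p-1)] with the
    exponents [p] and [p / (p - 1)]. *)
Lemma powR_ge_tangent x y p : 0 <= x -> 0 <= y -> 1 < p ->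
  y `^ p + p * y `^ (p - 1) * (x - y) <= x `^ p.
Proof.
move=> x0 y0 p1.
have p0 : 0 < p by lra.
have q0 : 0 < p / (p - 1) by rewrite divr_gt0//; lra.
have := @conjugate_powR R x (y `^ (p - 1)) p (p / (p - 1)) x0 (powR_ge0 _ _) p0 q0.
rewrite -powRrM (_ : (p - 1) * (p / (p - 1)) = p); last by field; lra.
have -> : p^-1 + (p / (p - 1))^-1 = 1 by field; apply/andP; split; lra.
move=> /(_ erefl); rewrite (_ : x `^ p / p + y `^ p / (p / (p - 1)) = (x `^ p + (p - 1) * y `^ p) / p).
  rewrite ler_pdivlMr// -(mulr_powRB1 y0 p0); nra.
by field; apply/andP; split; lra.
Qed.

(** The tangent at the larger of the two points bounds the increment. *)
Lemma powR_lip x y p C : 0 <= x <= C -> 0 <= y <= C -> 1 < p ->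
  `|x `^ p - y `^ p| <= p * C `^ (p - 1) * `|x - y|.
Proof.
move=> xC yC p1; wlog xy : x y xC yC / x <= y.
  by move=> H; have [/H->//|/ltW/H] := leP x y; rewrite distrC [X in _ * X]distrC => ->.
move: xC yC => /andP[x0 xC] /andP[y0 yC].
have := powR_ge_tangent x0 y0 p1.
have xyp : x `^ p <= y `^ p by apply: ge0_ler_powR => //; lra.
have yCp : y `^ (p - 1) <= C `^ (p - 1).
  by apply: ge0_ler_powR => //; rewrite ?nnegrE; lra.
rewrite ler0_norm ?subr_le0// ler0_norm ?subr_le0// => h.
have : p * y `^ (p - 1) * (y - x) <= p * C `^ (p - 1) * (y - x).
  by rewrite ler_wpM2r ?subr_ge0// ler_wpM2l//; lra.
lra.
Qed.

End powers.

(** * Profiles of finite energy: decay and control of the L^p term by the mass *)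

Section radial_profiles.
Variables (R : realType) (N : nat).
Hypothesis N0 : (0 < N)%N.
Local Notation nu := (@radm R N).
Local Notation leb := (@lebesgue_measure R).
Local Notation L1 f := (nu.-integrable setT (EFin \o f)).
Implicit Types (W V : R -> R) (r s : R).

(** The two integrability conditions say that [x |-> tail W |x|] and its gradient are square
    integrable over R^N. Higher integrability of the gradient then follows from [W <= 1]. *)
Definition profile W := [/\ density_profile W, L1 (fun r => W r ^+ 2) &
  L1 (fun r => tail W r ^+ 2)].

Definition mass_of W : R := \int[nu]_r (tail W r ^+ 2).

Local Notation mass := mass_of.

Lemma integral_ball r : 0 < r ->
  (\int[nu]_x (\1_(`]-oo, r[ : set R) x)%:E = (ballc R N * r ^+ N)%:E)%E.
Proof. by move=> r0; rewrite integral_indic// setIT; exact: radm_itv. Qed.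

Lemma L1_ball r (k : R) : 0 < r -> L1 (fun x => k * \1_(`]-oo, r[ : set R) x).
Proof.
move=> r0; apply: L1Z; apply: L1_fin => //.
  by rewrite integral_ball// ltry.
Qed.

Lemma Rintegral_ball r (k : R) : 0 < r ->
  \int[nu]_x (k * \1_(`]-oo, r[ : set R) x) = k * (ballc R N * r ^+ N).
Proof.
move=> r0; rewrite RintegralZl//.
  by congr (_ * _); rewrite /Rintegral integral_ball.
by have := L1_ball 1 r0; under eq_fun do rewrite mul1r.
Qed.

Lemma profile_tail_ge0 W r : density_profile W -> 0 <= tail W r.
Proof. by move=> [_ W01 _ _]; apply: tail_ge0 => t; have /andP[] := W01 t. Qed.

Lemma mass_ge0 W : 0 <= mass W.
Proof. by apply: Rintegral_ge0 => x _; exact: sqr_ge0. Qed.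

(** The tail is nonincreasing, hence at least [tail W r] on the whole ball of radius [r]. This decay
    estimate does the work of a radial Sobolev inequality. *)
Lemma mass_ge_ball W r : profile W -> 0 < r ->
  tail W r ^+ 2 * (ballc R N * r ^+ N) <= mass W.
Proof.
move=> [dW _ iU] r0; rewrite -Rintegral_ball// le_Rintegral//; first exact: L1_ball.
move=> x _; rewrite indicE mem_setE in_itv/=; case: ltP => xr; last by rewrite mulr0 sqr_ge0.
by rewrite mulr1 lerXn2r ?nnegrE ?profile_tail_ge0// tail_nonincr// ltW.
Qed.

(** The mass bounds the tail at radius 1 by the square root; going back from 1 to 0, a slope of at
    most 1 adds at most 1. *)
Definition tail_bound (m : R) := Num.sqrt (m / ballc R N) + 1.

Lemma tail_bound_gt0 m : 0 < tail_bound m.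
Proof. by rewrite ltr_wpDl// sqrtr_ge0. Qed.

Let tail_sqrt W r m : profile W -> mass W <= m -> 0 < r ->
  Num.sqrt (r ^+ N) * tail W r <= Num.sqrt (m / ballc R N).
Proof.
move=> pW mW r0; have [dW _ _] := pW; have c0 := ballc_gt0 R N0.
have rN : 0 <= r ^+ N by rewrite exprn_ge0// ltW.
rewrite -[X in _ * X](ger0_norm (profile_tail_ge0 r dW)) -sqrtr_sqr -sqrtrM//.
rewrite ler_wsqrtr// ler_pdivlMr//; apply: le_trans mW.
by apply: le_trans (mass_ge_ball pW r0); rewrite le_eqVlt; apply/orP; left; apply/eqP; ring.
Qed.

Lemma tail_le_bound W r m : profile W -> mass W <= m -> tail W r <= tail_bound m.
Proof.
move=> pW mW; have [dW _ _] := pW; have [_ _ Wn iW] := dW.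
have t1 := tail_sqrt pW mW ltr01; rewrite expr1n sqrtr1 mul1r in t1.
have t01 : tail W 0 <= tail W 1 + 1.
  by have /andP[_] := tail_lip dW (ler01 : (0 : R) <= 1); rewrite subr0 lerBlDl addrC.
have tr0 : tail W r <= tail W 0.
  have [r0|r0] := leP 0 r; first exact: tail_nonincr.
  by rewrite (tail_neg dW (ltW r0)).
by rewrite (le_trans tr0)// (le_trans t01)// lerD2r.
Qed.

Hypothesis N2 : (2 <= N)%N.

(** For [r >= 1] one has [r <= sqrt (r^N)], as [N >= 2], and the mass bound applies; for [r <= 1]
    boundedness of the tail is enough. The rate [1 / r] serves both the compactness of tails and the
    bound on the flux. *)
Lemma tail_decay W r m : profile W -> mass W <= m -> 0 < r ->
  r * tail W r <= tail_bound m.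
Proof.
move=> pW mW r0; have [dW _ _] := pW.
have U0 := profile_tail_ge0 r dW.
have [r1|r1] := leP r 1.
  by apply: le_trans (tail_le_bound r pW mW); rewrite ler_piMl.
apply: (@le_trans _ _ (Num.sqrt (m / ballc R N))); last by rewrite lerDl.
apply: le_trans (tail_sqrt pW mW r0); rewrite ler_wpM2r//.
rewrite -[X in X <= _](ger0_norm (ltW r0)) -sqrtr_sqr ler_wsqrtr//.
by rewrite ler_weXn2l// ltW.
Qed.

Lemma profileC W V (a b : R) : profile W -> profile V -> 0 <= a -> 0 <= b -> a + b = 1 ->
  profile (fun t => a * W t + b * V t).
Proof.
move=> [dW W2 UW] [dV V2 UV] a0 b0 ab.
have dWV := profile_comb dW dV a0 b0 ab.
have cvx x y : (a * x + b * y) ^+ 2 <= x ^+ 2 + y ^+ 2.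
  have -> : (a * x + b * y) ^+ 2 = a * x ^+ 2 + b * y ^+ 2 - a * b * (x - y) ^+ 2.
    by have -> : b = 1 - a by [rewrite -ab; ring]; ring.
  have : 0 <= a * b * (x - y) ^+ 2 by rewrite mulr_ge0 ?sqr_ge0// mulr_ge0.
  have : a * x ^+ 2 <= x ^+ 2 by rewrite ler_piMl ?sqr_ge0//; lra.
  have : b * y ^+ 2 <= y ^+ 2 by rewrite ler_piMl ?sqr_ge0//; lra.
  lra.
split => //.
- apply: (ge0_le_L1 _ _ (L1D W2 V2)) => [x|].
    by rewrite sqr_ge0 cvx.
  by apply: measurable_funX; case: dWV.
- apply: (ge0_le_L1 _ _ (L1D UW UV)) => [x|].
    rewrite sqr_ge0/= tail_comb ?cvx//; by [case: dW|case: dV].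
  by apply: measurable_funX; exact: measurable_tail.
Qed.

Variable p : R.
Hypothesis p2 : 2 < p.

Definition pmass_of W : R := \int[nu]_r (tail W r `^ p).

Local Notation pmass := pmass_of.

Lemma measurable_tail_powR W q : density_profile W ->
  measurable_fun [set: R] (fun r => tail W r `^ q).
Proof. by move=> dW; exact: (measurableT_comp (f := @powR R ^~ q) (measurable_powR q) (measurable_tail dW)). Qed.

Lemma tail_powR_le W r m : profile W -> mass W <= m ->
  tail W r `^ p <= tail_bound m `^ (p - 2) * tail W r ^+ 2.
Proof.
move=> pW mW; have [dW _ _] := pW; have U0 := profile_tail_ge0 r dW.
rewrite powR_split// ler_wpM2r ?sqr_ge0//.
apply: ge0_ler_powR; rewrite ?nnegrE//; [by rewrite subr_ge0 ltW|exact/ltW/tail_bound_gt0|exact: tail_le_bound].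
Qed.

Lemma L1_tail_powR W : profile W -> L1 (fun r => tail W r `^ p).
Proof.
move=> pW; have [dW _ UW] := pW.
apply: (ge0_le_L1 _ _ (L1Z (tail_bound (mass W) `^ (p - 2)) UW)) => [x|].
  by rewrite powR_ge0 tail_powR_le.
exact: measurable_tail_powR.
Qed.

Lemma pmass_le W m : profile W -> mass W <= m ->
  pmass W <= tail_bound m `^ (p - 2) * m.
Proof.
move=> pW mW; have [dW _ UW] := pW.
apply: (@le_trans _ _ (tail_bound m `^ (p - 2) * mass W)); last first.
  by rewrite ler_wpM2l// powR_ge0.
rewrite -RintegralZl// le_Rintegral//; first exact: L1_tail_powR.
- exact: L1Z.
- by move=> x _; exact: tail_powR_le.
Qed.

(** Outside a large ball the tails are so small that [U^p <= eta U^2], and the mass bounds this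
    contribution, because [p > 2]. Inside the ball, which has finite measure, the power is Lipschitz
    on [[0, C]]. So uniformly close tails have close L^p terms. *)
Lemma pmass_unif_continuous (m e : R) : 0 < m -> 0 < e -> exists2 d, 0 < d &
  forall W V, profile W -> profile V -> mass W <= m -> mass V <= m ->
  (forall r, `|tail W r - tail V r| <= d) -> `|pmass W - pmass V| <= e.
Proof.
move=> m0 e0; set C := tail_bound m.
have C0 : 0 < C := tail_bound_gt0 m.
have p20 : 0 < p - 2 by rewrite subr_gt0.
pose eta := e / (4 * m).
have eta0 : 0 < eta by rewrite divr_gt0// mulr_gt0.
have etaE : eta * m = e / 4 by rewrite /eta; field; rewrite gt_eqF.
clearbody eta.
(* the tail radius A solves (C / A)^(p-2) = eta *)
pose A := C / eta `^ (p - 2)^-1.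
have A0 : 0 < A by rewrite divr_gt0// powR_gt0.
have CE : C = A * eta `^ (p - 2)^-1 by rewrite mulfVK// gt_eqF// powR_gt0.
clearbody A.
pose K := p * C `^ (p - 1) * (ballc R N * A ^+ N).
have K0 : 0 < K.
  rewrite !mulr_gt0 ?powR_gt0 ?exprn_gt0//; first lra.
  exact: ballc_gt0.
exists (e / (2 * K)); first by rewrite divr_gt0// mulr_gt0.
set d := e / _.
have dE : p * C `^ (p - 1) * d * (ballc R N * A ^+ N) = e / 2.
  have -> : d = e / 2 / K by rewrite /d invfM mulrA.
  have K1 : K != 0 by rewrite gt_eqF.
  by rewrite -[RHS](mulfVK K1) /K; ring.
have d0 : 0 < d by rewrite divr_gt0// mulr_gt0.
clearbody d => {K K0}.
move=> W V pW pV mW mV UWV.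
have [dW _ UW] := pW; have [dV _ UV] := pV.
have far X r : profile X -> mass X <= m -> A <= r -> tail X r `^ p <= eta * tail X r ^+ 2.
  move=> pX mX Ar; have [dX _ _] := pX; have U0 := profile_tail_ge0 r dX.
  have r0 : 0 < r by apply: lt_le_trans Ar.
  rewrite powR_split// ler_wpM2r ?sqr_ge0//.
  have -> : eta = (eta `^ (p - 2)^-1) `^ (p - 2).
    by rewrite -powRrM mulVf ?powRr1// ?ltW// gt_eqF.
  apply: ge0_ler_powR; rewrite ?nnegrE ?powR_ge0//; first exact: ltW.
  have := tail_decay pX mX r0; rewrite -/C => h.
  rewrite -(ler_pM2l A0) -CE; apply: le_trans h; exact: ler_wpM2r.
have key r : `|tail W r `^ p - tail V r `^ p| <=
    eta * tail W r ^+ 2 + eta * tail V r ^+ 2 + p * C `^ (p - 1) * d * \1_(`]-oo, A[ : set R) r.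
  rewrite indicE mem_setE in_itv/=; case: ltP => rA.
    rewrite mulr1 -[X in X <= _]add0r lerD//.
      by rewrite addr_ge0// mulr_ge0 ?sqr_ge0// ltW.
    apply: (le_trans (powR_lip (C := C) _ _ _)); rewrite ?profile_tail_ge0 ?tail_le_bound//; first lra.
    by rewrite ler_wpM2l// mulr_ge0 ?powR_ge0//; lra.
  rewrite mulr0 addr0; have := far W r pW mW rA; have := far V r pV mV rA.
  have := powR_ge0 (tail W r) p; have := powR_ge0 (tail V r) p.
  by rewrite ler_norml => {UW UV}; move: (tail W r `^ p) (tail V r `^ p) (eta * _) (eta * _); clear => a b c d *; lra.
have iW := L1_tail_powR pW; have iV := L1_tail_powR pV.
rewrite /pmass -(RintegralB measurableT iW iV).
apply: (le_trans (le_normr_Rintegral measurableT (L1B iW iV))).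
apply: (@le_trans _ _ (\int[nu]_r (eta * tail W r ^+ 2 + eta * tail V r ^+ 2 + p * C `^ (p - 1) * d * \1_(`]-oo, A[ : set R) r))).
  apply: RintegralT_le; last exact: key.
  - by have := integrable_abse (L1B iW iV).
  - apply: L1D; last exact: L1_ball.
    by apply: L1D; exact: L1Z.
rewrite (RintegralD measurableT (L1D (L1Z _ UW) (L1Z _ UV)) (L1_ball _ A0)).
rewrite (RintegralD measurableT (L1Z _ UW) (L1Z _ UV)) (Rintegral_ball _ A0).
rewrite (RintegralZl _ measurableT UW) (RintegralZl _ measurableT UV).
rewrite dE -/(mass W) -/(mass V) => {key far iW iV UWV}.
have : eta * mass W <= eta * m by rewrite ler_wpM2l// ltW.
have : eta * mass V <= eta * m by rewrite ler_wpM2l// ltW.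
move: (mass W) (mass V) etaE; clear => *; lra.
Qed.

End radial_profiles.

(** * Existence of a minimiser *)

Section convergence.
Context d (T : measurableType d) (R : realType) (mu : {measure set T -> \bar R}).
Local Notation L1 f := (mu.-integrable setT (EFin \o f)).

Lemma fatou_L1 (f_ : nat -> T -> R) (f : T -> R) (M : R) :
  (forall n, L1 (f_ n)) -> (forall n x, 0 <= f_ n x) ->
  measurable_fun setT f -> (forall x, 0 <= f x) ->
  {ae mu, forall x, f_ ^~ x @ \oo --> f x} ->
  (forall n, \int[mu]_x f_ n x <= M) ->
  L1 f /\ \int[mu]_x f x <= M.
Proof.
move=> if_ f_0 mf f0 f_f fM.
have mf_ n : measurable_fun setT (EFin \o f_ n) by case/integrableP : (if_ n).
have le : (\int[mu]_x (f x)%:E <= M%:E)%E.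
  have -> : (\int[mu]_x (f x)%:E = \int[mu]_x limn_einf (fun n => (f_ n x)%:E))%E.
    apply: ae_eq_integral => //.
    - exact/measurable_EFinP.
    - apply: measurableT_comp => //; apply: measurable_fun_limn_esup => n.
      by apply: measurableT_comp => //; exact: mf_.
    - apply: filterS f_f => x fx _; apply/esym.
      have := @cvg_limn_einf_sup _ (fun n => (f_ n x)%:E) (f x)%:E _.
      by case => //; apply/fine_cvgP; split; [exact: nearW|exact: fx].
  apply: (le_trans (fatou mu measurableT (f := fun n => EFin \o f_ n) _ _)) => //.
    by move=> n x _; rewrite lee_fin.
  rewrite limn_einf_lim; apply: lime_le.
    exact: is_cvg_einfs.
  apply: nearW => n; apply: (le_trans (ereal_inf_lbound _)).
    by exists n => //=; exact: leqnn.
  by rewrite L1_EFin// lee_fin.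
have fi : L1 f by apply: L1_fin => //; apply: le_lt_trans le _; rewrite ltry.
by split => //; rewrite -lee_fin -L1_EFin.
Qed.

Lemma fast_cauchy_cvg (u : nat -> R) (M : R) :
  (forall k, `|u k.+1 - u k| <= M * 2^-1 ^+ k) -> cvgn u.
Proof.
move=> uM.
have -> : u = (fun n => u 0%N + series (telescope u) n).
  by apply/funext => n; rewrite telescopeK addrC subrK.
apply: is_cvgD; first exact: is_cvg_cst.
apply: normed_cvg; apply: (@series_le_cvg _ _ (fun k => M * 2^-1 ^+ k)) => //.
- by move=> n; rewrite /= normr_ge0.
- by move=> n; exact: le_trans (normr_ge0 _) (uM n).
- apply: is_cvg_geometric_series.
  by rewrite ger0_norm ?invr_ge0// invf_lt1; lra.
Qed.

(** With the weight [4^k] the integrals of the squared increments still sum up, like [2^-k]. The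
    weighted sum [S] is therefore finite almost everywhere, and there the increments are at most
    [sqrt S * 2^-k]. *)
Lemma L2_fast_cauchy_ae (W : nat -> T -> R) (M : R) :
  (forall k, measurable_fun setT (W k)) ->
  (forall k, L1 (fun x => (W k.+1 x - W k x) ^+ 2)) ->
  (forall k, \int[mu]_x (W k.+1 x - W k x) ^+ 2 <= M * 8^-1 ^+ k) ->
  {ae mu, forall x, cvgn (W ^~ x)}.
Proof.
move=> mW iW WM.
pose f k x := 4 ^+ k * (W k.+1 x - W k x) ^+ 2.
have f0 k x : 0 <= f k x by rewrite mulr_ge0 ?sqr_ge0// exprn_ge0.
have fi k : L1 (f k) by exact: L1Z.
have mf k : measurable_fun setT (EFin \o f k) by case/integrableP : (fi k).
have M0 : 0 <= M.
  have := WM 0%N; rewrite expr0 mulr1; apply: le_trans.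
  by apply: Rintegral_ge0 => x _; exact: sqr_ge0.
have sumfin : (\int[mu]_x (\sum_(k <oo) (f k x)%:E) < +oo)%E.
  rewrite integral_nneseries//; last by move=> k x _; rewrite lee_fin.
  apply: (@le_lt_trans _ _ (\sum_(k <oo) (M * 2^-1 ^+ k)%:E)%E).
    apply: lee_nneseries => [k _ _|k _].
      by apply: integral_ge0 => x _; rewrite lee_fin.
    rewrite L1_EFin// lee_fin RintegralT_Z//.
    rewrite (le_trans (ler_wpM2l _ (WM k)))// ?exprn_ge0//.
    rewrite mulrCA -exprMn ler_wpM2l// le_eqVlt; apply/orP; left; apply/eqP; congr (_ ^+ _).
    by field.
  have h2 : `|2^-1 : R| < 1 by rewrite ger0_norm ?invr_ge0// invf_lt1; lra.
  have cg := @cvg_geometric_series R M 2^-1 h2.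
  rewrite (_ : (\sum_(k <oo) (M * 2^-1 ^+ k)%:E)%E = (M / (1 - 2^-1))%:E) ?ltry//.
  apply/cvg_lim => //.
  rewrite (_ : (fun n => _) = EFin \o series (geometric M 2^-1)).
    by apply/fine_cvgP; split; [exact: nearW|exact: cg].
  by apply/funext => n; rewrite /= /series/= sumEFin.
have mS : measurable_fun setT (fun x => \sum_(k <oo) (f k x)%:E)%E.
  by apply: (ge0_emeasurable_sum (P := xpredT)) => [k x _ _|k _]; [rewrite lee_fin|exact: mf].
have Si : mu.-integrable setT (fun x => \sum_(k <oo) (f k x)%:E)%E.
  apply/integrableP; split => //.
  rewrite (eq_integral (fun x => \sum_(k <oo) (f k x)%:E)%E) => [//|x _].
  by rewrite gee0_abs//; apply: nneseries_ge0 => k _ _; rewrite lee_fin.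
have := integrable_ae measurableT Si.
apply: filterS => x /(_ I) Sx.
set S := (\sum_(k <oo) (f k x)%:E)%E in Sx.
have S0 : (0 <= S)%E by apply: nneseries_ge0 => k _ _; rewrite lee_fin.
have fS k : f k x <= fine S.
  rewrite -lee_fin fineK//.
  apply: le_trans (nneseries_lim_ge k.+1 _) => [|i _ _]; last by rewrite lee_fin.
  rewrite big_nat_recr//= leeDr//; apply: sume_ge0 => i _; by rewrite lee_fin.
apply: (@fast_cauchy_cvg _ (Num.sqrt (fine S))) => k.
have := fS k; rewrite /f => h.
have e2 : (2^-1 ^+ k : R) = Num.sqrt ((4^-1) ^+ k).
  have -> : (4^-1 : R) = 2^-1 ^+ 2 by field.
  by rewrite -exprM mulnC exprM sqrtr_sqr ger0_norm// exprn_ge0// invr_ge0.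
rewrite e2 -sqrtrM ?fine_ge0// -sqrtr_sqr ler_wsqrtr//.
by rewrite exprVn ler_pdivlMr ?exprn_gt0// mulrC.
Qed.

End convergence.

Section lipschitz_compactness.
Variable R : realType.

Lemma ultra_fmap (T U : Type) (f : T -> U) (G : set_system T) :
  UltraFilter G -> UltraFilter (f @ G).
Proof.
move=> GU; have PG : ProperFilter G by exact: ultra_proper.
split; first exact: fmap_proper_filter.
move=> H PH fGH; apply/seteqP; split => // A HA.
have [//|GC] := in_ultra_setVsetC (f @^-1` A) GU.
have HC : H (~` A) by apply: fGH; exact: GC.
by exfalso; apply: (@filter_not_empty _ H PH); rewrite -(setICr A); exact: filterI.
Qed.

(* The pointwise limit along an ultrafilter; the Lipschitz bound makes the
   convergence uniform on compact sets and the decay makes it uniform on R. *)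
Lemma lipschitz_compact (F : nat -> R -> R) (C : R) :
  (forall n r s, `|F n r - F n s| <= `|r - s|) ->
  (forall n r, 0 <= F n r <= C) ->
  (forall n r, r < 0 -> F n r = F n 0) ->
  (forall n r, 0 < r -> r * F n r <= C) ->
  exists U : R -> R, forall d, 0 < d -> forall K, exists2 n, (K <= n)%N &
    forall r, `|F n r - U r| <= d.
Proof.
move=> Flip F0C Fneg Fdec.
have [G [GU ooG]] := @ultraFilterLemma nat \oo _.
have PG : ProperFilter G by exact: ultra_proper.
have /choice[U FU] : forall r : R, exists l : R, (fun n => F n r) @ G --> l.
  move=> r; have UF := ultra_fmap (fun n => F n r) GU.
  have := @segment_compact R 0 C; rewrite compact_ultra => /(_ _ UF)[|l [_ Fl]].
    by apply: nearW => n /=; rewrite in_itv/= F0C.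
  by exists l.
exists U => d d0 K.
have ex2 (P Q : set nat) : G P -> G Q -> exists n, P n /\ Q n.
  by move=> GP GQ; have /filter_ex : G (P `&` Q) by exact: filterI.
have near r (e : R) : 0 < e -> G [set n | `|U r - F n r| < e].
  by move=> e0; have /cvgrPdist_lt := FU r; exact.
have Ulip r s : `|U r - U s| <= `|r - s|.
  apply/ler_addgt0Pr => e e0.
  have e2 : 0 < e / 2 by rewrite divr_gt0.
  have [n [/= h1 h2]] := ex2 _ _ (near r _ e2) (near s _ e2).
  have := Flip n r s; move: h1 h2; rewrite !ltr_norml !ler_norml.
  by case: (lerP 0 (r - s)) => ? /andP[? ?] /andP[? ?] /andP[? ?]; apply/andP; split; lra.
have Uneg r : r < 0 -> U r = U 0.
  move=> r0; apply/eqP; rewrite -subr_eq0 -normr_le0; apply/ler_addgt0Pr => e e0.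
  have e2 : 0 < e / 2 by rewrite divr_gt0.
  have [n [/= h1 h2]] := ex2 _ _ (near r _ e2) (near 0 _ e2).
  move: h1 h2; rewrite Fneg// !ltr_norml add0r ler_norml.
  by move=> /andP[? ?] /andP[? ?]; apply/andP; split; lra.
have U0 r : 0 <= U r.
  apply/ler_addgt0Pr => e e0; have /filter_ex[n /=] := near r _ e0.
  by have /andP[? _] := F0C n r; rewrite ltr_norml => /andP[? ?]; lra.
have Udec r : 0 < r -> r * U r <= C.
  move=> r0; apply/ler_addgt0Pr => e e0.
  have er : 0 < e / r by rewrite divr_gt0.
  have /filter_ex[n /=] := near r _ er; have := Fdec n r r0.
  rewrite ltr_norml => h /andP[_ h2].
  have : r * (U r - F n r) <= r * (e / r) by rewrite ler_pM2l// ltW.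
  rewrite mulrCA divff ?gt_eqF// mulr1 mulrBr; lra.
have C0 : 0 <= C by have /andP[? ?] := F0C 0%N 0; lra.
(* Beyond [A = C / d] both functions are at most [d]. On [[0, A]] both are 1-Lipschitz, so control
   within [h] at the nodes of a grid of step [h = d / 4] gives an error below [3 h]. *)
pose A := C / d; pose h := d / 4.
have h0 : 0 < h by rewrite divr_gt0.
pose M := (Num.truncn (A / h)).+1.
have grid : G [set n | forall i, (i < M)%N -> `|U (i%:R * h) - F n (i%:R * h)| < h].
  elim: M => [|M IH]; first by apply: filterS filterT => n _ i.
  apply: (@filterS _ G _ ([set n | forall i, (i < M)%N -> `|U (i%:R * h) - F n (i%:R * h)| < h] `&`
    [set n | `|U (M%:R * h) - F n (M%:R * h)| < h])); last first.
    by apply: filterI => //; exact: near.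
  move=> n [/= H1 H2] i.
  by rewrite ltnS leq_eqVlt => /predU1P[->//|/H1].
have Kn : G [set n | (K <= n)%N] by apply: ooG; exact: nbhs_infty_ge.
have [n [/= Hn Hg]] := ex2 _ _ Kn grid.
exists n => // r.
have small r' : 0 <= r' -> `|F n r' - U r'| <= d.
  move=> r0; have [rA|rA] := leP r' A.
    pose i := Num.truncn (r' / h).
    have rh0 : 0 <= r' / h by rewrite divr_ge0// ltW.
    have iM : (i < M)%N by rewrite ltnS le_truncn// ler_pM2r// invr_gt0.
    have /andP[i1 i2] := truncn_itv rh0.
    have r1 : i%:R * h <= r' by rewrite -ler_pdivlMr.
    have r2 : r' < i%:R * h + h by rewrite -ltr_pdivrMr// -mulrDl1 || (rewrite -{2}[h]mul1r -mulrDl -ltr_pdivrMr// natr1).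
    have := Hg i iM; have := Ulip r' (i%:R * h); have := Flip n r' (i%:R * h).
    have -> : `|r' - i%:R * h| = r' - i%:R * h by rewrite ger0_norm// subr_ge0.
    rewrite !ler_norml !ltr_norml /h in r1 r2 * => /andP[? ?] /andP[? ?] /andP[? ?].
    by apply/andP; split; lra.
  have r'0 : 0 < r' by apply: le_lt_trans rA; rewrite divr_ge0// ltW.
  have Cd : C <= r' * d by rewrite -ler_pdivrMr// ltW.
  have f1 : F n r' <= d by rewrite -(ler_pM2l r'0) (le_trans (Fdec n r' r'0)).
  have f2 : U r' <= d by rewrite -(ler_pM2l r'0) (le_trans (Udec r' r'0)).
  have /andP[f3 _] := F0C n r'; have := U0 r'.
  by rewrite ler_norml => ?; apply/andP; split; lra.
have [r0|r0] := leP 0 r; first exact: small.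
by rewrite Fneg// Uneg//; exact: small.
Qed.

End lipschitz_compactness.

Section radm_ae.
Variables (R : realType) (N : nat).
Hypothesis N0 : (0 < N)%N.
Local Notation nu := (@radm R N).
Local Notation leb := (@lebesgue_measure R).

(** The polar density is positive at every [r > 0], so a [nu]-null set meets the positive half-line
    in a Lebesgue null set. *)
Lemma radm_ae_lebesgue (P : R -> Prop) : {ae nu, forall r, P r} ->
  {ae leb, forall r, 0 < r -> P r}.
Proof.
move=> [A [mA A0 PA]].
have : (\int[leb]_r `|(\1_A r)%:E * (polar_density N r)%:E| = 0)%E.
  transitivity (\int[nu]_r (\1_A r)%:E)%E; last first.
    by rewrite integral_indic// setIT; exact: A0.
  rewrite (ge0_integral_polar N0)//.
  - by apply: eq_integral => r _; rewrite gee0_abs// -EFinM lee_fin mulr_ge0// polar_density_ge0.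
  - by apply/measurable_EFinP; exact: measurable_indic.
have mf : measurable_fun [set: R] (fun r => (\1_A r)%:E * (polar_density N r)%:E)%E.
  apply: emeasurable_funM; apply/measurable_EFinP; first exact: measurable_indic.
  exact: measurable_polar_density.
move=> /(ae_eq_integral_abs leb measurableT mf).
apply: filterS => r /(_ I) /= h r0.
apply: contrapT => nP.
have Ar : A r by exact: PA.
move: h; rewrite indicE mem_set// mul1e => -[] /eqP.
rewrite /polar_density ltNge ltW//= !mulf_eq0 expf_eq0 pnatr_eq0.
by have := ballc_gt0 R N0; rewrite (gt_eqF r0) andbF => /gt_eqF ->; rewrite (gtn_eqF N0).
Qed.

End radm_ae.

Section ae_lemmas.
Context d (T : measurableType d) (R : realType) (mu : {measure set T -> \bar R}).

Lemma ae_imply (P Q : T -> Prop) : {ae mu, forall x, P x} ->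
  (forall x, P x -> Q x) -> {ae mu, forall x, Q x}.
Proof. by move=> aP PQ; apply: filterS aP. Qed.

Lemma ae_and (P Q : T -> Prop) : {ae mu, forall x, P x} ->
  {ae mu, forall x, Q x} -> {ae mu, forall x, P x /\ Q x}.
Proof. by move=> aP aQ; apply: filterS2 aP aQ. Qed.

Lemma ae_all_nat (P : nat -> T -> Prop) : (forall n, {ae mu, forall x, P n x}) ->
  {ae mu, forall x n, P n x}.
Proof. by move=> H; apply/ae_foralln. Qed.

End ae_lemmas.

(** * Limits of profiles that converge almost everywhere *)

Section limit_profile.
Variables (R : realType) (N : nat).
Hypothesis N0 : (0 < N)%N.
Hypothesis N2 : (2 <= N)%N.
Local Notation nu := (@radm R N).
Local Notation leb := (@lebesgue_measure R).
Local Notation L1 f := (nu.-integrable setT (EFin \o f)).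
Local Notation profile := (@profile R N).
Local Notation mass := (@mass_of R N).

Variables (W_ : nat -> R -> R) (U : R -> R) (m M : R).
Hypothesis pW : forall n, profile (W_ n).
Hypothesis mW : forall n, mass (W_ n) <= m.
Hypothesis M_W : forall n, \int[nu]_r (W_ n r ^+ 2) <= M.
Hypothesis U_lim : forall r, (fun n => tail (W_ n) r) @ \oo --> U r.
Hypothesis W_cvg : {ae nu, forall r, cvgn (W_ ^~ r)}.

(** The upper limit is measurable and defined everywhere; clamping it to [[0, 1]] and setting it to
    zero at negative radii enforces the profile conditions also at points without convergence. *)
Definition limit_density (r : R) : R := if r < 0 then 0 else
  Num.max 0 (Num.min 1 (fine (limn_esup (fun n => (W_ n r)%:E)))).

Local Notation W := limit_density.

Let dW n : density_profile (W_ n). Proof. by case: (pW n). Qed.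
Let W_01 n r : 0 <= W_ n r <= 1. Proof. by case: (dW n). Qed.
Let mW_ n : measurable_fun [set: R] (W_ n). Proof. by case: (dW n). Qed.

Let W01 r : 0 <= W r <= 1.
Proof.
rewrite /W; case: ifP => _; first by rewrite lexx ler01.
by rewrite le_max lexx/= ge_max ler01 ge_min lexx.
Qed.

Let measurable_W : measurable_fun [set: R] W.
Proof.
apply: measurable_fun_ifT => //; first exact: measurable_fun_ltr.
apply: measurable_maxr => //; apply: measurable_minr => //.
apply: measurableT_comp => //; apply: measurable_fun_limn_esup => n.
exact/measurable_EFinP.
Qed.

Let Wneg r : r < 0 -> W r = 0. Proof. by rewrite /W => ->. Qed.

Lemma limit_density_ae : {ae nu, forall r, W_ ^~ r @ \oo --> W r}.
Proof.
apply: (ae_imply W_cvg) => r /cvg_ex[l Wl]; rewrite /W.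
have [r0|r0] := ltP r 0.
  rewrite (_ : W_ ^~ r = cst 0); first exact: cvg_cst.
  by apply/funext => n; have [_ _ -> //] := dW n.
have l0 : 0 <= l.
  by apply: (ler_cvg_to (cvg_cst 0) Wl); apply: nearW => n; have /andP[] := W_01 n r.
have l1 : l <= 1.
  apply: (@ler_cvg_to _ \oo _ R (W_ ^~ r) (cst 1) l 1 Wl (cvg_cst _)).
  by apply: nearW => n; have /andP[] := W_01 n r.
have WlE : (fun n => (W_ n r)%:E) @ \oo --> l%:E.
  by apply/fine_cvgP; split; [exact: nearW|exact: Wl].
have [_ ->] := cvg_limn_einf_sup WlE.
by rewrite /= (min_idPr l1) (max_idPr l0).
Qed.

Let ae_lebT : {ae leb, forall t, W_ ^~ t @ \oo --> W t}.
Proof.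
have H := radm_ae_lebesgue N0 limit_density_ae.
have H0 : {ae leb, forall t : R, t != 0}.
  exists [set 0]; split => //; first exact: lebesgue_measure_set1.
  by move=> t /= /negP/negPn/eqP.
apply: (ae_imply (ae_and H H0)) => t /= [Ht t0].
have [t1|t1] := ltP 0 t; first exact: Ht.
have tn : t < 0 by rewrite lt_neqAle t0.
rewrite Wneg// (_ : W_ ^~ t = cst 0); first exact: cvg_cst.
by apply/funext => n; have [_ _ -> //] := dW n.
Qed.

Let W0 r : 0 <= W r. Proof. by have /andP[] := W01 r. Qed.

Let total n : \int[leb]_t W_ n t = tail (W_ n) 0.
Proof.
have [_ _ Wn iW] := dW n.
rewrite /tail [RHS]Rintegral_mkcond; congr (Rintegral _ _ _); apply/funext => t.
rewrite /patch mem_setE in_itv/= andbT; case: leP => // t0; exact: Wn.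
Qed.

Let C := tail_bound N m.

Let integrable_W : leb.-integrable setT (EFin \o W).
Proof.
have H n : leb.-integrable setT (EFin \o W_ n) by case: (dW n).
have [] // := @fatou_L1 _ _ R leb W_ W C H _ measurable_W W0 ae_lebT _.
- by move=> n x; have /andP[] := W_01 n x.
- by move=> n; rewrite total; exact: tail_le_bound.
Qed.

Lemma limit_density_profile : density_profile W.
Proof. by split. Qed.

Let diff_cvg r s : r <= s -> (fun n => \int[leb]_(t in `[r, s[) W_ n t) @ \oo -->
  \int[leb]_(t in `[r, s[) W t.
Proof.
move=> rs.
have m1 n : measurable_fun (`[r, s[%classic : set R) (fun x => (W_ n x)%:E).
  by apply/measurable_EFinP; exact: measurable_funTS.
have mWE : measurable_fun (`[r, s[%classic : set R) (fun x => (W x)%:E).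
  by apply/measurable_EFinP; exact: measurable_funTS.
have ae1 : {ae leb, forall x : R, `[r, s[%classic x -> (fun n => (W_ n x)%:E) @ \oo --> (W x)%:E}.
  apply: ae_imply ae_lebT _ => x Wx _.
  by apply/fine_cvgP; split; [exact: nearW|exact: Wx].
have ae2 : {ae leb, forall (x : R) n, `[r, s[%classic x -> (`|(W_ n x)%:E| <= (EFin \o fun=> 1%R) x)%E}.
  by apply: aeW => x n _ /=; have /andP[? ?] := W_01 n x; rewrite lee_fin ger0_norm.
have [iWrs _] := @dominated_convergence _ _ R leb `[r, s[%classic (measurable_itv _)
  (fun n x => (W_ n x)%:E) (fun x => (W x)%:E) (EFin \o fun=> 1) m1 mWE ae1 (integrable_itv_cst r s 1) ae2.
rewrite (_ : (\int[leb]_(x in `[r, s[) (W x)%:E)%E = (\int[leb]_(t in `[r, s[) W t)%:E).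
  by move/fine_cvgP => [].
by rewrite /Rintegral fineK//; exact: integrable_fin_num iWrs.
Qed.

Let tail_diff r s : r <= s -> U r - U s = tail W r - tail W s.
Proof.
move=> rs; rewrite (tail_split integrable_W rs) addrK.
rewrite -(cvg_lim (@Rhausdorff R) (diff_cvg rs)); apply/esym/cvg_lim => //.
rewrite (_ : (fun n => _) = (fun n => tail (W_ n) r - tail (W_ n) s)).
  exact: cvgB.
apply/funext => n; have [_ _ _ i] := dW n.
by rewrite (tail_split i rs) addrK.
Qed.

Let tailW_le0 : tail W 0 <= U 0.
Proof.
apply/ler_addgt0Pr => e e0.
have [K _ HK] : \forall n \near \oo, tail (W_ n) 0 <= U 0 + e.
  have /cvgrPdist_le/(_ _ e0) := @U_lim 0; apply: filterS => n.
  by rewrite ler_norml => /andP[? _]; lra.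
have <- : \int[leb]_t W t = tail W 0.
  rewrite /tail [RHS]Rintegral_mkcond; congr (Rintegral _ _ _); apply/funext => t.
  by rewrite /patch mem_setE in_itv/= andbT; case: leP => // t0; exact: Wneg.
have H n : leb.-integrable setT (EFin \o W_ (n + K)%N) by case: (dW (n + K)).
have [] // := @fatou_L1 _ _ R leb (fun n => W_ (n + K)%N) W (U 0 + e) H _ measurable_W W0 _ _.
- by move=> n x; have /andP[] := W_01 (n + K) x.
- by apply: (ae_imply ae_lebT) => t Wt; rewrite (@cvg_shiftn K _ (W_ ^~ t)).
- by move=> n; rewrite total; apply: HK; rewrite /= leq_addl.
Qed.

(** Dominated convergence on bounded intervals shows that [U - tail W] is constant. Fatou gives
    [tail W 0 <= U 0], and the uniform decay makes the constant nonpositive: no slope escapes to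
    infinity. *)
Lemma tail_limit r : tail W r = U r.
Proof.
have dWW := limit_density_profile.
have Uneg s : s < 0 -> U s - tail W s = U 0 - tail W 0.
  by move=> s0; have := tail_diff (ltW s0); lra.
have Upos s : 0 <= s -> U s - tail W s = U 0 - tail W 0.
  by move=> s0; have := tail_diff s0; lra.
have c0 : U 0 - tail W 0 <= 0.
  apply/ler_addgt0Pr => e e0; rewrite add0r.
  have C0 : 0 < C := tail_bound_gt0 N m.
  have s0 : 0 < C / e by rewrite divr_gt0.
  rewrite -(Upos _ (ltW s0)).
  have : U (C / e) <= e.
    have Ul := @U_lim (C / e).
    apply: (@ler_cvg_to _ \oo _ R (fun n => tail (W_ n) (C / e)) (cst e) _ e Ul (cvg_cst _)).
    apply: nearW => n /=; have := tail_decay N0 N2 (pW n) (mW n) s0.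
    by rewrite -/C mulrAC ler_pdivrMr// ler_pM2l.
  by have := @tail_ge0 _ W (C / e) W0; lra.
have := tailW_le0; have [/Uneg|/Upos] := ltP r 0; lra.
Qed.

Lemma limit_profile_spec : profile W /\ mass W <= m.
Proof.
have dWW := limit_density_profile.
have [W2 _] : L1 (fun r => W r ^+ 2) /\ \int[nu]_r (W r ^+ 2) <= M.
  apply: (@fatou_L1 _ _ R nu (fun n r => W_ n r ^+ 2) (fun r => W r ^+ 2) M) => //.
  - by move=> n; case: (pW n).
  - by move=> n x; exact: sqr_ge0.
  - exact: measurable_funX.
  - by move=> x; exact: sqr_ge0.
  - by apply: (ae_imply limit_density_ae) => x Wx; apply: cvgM.
have [U2 mWm] : L1 (fun r => tail W r ^+ 2) /\ \int[nu]_r (tail W r ^+ 2) <= m.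
  apply: (@fatou_L1 _ _ R nu (fun n r => tail (W_ n) r ^+ 2) (fun r => tail W r ^+ 2) m) => //.
  - by move=> n; case: (pW n).
  - by move=> n x; exact: sqr_ge0.
  - by apply: measurable_funX; exact: measurable_tail.
  - by move=> x; exact: sqr_ge0.
  - by apply: aeW => x; rewrite tail_limit; apply: cvgM.
by split.
Qed.

End limit_profile.

Section arithmetic.
Variable R : realType.

Let comb_arith (a c x y : R) : a * (1 - a) * (2 * c) <= a * (1 - a) * (x + y) ->
  a ^+ 2 * x + (1 - a) ^+ 2 * y + 2 * a * (1 - a) * c <= a * x + (1 - a) * y.
Proof. by move=> h; lra. Qed.

Lemma quad_comb_le (a b c x y : R) : 0 <= a -> 0 <= b -> a + b = 1 ->
  2 * c <= x + y -> a ^+ 2 * x + b ^+ 2 * y + 2 * a * b * c <= a * x + b * y.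
Proof.
move=> a0 b0 ab cxy; have := ler_wpM2l (mulr_ge0 a0 b0) cxy.
have -> : b = 1 - a by rewrite -ab; ring.
exact: comb_arith.
Qed.

Lemma half_comb_le (x y m : R) : x <= m -> y <= m -> 2^-1 * x + 2^-1 * y <= m.
Proof. by lra. Qed.

Lemma sqrB_le (x y : R) : (x - y) ^+ 2 <= 2 * (x ^+ 2 + y ^+ 2).
Proof. by have := sqr_ge0 (x + y); rewrite sqrrD sqrrB; lra. Qed.

Lemma gap_arith (q eW eV eM qW qV qM e I : R) : 0 <= q ->
  e <= eM - q * qM -> eM <= 2^-1 * eW + 2^-1 * eV - I ->
  I <= 2^-1 * (eW - q * qW - e) + 2^-1 * (eV - q * qV - e) +
  q * (2^-1 * `|qW - qM| + 2^-1 * `|qV - qM|).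
Proof.
move=> q0 h1 h2.
have := ler_wpM2l q0 (ler_norm (qW - qM)).
have := ler_wpM2l q0 (ler_norm (qV - qM)).
move: `|_| `|_| => u v; lra.
Qed.

Lemma half_expr_small (d : R) : 0 < d -> exists K, forall k, (K <= k)%N -> 2^-1 ^+ k <= d.
Proof.
move=> d0; have h2 : `|2^-1 : R| < 1 by rewrite ger0_norm ?invr_ge0// invf_lt1; lra.
have /cvgrPdist_le/(_ _ d0)[K _ HK] := cvg_expr h2.
exists K => k /HK; rewrite sub0r normrN ger0_norm// exprn_ge0// invr_ge0.
Qed.

Lemma eighth_le_half (k : nat) : 8^-1 ^+ k <= 2^-1 ^+ k :> R.
Proof. by apply: lerXn2r; rewrite ?nnegrE; lra. Qed.

Lemma step_arith (a0 q e I : R) : 0 < a0 -> 0 <= q -> 0 <= e ->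
  a0 / 8 * I <= 2^-1 * e + 2^-1 * e + q * (2^-1 * e + 2^-1 * e) ->
  I <= 8 / a0 * (1 + q) * e.
Proof.
move=> a00 q0 e0 h; have a8 : 0 < a0 / 8 by rewrite divr_gt0.
rewrite -(ler_pM2l a8); apply: (le_trans h).
rewrite (_ : a0 / 8 * (8 / a0 * (1 + q) * e) = (1 + q) * e); last by field; rewrite gt_eqF.
lra.
Qed.

End arithmetic.

(** * The direct method for the action *)

Section minimizer.
Variables (R : realType) (N : nat).
Hypothesis N0 : (0 < N)%N.
Hypothesis N2 : (2 <= N)%N.
Local Notation nu := (@radm R N).
Local Notation leb := (@lebesgue_measure R).
Local Notation L1 f := (nu.-integrable setT (EFin \o f)).
Local Notation profile := (@profile R N).
Local Notation mass := (@mass_of R N).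
Variable p : R.
Hypothesis p2 : 2 < p.
Local Notation pmass := (@pmass_of R N p).
Variables (B : R -> R) (a0 K : R).
Hypothesis a0_gt0 : 0 < a0.
Hypothesis cB : continuous B.
Hypothesis B_bound : forall w, 0 <= w <= 1 -> a0 / 2 * w ^+ 2 <= B w <= K * w ^+ 2.
Hypothesis B_mid : forall v w, 0 <= v <= 1 -> 0 <= w <= 1 ->
  B (2^-1 * v + 2^-1 * w) <= 2^-1 * B v + 2^-1 * B w - a0 / 8 * (v - w) ^+ 2.

Definition energy (W : R -> R) : R := \int[nu]_r B (W r).
Definition action W : R := energy W - p^-1 * pmass W.

Local Notation J := action.

Let B_ge0 w : 0 <= w <= 1 -> 0 <= B w.
Proof.
move=> w01; have /andP[h _] := B_bound w01; apply: le_trans h.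
by rewrite mulr_ge0 ?sqr_ge0// ltW// divr_gt0.
Qed.

Lemma measurable_energy_density W : density_profile W ->
  measurable_fun [set: R] (fun r => B (W r)).
Proof.
move=> [mW _ _ _]; apply: (measurableT_comp _ mW).
exact: continuous_measurable_fun.
Qed.

Lemma L1_energy W : profile W -> L1 (fun r => B (W r)).
Proof.
move=> [dW W2 _]; have [mW W01 _ _] := dW.
apply: (ge0_le_L1 _ _ (L1Z K W2)) => [x|]; last exact: measurable_energy_density.
by rewrite B_ge0//; have /andP[] := B_bound (W01 x).
Qed.

Lemma energy_ge W : profile W -> a0 / 2 * \int[nu]_r (W r ^+ 2) <= energy W.
Proof.
move=> pW; have [dW W2 _] := pW; have [mW W01 _ _] := dW.
rewrite -RintegralT_Z//; apply: RintegralT_le; [exact: L1Z|exact: L1_energy|].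
by move=> x; have /andP[] := B_bound (W01 x).
Qed.

Lemma energy_ge0 W : profile W -> 0 <= energy W.
Proof.
move=> [[_ W01 _ _] _ _]; apply: Rintegral_ge0 => x _; exact: B_ge0.
Qed.

Lemma zero_profile : profile (fun=> 0).
Proof.
have i0 d (T : measurableType d) (mu : {measure set T -> \bar R}) (f : T -> R) :
    (forall x, f x = 0) -> mu.-integrable setT (EFin \o f).
  move=> f0; rewrite (_ : f = fun=> 0); last exact/funext.
  by have := @integrable0 _ _ _ mu setT.
split.
- split => //; first by move=> t; rewrite lexx ler01.
  exact: i0.
- by apply: i0 => x; rewrite expr0n.
- by apply: i0 => x; rewrite /tail Rintegral_cst// mul0r expr0n.
Qed.

Lemma zero_mass : mass (fun=> 0) = 0.
Proof.
rewrite /mass_of (_ : (fun r => _) = fun=> 0); first by rewrite Rintegral_cst// mul0r.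
by apply/funext => x; rewrite /tail Rintegral_cst// mul0r expr0n.
Qed.

Lemma J_ge W m : profile W -> mass W <= m ->
  - (p^-1 * (tail_bound N m `^ (p - 2) * m)) <= J W.
Proof.
move=> pW mW; have := energy_ge0 pW; have := pmass_le N0 p2 pW mW.
have pi : 0 < p^-1 by rewrite invr_gt0 (lt_trans _ p2).
by rewrite -(ler_pM2l pi) /J; lra.
Qed.

(** The bilinear form that polarises [mass]. *)
Definition cross_of W V : R := \int[nu]_r (tail W r * tail V r).

Local Notation cross := cross_of.

Lemma L1_cross W V : profile W -> profile V -> L1 (fun r => tail W r * tail V r).
Proof.
move=> [dW _ UW] [dV _ UV]; apply: L1_prod => //; exact: measurable_tail.
Qed.

Lemma mass_comb W V (a b : R) : profile W -> profile V ->
  mass (fun t => a * W t + b * V t) =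
  a ^+ 2 * mass W + b ^+ 2 * mass V + 2 * a * b * cross W V.
Proof.
move=> pW pV; have [dW _ UW] := pW; have [dV _ UV] := pV.
have [_ _ _ iW] := dW; have [_ _ _ iV] := dV.
have UWV := L1_cross pW pV.
rewrite /mass_of /cross -!RintegralT_Z// -!RintegralT_D//; try exact: L1Z.
  by congr (Rintegral _ _ _); apply/funext => r; rewrite tail_comb//; ring.
by apply: L1D; exact: L1Z.
Qed.

Lemma cross_le W V : profile W -> profile V -> 2 * cross W V <= mass W + mass V.
Proof.
move=> pW pV; have [dW _ UW] := pW; have [dV _ UV] := pV.
have UWV := L1_cross pW pV.
rewrite -RintegralT_D// -RintegralT_Z//.
apply: RintegralT_le; [exact: L1Z|exact: L1D|] => r.
by have := sqr_ge0 (tail W r - tail V r); rewrite sqrrB; lra.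
Qed.

Lemma mass_comb_le W V (a b : R) : profile W -> profile V -> 0 <= a -> 0 <= b ->
  a + b = 1 -> mass (fun t => a * W t + b * V t) <= a * mass W + b * mass V.
Proof.
move=> pW pV a_ge0 b_ge0 ab; rewrite (mass_comb _ _ pW pV).
by apply: quad_comb_le => //; exact: cross_le.
Qed.

Let half0 : 0 <= 2^-1 :> R. Proof. by rewrite invr_ge0. Qed.
Let half1 : 2^-1 + 2^-1 = 1 :> R. Proof. by field. Qed.

Let mid W V := fun t : R => 2^-1 * W t + 2^-1 * V t : R.

(** The midpoint is a competitor, so its action is at least [e]. Strong convexity of [B] then bounds
    the L^2 distance of the slopes by the two excesses of action, up to the variation of [pmass],
    the one term that is not convex in the right direction. *)
Let mid_gap W V m e : profile W -> profile V -> mass W <= m -> mass V <= m ->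
  (forall Z, profile Z -> mass Z <= m -> e <= J Z) ->
  a0 / 8 * \int[nu]_r ((W r - V r) ^+ 2) <=
  2^-1 * (J W - e) + 2^-1 * (J V - e) +
  p^-1 * (2^-1 * `|pmass W - pmass (mid W V)| + 2^-1 * `|pmass V - pmass (mid W V)|).
Proof.
move=> pW pV mW mV Je.
have pM : profile (mid W V) by exact: profileC.
have mM : mass (mid W V) <= m.
  by apply: le_trans (mass_comb_le pW pV half0 half0 half1) _; exact: half_comb_le.
have JM := Je _ pM mM.
have [dW W2 _] := pW; have [dV V2 _] := pV.
have [mWm W01 _ _] := dW; have [mVm V01 _ _] := dV.
have WV2 : L1 (fun r => (W r - V r) ^+ 2).
  apply: (ge0_le_L1 _ _ (L1Z 2 (L1D W2 V2))) => [x|].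
    by rewrite sqr_ge0 sqrB_le.
  by apply: measurable_funX; exact: measurable_funB.
have eM : energy (mid W V) <= 2^-1 * energy W + 2^-1 * energy V
     - a0 / 8 * \int[nu]_r ((W r - V r) ^+ 2).
  have i1 := L1Z 2^-1 (L1_energy pW); have i2 := L1Z 2^-1 (L1_energy pV).
  have i3 := L1Z (a0 / 8) WV2.
  rewrite -(RintegralT_Z _ WV2) -(RintegralT_Z _ (L1_energy pW)) -(RintegralT_Z _ (L1_energy pV)).
  rewrite -(RintegralT_D i1 i2) -(RintegralT_B (L1D i1 i2) i3).
  apply: RintegralT_le; [exact: L1_energy|by apply: L1B => //; exact: L1D|].
  by move=> x; exact: B_mid.
have pi : 0 < p^-1 by rewrite invr_gt0 (lt_trans _ p2).
exact: gap_arith (ltW pi) JM eM.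
Qed.


(* A subsequence has uniformly fast converging tails; testing minimality with
   the midpoints of consecutive terms, [B_mid] then bounds
   [\int (W_k+1 - W_k)^2] geometrically, whence convergence a.e. *)
Theorem minimizer_exists m : 0 < m -> exists W, [/\ profile W, mass W <= m &
  forall V, profile V -> mass V <= m -> J W <= J V].
Proof.
move=> m0; have pi : 0 < p^-1 by rewrite invr_gt0 (lt_trans _ p2).
pose S := [set J V | V in [set V | profile V /\ mass V <= m]].
have infS : has_inf S.
  split.
    exists (J (fun=> 0)), (fun=> 0) => //=; split; first exact: zero_profile.
    by rewrite zero_mass ltW.
  by exists (- (p^-1 * (tail_bound N m `^ (p - 2) * m))) => _ [V [pV mV] <-]; exact: J_ge.
pose j := inf S.
have jle Z : profile Z -> mass Z <= m -> j <= J Z.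
  by move=> pZ mZ; apply: ge_inf; [case: infS|exists Z].
have e0 k : 0 < 8^-1 ^+ k :> R by rewrite exprn_gt0.
(* The rate [8^-k] of the excess is the one that [L2_fast_cauchy_ae] asks for. *)
have /choice[V HV] : forall k : nat, exists V, [/\ profile V, mass V <= m & J V < j + 8^-1 ^+ k].
  by move=> k; have [_ [V [pV mV] <-] JV] := inf_adherent (e0 k) infS; exists V.
have pV k : profile (V k) by case: (HV k).
have mV k : mass (V k) <= m by case: (HV k).
have /choice[d Hd] : forall k : nat, exists d : R, 0 < d /\ forall W Z, profile W -> profile Z ->
    mass W <= m -> mass Z <= m -> (forall r, `|tail W r - tail Z r| <= d) ->
    `|pmass W - pmass Z| <= 8^-1 ^+ k.
  by move=> k; have [d d0 Hd] := pmass_unif_continuous N0 N2 p2 m0 (e0 k); exists d.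
(* The term of index [k] is compared with both of its neighbours, whence [d k] and [d (k-1)]; the
   factor [1 / 2] is for the triangle inequality through [U], and [2^-k] forces the tails to
   converge. *)
pose dl k := Num.min (Num.min (d k) (d k.-1)) (2^-1 ^+ k) / 2.
have dl0 k : 0 < dl k.
  rewrite divr_gt0// !lt_min exprn_gt0 ?invr_gt0// andbT.
  by apply/andP; split; [case: (Hd k)|case: (Hd k.-1)].
have dl1 k : dl k <= d k / 2 by rewrite ler_pM2r// !ge_min lexx.
have dl2 k : dl k.+1 <= d k / 2 by rewrite ler_pM2r// !ge_min lexx orbT.
have dl3 k : dl k <= 2^-1 ^+ k.
  rewrite ler_pdivrMr//; apply: (@le_trans _ _ (2^-1 ^+ k)); first by rewrite ge_min lexx orbT.
  by rewrite ler_peMr ?exprn_ge0// ler1n.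
have dV k : density_profile (V k) by case: (pV k).
have [U HU] := @lipschitz_compact R (fun n => tail (V n)) (tail_bound N m)
  (fun n r s => tail_lip_norm r s (dV n))
  (fun n r => introT andP (conj (profile_tail_ge0 r (dV n)) (tail_le_bound N0 r (pV n) (mV n))))
  (fun n r r0 => tail_neg (dV n) (ltW r0)) (fun n r => tail_decay N0 N2 (pV n) (mV n)).
have /choice[s Hs] : forall k, exists n, (k <= n)%N /\ forall r, `|tail (V n) r - U r| <= dl k.
  by move=> k; have [n kn Hn] := HU _ (dl0 k) k; exists n.
pose W k := V (s k).
have pW k : profile (W k) := pV _.
have mW k : mass (W k) <= m := mV _.
have dW k : density_profile (W k) := dV _.
have JW k : J (W k) - j <= 8^-1 ^+ k.
  have [_ _ /ltW JV] := HV (s k); rewrite lerBlDl (le_trans JV)// lerD2l.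
  by apply: ler_wiXn2l; [rewrite invr_ge0|rewrite invf_le1 ?ler1n|case: (Hs k)].
have WU k r : `|tail (W k) r - U r| <= dl k by case: (Hs k).
have WW k r : `|tail (W k) r - tail (W k.+1) r| <= d k.
  rewrite [leRHS]splitr (le_trans (ler_distD (U r) _ _))// lerD//.
    exact: le_trans (WU k r) (dl1 k).
  by rewrite distrC; exact: le_trans (WU k.+1 r) (dl2 k).
have midW k : profile (mid (W k) (W k.+1)) /\ mass (mid (W k) (W k.+1)) <= m.
  split; first exact: profileC.
  by apply: le_trans (mass_comb_le (pW _) (pW _) half0 half0 half1) _; exact: half_comb_le.
have tail_mid k r : tail (mid (W k) (W k.+1)) r = 2^-1 * tail (W k) r + 2^-1 * tail (W k.+1) r.
  by rewrite tail_comb//; [case: (dW k)|case: (dW k.+1)].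
have gapl k : `|pmass (W k) - pmass (mid (W k) (W k.+1))| <= 8^-1 ^+ k.
  have [pM mM] := midW k; have [dk Hk] := Hd k; apply: (Hk _ _ (pW _) pM (mW _) mM) => r.
  rewrite tail_mid (_ : _ - _ = 2^-1 * (tail (W k) r - tail (W k.+1) r)); last by field.
  rewrite normrM ger0_norm//; apply: le_trans (WW k r).
  by rewrite ler_piMl// invf_le1 ?ler1n.
have gapr k : `|pmass (W k.+1) - pmass (mid (W k) (W k.+1))| <= 8^-1 ^+ k.
  have [pM mM] := midW k; have [dk Hk] := Hd k; apply: (Hk _ _ (pW _) pM (mW _) mM) => r.
  rewrite tail_mid (_ : _ - _ = 2^-1 * (tail (W k.+1) r - tail (W k) r)); last by field.
  rewrite normrM ger0_norm// distrC; apply: le_trans (WW k r).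
  by rewrite ler_piMl// invf_le1 ?ler1n.
pose M := 8 / a0 * (1 + p^-1).
have WM k : \int[nu]_r (W k.+1 r - W k r) ^+ 2 <= M * 8^-1 ^+ k.
  rewrite (_ : \int[nu]_r _ = \int[nu]_r (W k r - W k.+1 r) ^+ 2); last first.
    by congr (Rintegral _ _ _); apply/funext => r; rewrite -sqrrN opprB.
  apply: step_arith; [by []|exact: ltW|exact/ltW/e0|].
  apply: le_trans (mid_gap (pW k) (pW k.+1) (mW k) (mW k.+1) jle) _.
  have e1 : 8^-1 ^+ k.+1 <= 8^-1 ^+ k :> R.
    by apply: ler_wiXn2l => //; rewrite invf_le1 ?ler1n.
  apply: lerD.
    by apply: lerD; rewrite ler_pM2l// (le_trans (JW _)).
  by rewrite ler_pM2l//; apply: lerD; rewrite ler_pM2l// ?gapl ?gapr.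
have W_cvg : {ae nu, forall r, cvgn (W ^~ r)}.
  apply: (L2_fast_cauchy_ae _ _ WM) => k; first by case: (dW k).
  have [_ W2 _] := pW k; have [_ V2 _] := pW k.+1.
  apply: (ge0_le_L1 _ _ (L1Z 2 (L1D V2 W2))) => [x|].
    by rewrite sqr_ge0 sqrB_le.
  by apply: measurable_funX; apply: measurable_funB; [case: (dW k.+1)|case: (dW k)].
have U_lim r : (fun n => tail (W n) r) @ \oo --> U r.
  apply/cvgrPdist_le => e e00; have [K0 HK] := half_expr_small e00.
  exists K0 => // k /= /HK; rewrite distrC; apply: le_trans.
  exact: le_trans (WU k r) (dl3 k).
pose Q := 2 / a0 * (j + 1 + p^-1 * (tail_bound N m `^ (p - 2) * m)).
have M_W n : \int[nu]_r (W n r ^+ 2) <= Q.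
  rewrite /Q -(ler_pM2l (x := a0 / 2)) ?divr_gt0// (le_trans (energy_ge (pW n)))//.
  rewrite mulrA (_ : a0 / 2 * (2 / a0) = 1) ?mul1r; last by field; rewrite gt_eqF.
  have := JW n; rewrite /J lerBlDl lerBlDr => /le_trans; apply.
  apply: lerD; last by rewrite ler_pM2l// pmass_le.
  by rewrite lerD2l exprn_ile1// invf_le1 ?ler1n.
have [pL mL] := limit_profile_spec N0 N2 pW mW M_W U_lim W_cvg.
have tL := tail_limit N0 N2 pW mW U_lim W_cvg.
have aeL := limit_density_ae pW W_cvg.
set L := limit_density W in pL mL tL aeL.
clearbody L W.
exists L; split; [exact: pL|exact: mL|move=> Z pZ mZ].
apply: (@le_trans _ _ j); last exact: (jle Z pZ mZ).
apply/ler_addgt0Pr => e ee.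
have ep : 0 < e / (1 + p^-1) by rewrite divr_gt0// addr_gt0.
set e1 := e / _ in ep.
have [dd dd0 Hdd] := pmass_unif_continuous N0 N2 p2 m0 ep.
have [K0 HK] : exists K0, forall k, (K0 <= k)%N -> 2^-1 ^+ k <= Num.min dd e1.
  by apply: half_expr_small; rewrite lt_min dd0.
(* Lower semicontinuity: Fatou handles the energy, and uniform convergence of the tails handles
   [pmass]. Shifting by [K0] keeps only indices where all errors are below [e1]. *)
have eL : energy L <= j + e1 + p^-1 * (pmass L + e1).
  have H k : L1 (fun r => B (W (k + K0)%N r)) := L1_energy (pW _).
  have dL : density_profile L by case: pL.
  have [] // := @fatou_L1 _ _ R nu (fun k r => B (W (k + K0)%N r)) (fun r => B (L r))
    (j + e1 + p^-1 * (pmass L + e1)) H _ (measurable_energy_density dL) _ _ _.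
  - by move=> n x; apply: B_ge0; case: (dW (n + K0)%N).
  - by move=> x; apply: B_ge0; case: dL.
  - apply: (ae_imply aeL) => r Wr.
    have c : (fun n => W (n + K0)%N r) @ \oo --> L r by rewrite (@cvg_shiftn K0 _ (W ^~ r)).
    exact: (@continuous_cvg nat R R \oo _ _ B (L r) (@cB _) c).
  - move=> n; set k := (n + K0)%N.
    have := HK k (leq_addl _ _); rewrite le_min => /andP[k1 k2].
    have := JW k; rewrite /J lerBlDl lerBlDr => /le_trans; apply.
    apply: lerD; first by rewrite lerD2l (le_trans (eighth_le_half _ _)).
    rewrite (ler_pM2l pi) -lerBlDl; apply: le_trans (ler_norm _) _.
    apply: (Hdd _ _ (pW _) pL (mW _) mL) => r; rewrite tL; apply: le_trans k1.
    exact: le_trans (WU k r) (dl3 k).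
rewrite /J lerBlDr; apply: (le_trans eL); rewrite -/j.
rewrite (_ : e = e1 * (1 + p^-1)); last by rewrite mulfVK// gt_eqF// addr_gt0.
rewrite (_ : j + e1 * (1 + p^-1) + p^-1 * pmass L = j + e1 + p^-1 * (pmass L + e1)); first exact: lexx.
ring.
Qed.

End minimizer.

(** * Saturation of the constraint *)

Section spreading.
Variable R : realType.

(* [A] and [h] are the radius and the height of a tent of mass [m]; the potential
   energy [h^p A^N] beats the kinetic energy [h^2 A^(N-2)] for large [A] because
   [p < 2 + 4/N]. *)
Lemma exists_spread (N : nat) (p c m K q : R) : (0 < N)%N -> 2 < p < 2 + 4 / N%:R ->
  0 < c -> 0 < m -> 0 < q ->
  exists A h : R, [/\ 0 < A, 0 < h, h <= A, h ^+ 2 * (c * A ^+ N) = m &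
    K * h ^+ 2 * A ^+ N < q * h `^ p * A ^+ N * A ^+ 2].
Proof.
move=> N0 /andP[p2 p4] c0 m0 q0.
have NR : 0 < N%:R :> R by rewrite ltr0n.
(* Since [h] is proportional to [A^(-N/2)], the potential term [h^p A^N A^2] grows like [A^th] while
   the kinetic term [h^2 A^N] stays constant; [th > 0] is the condition [p < 2 + 4/N]. *)
pose th : R := 2 - N%:R * (p - 2) / 2.
have th0 : 0 < th.
  have : N%:R * (p - 2) < 4.
    by rewrite mulrC -ltr_pdivlMr//; lra.
  by rewrite /th; lra.
pose s := Num.sqrt (m / c).
have s0 : 0 < s by rewrite sqrtr_gt0 divr_gt0.
have s2 : s ^+ 2 = m / c by rewrite sqr_sqrtr// ltW// divr_gt0.
pose D := K * s ^+ 2 / (q * s `^ p).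
pose y := Num.max 0 D + 1.
(* From [A >= 1] and [A >= s] follows [h <= s <= A], so the tent has slope at most 1; the last entry
   makes [A^th] exceed [D]. *)
pose A := Num.max (Num.max 1 s) (y `^ th^-1).
have A1 : 1 <= A by rewrite !le_max lexx.
have As : s <= A by rewrite !le_max lexx orbT.
have A0 : 0 < A by apply: lt_le_trans A1.
have DA : D < A `^ th.
  have y0 : 0 <= y by rewrite addr_ge0// le_max lexx.
  apply: (@lt_le_trans _ _ y).
    by rewrite ltr_pwDr// le_max lexx orbT.
  have yA : y `^ th^-1 <= A by rewrite le_max lexx orbT.
  apply: (@le_trans _ _ ((y `^ th^-1) `^ th)).
    by rewrite -powRrM mulVf ?gt_eqF// powRr1.
  by apply: ge0_ler_powR; rewrite ?nnegrE ?powR_ge0// ltW.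
exists A, (s * A `^ (- (N%:R / 2))).
have AN : A `^ (- (N%:R / 2)) ^+ 2 * A ^+ N = 1.
  rewrite -powR_mulrn ?powR_ge0// -powRrM -(powR_mulrn N (ltW A0)) -powRD ?(gt_eqF A0) ?implybT//.
  by rewrite (_ : _ + _ = 0) ?powRr0//; field.
split => //.
- by rewrite mulr_gt0// powR_gt0.
- apply: le_trans As; rewrite (ler_piMr (ltW s0))// -[leRHS](powRr0 A).
  by apply: ler_powR => //; rewrite oppr_le0 divr_ge0.
- rewrite exprMn.
  have -> : s ^+ 2 * A `^ (- (N%:R / 2)) ^+ 2 * (c * A ^+ N) = s ^+ 2 * c * (A `^ (- (N%:R / 2)) ^+ 2 * A ^+ N) by ring.
  by rewrite AN mulr1 s2 mulfVK// gt_eqF.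
- have -> : K * (s * A `^ (- (N%:R / 2))) ^+ 2 * A ^+ N = K * s ^+ 2 * (A `^ (- (N%:R / 2)) ^+ 2 * A ^+ N) by ring.
  rewrite AN mulr1 powRM ?powR_ge0 ?ltW// -powRrM.
  have -> : q * (s `^ p * A `^ (- (N%:R / 2) * p)) * A ^+ N * A ^+ 2 = q * s `^ p * (A `^ (- (N%:R / 2) * p) * A ^+ N * A ^+ 2) by ring.
  rewrite -(powR_mulrn N (ltW A0)) -(powR_mulrn 2 (ltW A0)) -!powRD ?(gt_eqF A0) ?implybT//.
  rewrite (_ : _ + 2%:R = th); last by rewrite /th; field.
  by rewrite [ltRHS]mulrC -ltr_pdivrMr ?mulr_gt0 ?powR_gt0.
Qed.

End spreading.

(** * Negative infimum and full mass *)

Section saturation.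
Variables (R : realType) (N : nat).
Hypothesis N0 : (0 < N)%N.
Hypothesis N2 : (2 <= N)%N.
Local Notation nu := (@radm R N).
Local Notation leb := (@lebesgue_measure R).
Local Notation L1 f := (nu.-integrable setT (EFin \o f)).
Local Notation profile := (@profile R N).
Local Notation mass := (@mass_of R N).
Variable p : R.
Hypothesis p2 : 2 < p.
Local Notation pmass := (@pmass_of R N p).
Variables (B : R -> R) (a0 K : R).
Hypothesis a0_gt0 : 0 < a0.
Hypothesis cB : continuous B.
Hypothesis B_bound : forall w, 0 <= w <= 1 -> a0 / 2 * w ^+ 2 <= B w <= K * w ^+ 2.
Hypothesis B_mono : forall v w, 0 <= v -> v <= w -> w <= 1 -> B v <= B w.
Local Notation J := (action N p B).
Local Notation energy := (energy N B).

Section tent.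
Variables (e A : R).
Hypotheses (e01 : 0 <= e <= 1) (A0 : 0 < A).

(** Its tail is the cone of height [e A] and radius [A]. Exact integrals are avoided by comparison
    with multiples of the indicators of the balls of radii [A] and [A / 2]. *)
Let W : R -> R := fun r => e * \1_(`[0, A[%classic : set R) r.

Let W_itv r : 0 <= r < A -> W r = e.
Proof. by move=> rA; rewrite /W indicE mem_setE in_itv/= rA mulr1. Qed.

Let W_out r : ~~ (0 <= r < A) -> W r = 0.
Proof. by move=> rA; rewrite /W indicE mem_setE in_itv/= (negbTE rA) mulr0. Qed.

Lemma tent_density : density_profile W.
Proof.
have mW : measurable_fun [set: R] (fun r : R => \1_(`[0, A[%classic : set R) r : R).
  exact: measurable_indic.
have /andP[e0 e1] := e01.
split.
- exact: measurable_funM.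
- by move=> t; rewrite /W indicE; case: (_ \in _); rewrite ?mulr1 ?mulr0 ?e0 ?lexx ?ler01.
- by move=> t t0; rewrite W_out// leNgt t0.
- apply: L1Z; apply: L1_fin => //.
  rewrite integral_indic// setIT.
  apply: (@le_lt_trans _ _ (lebesgue_measure (`[0%R, A[%classic : set R))) => //.
  by rewrite lebesgue_measure_itv/=; case: ifP => // _; rewrite -EFinB ltry.
Qed.

Let tail_out r : A <= r -> tail W r = 0.
Proof.
move=> Ar; rewrite /tail (@eq_Rintegral _ _ _ _ _ (cst 0)).
  by rewrite Rintegral_cst// mul0r.
move=> x; rewrite inE/= in_itv/= andbT => rx; apply: W_out.
by rewrite negb_and -!ltNge -leNgt (le_trans Ar rx) orbT.
Qed.

Let tail_in r : 0 <= r <= A -> tail W r = e * (A - r).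
Proof.
move=> /andP[r0 rA]; have [_ _ _ iW] := tent_density.
rewrite (tail_split iW rA) tail_out// addr0 (@eq_Rintegral _ _ _ _ _ (fun=> e * 1)).
  rewrite RintegralZl//; first by rewrite Rintegral_itv_cst.
  exact: integrable_itv_cst.
by move=> x; rewrite inE/= in_itv/= => /andP[rx xA]; rewrite W_itv ?mulr1// xA (le_trans r0).
Qed.

Let tail_le r : tail W r <= e * A * \1_(`]-oo, A[%classic : set R) r.
Proof.
have dW := tent_density; have /andP[e0 _] := e01.
rewrite indicE mem_setE in_itv/=; case: ltP => rA; last by rewrite mulr0 tail_out.
rewrite mulr1; have [r0|r0] := leP 0 r.
  by rewrite tail_in ?r0 ?(ltW rA)// ler_wpM2l// lerBlDr lerDl.
by rewrite (tail_neg dW (ltW r0)) tail_in ?subr0// lexx (ltW A0).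
Qed.

Let tail_ge r : e * A / 2 * \1_(`]-oo, A / 2[%classic : set R) r <= tail W r.
Proof.
have dW := tent_density; have /andP[e0 _] := e01.
rewrite indicE mem_setE in_itv/=; case: ltP => rA; last first.
  by rewrite mulr0 (profile_tail_ge0 _ dW).
have AA : A / 2 <= A by rewrite ler_pdivrMr// ler_peMr ?ler1n// ltW.
have A2 : 0 <= A / 2 by rewrite divr_ge0// ltW.
rewrite mulr1; apply: le_trans (tail_nonincr dW (ltW rA)).
rewrite tail_in ?A2 ?AA// -mulrA ler_wpM2l// lerBrDr -splitr.
exact: lexx.
Qed.

Let sq_le r : 0 <= tail W r ^+ 2 <= (e * A) ^+ 2 * \1_(`]-oo, A[%classic : set R) r.
Proof.
have dW := tent_density; rewrite sqr_ge0/=.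
have := tail_le r; have := profile_tail_ge0 r dW.
rewrite indicE; case: (_ \in _); rewrite ?mulr1 ?mulr0 => t0 tl.
  by rewrite lerXn2r// nnegrE// (le_trans t0).
by rewrite (le_anti (introT andP (conj tl t0))) expr0n.
Qed.

Let W2_le r : 0 <= W r ^+ 2 <= e ^+ 2 * \1_(`]-oo, A[%classic : set R) r.
Proof.
rewrite sqr_ge0/=; have [rA|rA] := boolP (0 <= r < A).
  by rewrite W_itv// indicE mem_setE in_itv/=; have /andP[_ ->] := rA; rewrite mulr1.
by rewrite W_out// expr0n/= mulr_ge0 ?sqr_ge0.
Qed.

Lemma tent_profile : profile W.
Proof.
have dW := tent_density; have [mW _ _ _] := dW; split => //.
- apply: (ge0_le_L1 _ _ (L1_ball N0 (e ^+ 2) A0)) => [r|]; first exact: W2_le.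
  exact: measurable_funX.
- apply: (ge0_le_L1 _ _ (L1_ball N0 ((e * A) ^+ 2) A0)) => [r|]; first exact: sq_le.
  by apply: measurable_funX; exact: measurable_tail.
Qed.

Lemma tent_mass : mass W <= (e * A) ^+ 2 * (ballc R N * A ^+ N).
Proof.
have [_ _ U2] := tent_profile.
rewrite -Rintegral_ball//; apply: RintegralT_le => //; first exact: L1_ball.
by move=> r; have /andP[] := sq_le r.
Qed.

Lemma tent_pmass : (e * A / 2) `^ p * (ballc R N * (A / 2) ^+ N) <= pmass W.
Proof.
have A20 : 0 < A / 2 by rewrite divr_gt0.
have pp := L1_tail_powR N0 p2 tent_profile.
rewrite -Rintegral_ball//; apply: RintegralT_le => //; first exact: L1_ball.
move=> r; have := tail_ge r; have /andP[e0 _] := e01.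
have h0 : 0 <= e * A / 2 by rewrite divr_ge0// mulr_ge0// ltW.
rewrite indicE; case: (_ \in _); rewrite ?mulr1 ?mulr0 => tl; last exact: powR_ge0.
apply: ge0_ler_powR; rewrite ?nnegrE//; first by rewrite ltW// (lt_trans _ p2).
exact: le_trans tl.
Qed.

Lemma tent_energy : energy W <= K * (e ^+ 2 * (ballc R N * A ^+ N)).
Proof.
have pW := tent_profile; have [[_ W01 _ _] W2 _] := pW.
have K0 : 0 <= K.
  have h : 0 <= (1 : R) <= 1 by rewrite ler01 lexx.
  have /andP[h1 h2] := B_bound h; rewrite expr1n !mulr1 in h1 h2.
  by rewrite (le_trans _ h2)// (le_trans _ h1)// divr_ge0// ltW.
apply: (@le_trans _ _ (K * \int[nu]_r (W r ^+ 2))).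
  rewrite -RintegralT_Z//; apply: RintegralT_le; [exact: (L1_energy a0_gt0 cB B_bound pW)|exact: L1Z|].
  by move=> r; have /andP[] := B_bound (W01 r).
rewrite ler_wpM2l// -Rintegral_ball//; apply: RintegralT_le => //; first exact: L1_ball.
by move=> r; have /andP[] := W2_le r.
Qed.

End tent.

Lemma J_negative m : 0 < m -> p < 2 + 4 / N%:R -> exists V, [/\ profile V, mass V <= m & J V < 0].
Proof.
move=> m0 p4; have c0 := ballc_gt0 R N0.
have pi : 0 < p^-1 by rewrite invr_gt0 (lt_trans _ p2).
(* The powers of [2^-1] are the loss from replacing the tent by half its height on half its
   radius. *)
pose q := p^-1 * 2^-1 `^ p * 2^-1 ^+ N.
have q0 : 0 < q by rewrite !mulr_gt0// ?powR_gt0 ?exprn_gt0 ?invr_gt0.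
have p24 : 2 < p < 2 + 4 / N%:R by rewrite p2.
have [A [h [A0 h0 hA hm hK]]] := exists_spread K N0 p24 c0 m0 q0.
have A1 : A != 0 by rewrite gt_eqF.
have pn0 : p != 0 by rewrite gt_eqF// (lt_trans _ p2).
have e01 : 0 <= h / A <= 1 by rewrite (divr_ge0 (ltW h0) (ltW A0))/= ler_pdivrMr// mul1r.
exists (fun r => h / A * \1_(`[0, A[%classic : set R) r); split.
- exact: tent_profile.
- by rewrite (le_trans (tent_mass e01 A0))// divfK ?gt_eqF// hm.
- have := tent_pmass e01 A0; have := tent_energy e01 A0.
  rewrite divfK ?gt_eqF// /action => he hp.
  rewrite subr_lt0 (le_lt_trans he)// (@lt_le_trans _ _ (p^-1 * ((h / 2) `^ p * (ballc R N * (A / 2) ^+ N))))//; last by rewrite ler_pM2l.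
  rewrite (powRM _ (ltW h0)) ?invr_ge0// !exprMn exprVn.
  have -> : p^-1 * (h `^ p * 2^-1 `^ p * (ballc R N * (A ^+ N * 2^-1 ^+ N))) =
     ballc R N / A ^+ 2 * (q * h `^ p * A ^+ N * A ^+ 2).
    by rewrite /q; field; rewrite ?pn0 ?A1.
  have -> : K * (h ^+ 2 / A ^+ 2 * (ballc R N * A ^+ N)) = ballc R N / A ^+ 2 * (K * h ^+ 2 * A ^+ N).
    by field; rewrite ?A1.
  by rewrite ltr_pM2l// divr_gt0// exprn_gt0.
Qed.

Section dilation.
Variable t : R.
Hypothesis t1 : 1 <= t.

Let t0 : 0 < t. Proof. exact: lt_le_trans t1. Qed.
Let tV0 : 0 < t^-1. Proof. by rewrite invr_gt0. Qed.
Let tV1 : t^-1 <= 1. Proof. by rewrite invf_le1. Qed.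

(* The profile of [r |-> U (r / t)]. *)
Definition dilate (W : R -> R) : R -> R := fun r => t^-1 * W (t^-1 * r).

Let measurable_scale (f : R -> R) : measurable_fun [set: R] f ->
  measurable_fun [set: R] (fun r => f (t^-1 * r)).
Proof. by move=> mf; apply: (measurableT_comp mf); exact: measurable_funM. Qed.

Lemma L1_dilate f : L1 f -> (forall r, 0 <= f r) ->
  L1 (fun r => f (t^-1 * r)) /\ \int[nu]_r f (t^-1 * r) = t ^+ N * \int[nu]_r f r.
Proof.
move=> fi f0; have mf := L1_measurable fi.
have E : (\int[nu]_r (f (t^-1 * r)%R)%:E = (t ^+ N * \int[nu]_r f r)%:E)%E.
  have mfE : measurable_fun [set: R] (fun r => (f r)%:E) by exact/measurable_EFinP.
  rewrite (@ge0_integral_radm_scale R N t^-1 (fun r => (f r)%:E) tV0 mfE); last by move=> r; rewrite lee_fin.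
  by rewrite invrK L1_EFin// EFinM.
split; last by rewrite /Rintegral E.
apply: L1_fin => //; first exact: measurable_scale.
by rewrite E ltry.
Qed.

Let tail_integrand W r s : density_profile W -> 
  dilate W s * \1_(`[r, +oo[%classic : set R) s =
  t^-1 * (W (t^-1 * s) * \1_(`[t^-1 * r, +oo[%classic : set R) (t^-1 * s)).
Proof.
move=> _; rewrite /dilate -mulrA; congr (_ * (_ * _)).
by rewrite !indicE !mem_setE !in_itv/= !andbT ler_pM2l.
Qed.

Lemma dilate_density W : density_profile W -> density_profile (dilate W).
Proof.
move=> [mW W01 Wn iW]; split.
- by apply: measurable_funM => //; exact: measurable_scale.
- move=> r; have /andP[? ?] := W01 (t^-1 * r); rewrite /dilate (mulr_ge0 (ltW tV0))//=.
  by rewrite (mulr_ile1 (ltW tV0)).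
- by move=> r r0; rewrite /dilate Wn ?mulr0// pmulr_rlt0.
- apply: L1Z; apply: L1_fin; first exact: measurable_scale.
    by move=> r; have /andP[] := W01 (t^-1 * r).
  have mfE : measurable_fun [set: R] (fun r => (W r)%:E) by exact/measurable_EFinP.
  rewrite (@ge0_integral_scale1 R t^-1 (fun r => (W r)%:E) tV0 mfE); last first.
    by move=> r; rewrite lee_fin; have /andP[] := W01 r.
  by rewrite L1_EFin// -EFinM ltry.
Qed.

Lemma tail_dilate W r : density_profile W -> tail (dilate W) r = tail W (t^-1 * r).
Proof.
move=> dW; have [mW W01 Wn iW] := dW.
have mi (a : R) : measurable_fun [set: R] (fun s : R => \1_(`[a, +oo[%classic : set R) s : R).
  exact: measurable_indic.
have E V a : tail V a = fine (\int[leb]_s (V s * \1_(`[a, +oo[%classic : set R) s)%:E)%E.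
  rewrite /tail Rintegral_mkcond /Rintegral; congr fine; apply: eq_integral => s _.
  by rewrite /patch indicE; case: ifP => _; rewrite ?mulr1 ?mulr0.
pose g s := W s * \1_(`[t^-1 * r, +oo[%classic : set R) s.
have g0 s : 0 <= g s by rewrite mulr_ge0//; have /andP[] := W01 s.
have mg : measurable_fun [set: R] g by exact: measurable_funM.
have mgE : measurable_fun [set: R] (fun s => (g s)%:E) by exact/measurable_EFinP.
rewrite !E; congr fine; under eq_integral do rewrite tail_integrand//.
under eq_integral do rewrite EFinM.
rewrite ge0_integralZl//; last 3 first.
- by apply/measurable_EFinP; exact: (measurable_scale mg).
- by move=> s _; rewrite lee_fin; exact: g0.
- by rewrite lee_fin ltW.
rewrite (@ge0_integral_scale1 R t^-1 (fun s => (g s)%:E) tV0 mgE); last by move=> s; rewrite lee_fin.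
by rewrite muleA -EFinM invrK mulVf ?mul1e// gt_eqF.
Qed.

Lemma dilate_profile W : profile W -> profile (dilate W) /\ mass (dilate W) = t ^+ N * mass W.
Proof.
move=> [dW W2 U2]; have dD := dilate_density dW; have [mD _ _ _] := dD.
have [i1 I1] := L1_dilate U2 (fun r => sqr_ge0 _).
have [i2 _] := L1_dilate W2 (fun r => sqr_ge0 _).
have E : (fun r => tail (dilate W) r ^+ 2) = (fun r => tail W (t^-1 * r) ^+ 2).
  by apply/funext => r; rewrite tail_dilate.
split; last by rewrite /mass_of E.
split => //; last by rewrite E.
apply: (ge0_le_L1 _ _ (L1Z (t^-1 ^+ 2) i2)) => [r|]; last exact: measurable_funX.
by rewrite sqr_ge0/= /dilate exprMn.
Qed.

(** The dilation multiplies [pmass] by exactly [t^N]. The energy gains at most this factor, because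
    the slopes shrink and [B] is nondecreasing. *)
Lemma dilate_J W : profile W -> J (dilate W) <= t ^+ N * J W.
Proof.
move=> pW; have [pD _] := dilate_profile pW; have [dW W2 U2] := pW.
have [_ W01 _ _] := dW; have [dD _ _] := pD.
have iE := L1_energy a0_gt0 cB B_bound pW.
have B0 r : 0 <= B (W r).
  have /andP[h _] := B_bound (W01 r); apply: le_trans h.
  by rewrite mulr_ge0 ?sqr_ge0// ltW// divr_gt0.
have [i1 I1] := L1_dilate iE B0.
have [i2 I2] := L1_dilate (L1_tail_powR N0 p2 pW) (fun r => powR_ge0 _ _).
rewrite /action mulrBr lerB//.
  rewrite -[leRHS]I1; apply: RintegralT_le => //; first exact: (L1_energy a0_gt0 cB B_bound pD).
  move=> r; have /andP[w0 w1] := W01 (t^-1 * r); apply: B_mono => //.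
    by rewrite /dilate mulr_ge0// ltW.
  by rewrite /dilate ler_piMl.
have -> : pmass (dilate W) = t ^+ N * pmass W.
  rewrite /pmass_of -I2; congr (Rintegral _ _ _).
  by apply/funext => r; rewrite tail_dilate.
by rewrite mulrCA lexx.
Qed.

End dilation.

(** Below full mass there is room for a dilation with [t > 1], and since the minimal action is
    negative, multiplying it by [t^N] would lower it. *)
Lemma minimizer_mass m W : 0 < m -> p < 2 + 4 / N%:R -> profile W -> mass W <= m ->
  (forall V, profile V -> mass V <= m -> J W <= J V) -> mass W = m.
Proof.
move=> m0 p4 pW mW Wmin; apply/eqP; rewrite eq_le mW/= leNgt; apply/negP => mWm.
have [V [pV mV JV]] := J_negative m0 p4.
have JW : J W < 0 by apply: le_lt_trans JV; exact: Wmin.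
(* The dilation aims at [t^N = m / M] and not at [m / mass W], since [mass W] has not been shown to
   be nonzero. *)
pose M := (m + mass W) / 2.
have M1 : mass W < M by rewrite ltr_pdivlMr// mulr_natr mulr2n ltrD2r.
have M2 : M < m by rewrite ltr_pdivrMr// mulr_natr mulr2n ltrD2l.
have M0 : 0 < M by apply: le_lt_trans M1; exact: mass_ge0.
pose t := (m / M) `^ N%:R^-1.
have mM : 1 < m / M by rewrite ltr_pdivlMr// mul1r.
have tN : t ^+ N = m / M.
  rewrite -powR_mulrn ?powR_ge0// -powRrM mulVf ?powRr1// ?pnatr_eq0 -?lt0n//.
  by rewrite ltW// (lt_trans _ mM).
have t1 : 1 <= t.
  have E1 : (1 : R) `^ N%:R^-1 = 1 by rewrite powR1.
  rewrite -[leLHS]E1; apply: ge0_ler_powR; rewrite ?nnegrE ?invr_ge0//.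
    by rewrite ltW// (lt_trans _ mM).
  exact: ltW.
have [pD mD] := dilate_profile t1 pW.
have : J W <= J (dilate t W).
  apply: (Wmin _ pD); rewrite mD tN; move: (mass W) M1 => x xM.
  by rewrite mulrAC (ler_pdivrMr _ _ M0) (ler_pM2l m0) (ltW xM).
have := dilate_J t1 pW; rewrite tN => h1 h2.
have := le_trans h2 h1; rewrite leNgt => /negP; apply.
move: (J W) JW (m / M) mM => x x0 y y1.
by rewrite -subr_lt0 -{2}[x]mul1r -mulrBl pmulr_rlt0 ?subr_gt0.
Qed.

End saturation.

(** * The Euler-Lagrange relation *)

Section max0.
Variable R : realType.

Lemma max0_lip (x y : R) : `|Num.max x 0 - Num.max y 0| <= `|x - y|.
Proof.
have h1 := ler_norm (x - y); have := ler_norm (y - x); rewrite distrC => h2.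
case: (leP x 0) => x0; case: (leP y 0) => y0;
  by rewrite ler_norml; apply/andP; split; lra.
Qed.

End max0.

Section primitive.
Variable R : realType.
Local Notation leb := (@lebesgue_measure R).
Variable f : R -> R.
Hypothesis cf : continuous f.

Definition primitive (r : R) : R := \int[leb]_(s in `[0, r]) f s.

Lemma continuous_integrable_itv (a b : R) : leb.-integrable `[a, b] (EFin \o f).
Proof.
apply: continuous_compact_integrable; first exact: segment_compact.
exact: continuous_subspaceT.
Qed.

Lemma primitive_sub (r s : R) : 0 <= r -> r <= s ->
  primitive s - primitive r = \int[leb]_(t in `]r, s]) f t.
Proof.
move=> r0 rs; apply: (@Rintegral_itvB _ f (BLeft 0) (BRight s) r).
- exact: continuous_integrable_itv.
- by rewrite bnd_simp.
- by rewrite bnd_simp.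
Qed.

Lemma primitive_le0 (r : R) : r <= 0 -> primitive r = 0.
Proof.
rewrite le_eqVlt => /predU1P[->|r0]; first by rewrite /primitive set_itv1 Rintegral_set1.
by rewrite /primitive set_itv_ge ?Rintegral_set0// bnd_simp -ltNge.
Qed.

Let bounded_on (A : R) : exists M, forall x, -A <= x <= A -> `|f x| <= M.
Proof.
have : compact (f @` `[-A, A]) by apply: continuous_compact; [exact: continuous_subspaceT|exact: segment_compact].
move=> /compact_bounded[M [_ HM]]; exists (M + 1) => x xA.
by apply: HM; [rewrite ltrDl|exists x => //=; rewrite in_itv].
Qed.

Lemma primitive_sub_le (r s M : R) : 0 <= r -> r <= s ->
  (forall x, r <= x <= s -> `|f x| <= M) -> `|primitive s - primitive r| <= M * (s - r).
Proof.
move=> r0 rs fM; rewrite primitive_sub//.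
have i : leb.-integrable `]r, s] (EFin \o f).
  apply: (integrableS _ _ _ (continuous_integrable_itv r s)) => //.
  by apply: subset_itvr; rewrite bnd_simp.
apply: (le_trans (le_normr_Rintegral _ i)) => //.
have ic : leb.-integrable `]r, s] (EFin \o cst M).
  apply: measurable_bounded_integrable => //.
    apply: (@le_lt_trans _ _ (lebesgue_measure (`]r, s]%classic : set R))) => //.
    by rewrite lebesgue_measure_itv/=; case: ifP => // _; rewrite -EFinB ltry.
  by exists `|M|; split => // x kx y _ /=; exact: ltW.
apply: (@le_trans _ _ (\int[leb]_(t in `]r, s]) M)).
  apply: le_Rintegral => //; first by have := integrable_abse i.
  by move=> x; rewrite /= in_itv/= => /andP[rx xs]; apply: fM; rewrite ltW.
rewrite Rintegral_cst//; apply: ler_wpM2l.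
  by apply: le_trans (fM r _) => //; rewrite lexx.
have -> : fine (leb (`]r, s]%classic : set R)) = fine (lebesgue_measure (`]r, s]%classic : set R)) by [].
by rewrite lebesgue_measure_itv/= lte_fin; case: ltP => //= _; rewrite ?subr_ge0.
Qed.

Lemma continuous_primitive : continuous primitive.
Proof.
move=> x; have [M HM] := bounded_on (`|x| + 1).
have M0 : 0 <= M.
  by apply: le_trans (HM 0 _) => //; rewrite oppr_le0 addr_ge0// ler01.
have prM s : primitive s = primitive (Num.max s 0).
  by case: (leP s 0) => [s0|_ //]; rewrite !primitive_le0.
have lip s t : s <= t -> 0 <= s -> t <= `|x| + 1 -> `|primitive t - primitive s| <= M * (t - s).
  move=> st s0 tx; apply: primitive_sub_le => // z /andP[sz zt]; apply: HM.
  by rewrite (le_trans zt tx) andbT (le_trans _ (le_trans s0 sz))// oppr_le0 addr_ge0// ler01.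
have xle : Num.max x 0 <= `|x| + 1.
  by rewrite ge_max addr_ge0 ?ler01// andbT (le_trans (ler_norm x))// lerDl.
have key y : `|x - y| <= 1 -> `|primitive x - primitive y| <= M * `|x - y|.
  move=> xy; rewrite (prM x) (prM y).
  have yle : Num.max y 0 <= `|x| + 1.
    rewrite ge_max addr_ge0 ?ler01// andbT; have := ler_norm x.
    by move: xy; rewrite ler_norml => /andP[? _]; lra.
  have max0 (z : R) : 0 <= Num.max z 0 by rewrite le_max lexx orbT.
  have mxy := max0_lip x y.
  apply: (@le_trans _ _ (M * `|Num.max x 0 - Num.max y 0|)); last exact: ler_wpM2l.
  have [h|/ltW h] := leP (Num.max x 0) (Num.max y 0).
    by rewrite distrC [X in M * X]distrC [X in M * X]ger0_norm ?subr_ge0//; exact: lip.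
  by rewrite [X in M * X]ger0_norm ?subr_ge0//; exact: lip.
apply/cvgrPdist_le => e e0.
have e1 : 0 < Num.min 1 (e / (M + 1)) by rewrite lt_min ltr01 divr_gt0// ltr_pwDr.
apply: filterS (nbhsx_ballx x _ e1) => y; rewrite /ball/= lt_min => /andP[/ltW y1 y2].
apply: le_trans (key _ y1) _; rewrite ltr_pdivlMr ?ltr_pwDr// in y2.
by apply: le_trans (ltW y2); rewrite mulrC ler_wpM2l// lerDl ler01.
Qed.

End primitive.

(** * The flux and its duality with tails *)

Section duality.
Variables (R : realType) (N : nat).
Hypothesis N2 : (2 <= N)%N.
Local Notation nu := (@radm R N).
Local Notation leb := (@lebesgue_measure R).
Local Notation L1 f := (nu.-integrable setT (EFin \o f)).
Let N0 : (0 < N)%N. Proof. exact: ltnW. Qed.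

(** The solution [k] of [(r^(N-1) k)' = r^(N-1) f] that starts from zero: the radial field of
    strength [flux f] has divergence [f]. The function [h] of the overview is a combination of two
    fluxes. *)
Definition flux (f : R -> R) (r : R) : R :=
  primitive (fun s => f s * s ^+ N.-1) r / r ^+ N.-1.

Lemma continuous_weight (f : R -> R) : continuous f -> continuous (fun s => f s * s ^+ N.-1).
Proof. by move=> cf x; apply: cvgM; [exact: cf|exact: exprn_continuous]. Qed.

Lemma continuous_flux (f : R -> R) (r : R) : continuous f -> 0 < r -> {for r, continuous (flux f)}.
Proof.
move=> cf r0; apply: cvgM; first exact: (continuous_primitive (continuous_weight cf)).
by apply: cvgV; [rewrite expf_neq0// gt_eqF|exact: exprn_continuous].
Qed.

Lemma measurable_flux (f : R -> R) : continuous f -> measurable_fun [set: R] (flux f).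
Proof.
move=> cf; rewrite (_ : flux f = fun r => primitive (fun s => f s * s ^+ N.-1) r * r `^ (- N.-1%:R)).
  apply: measurable_funM; last exact: measurable_powR.
  by apply: continuous_measurable_fun; exact: (continuous_primitive (continuous_weight cf)).
apply/funext => r; rewrite /flux; have [r0|r0] := leP r 0; first by rewrite primitive_le0// !mul0r.
by rewrite powR_invn// ltW.
Qed.

Lemma flux_ge0 (f : R -> R) r : (forall s, 0 <= f s) -> 0 <= r -> 0 <= flux f r.
Proof.
move=> f0 r0; rewrite divr_ge0 ?exprn_ge0//; apply: Rintegral_ge0 => s /=.
by rewrite in_itv/= => /andP[s0 _]; rewrite mulr_ge0 ?exprn_ge0.
Qed.

Lemma flux_density (f : R -> R) r : 0 <= r ->
  flux f r * polar_density N r = ballc R N * N%:R * primitive (fun s => f s * s ^+ N.-1) r.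
Proof.
rewrite le_eqVlt => /predU1P[<-|r0].
  rewrite primitive_le0// mulr0 /polar_density ltxx expr0n.
  by rewrite -subn1 subn_eq0 leqNgt N2 !mulr0.
rewrite /flux /polar_density ltNge (ltW r0)/=; field.
by rewrite expf_neq0// gt_eqF.
Qed.

(** Tonelli on the region [s <= r] for [f(s) W(r)], weighted by the polar density in [s]:
    integrating in [r] first produces the tail of [W], integrating in [s] first produces the flux of
    [f]. *)
Lemma ge0_tail_duality (f W : R -> R) : continuous f -> (forall s, 0 <= f s) ->
  density_profile W ->
  (\int[nu]_r (f r * tail W r)%:E = \int[nu]_r (flux f r * W r)%:E)%E.
Proof.
move=> cf f0 dW; have [mW W01 Wn iW] := dW.
have W0 r : 0 <= W r by have /andP[] := W01 r.
have mf : measurable_fun [set: R] f by exact: continuous_measurable_fun.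
have mT := measurable_tail dW.
have T0 r := profile_tail_ge0 r dW.
have cw := continuous_weight cf.
pose F (z : R * R) : \bar R := (f z.1 * polar_density N z.1 * (if z.1 <= z.2 then W z.2 else 0))%:E.
have F0 z : (0 <= F z)%E.
  by rewrite lee_fin mulr_ge0 ?mulr_ge0 ?polar_density_ge0//; case: ifP.
have mF : measurable_fun [set: (R * R)%type] F.
  apply/measurable_EFinP; apply: measurable_funM.
    apply: measurable_funM; first exact: (measurableT_comp mf measurable_fst).
    exact: (measurableT_comp (@measurable_polar_density R N) measurable_fst).
  apply: measurable_fun_ifT => //; last exact: (measurableT_comp mW measurable_snd).
  by apply: measurable_fun_ler; [exact: measurable_fst|exact: measurable_snd].
have mfT : measurable_fun [set: R] (fun r => (f r * tail W r)%:E).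
  by apply/measurable_EFinP; exact: measurable_funM.
have mhW : measurable_fun [set: R] (fun r => (flux f r * W r)%:E).
  by apply/measurable_EFinP; apply: measurable_funM => //; exact: measurable_flux.
rewrite (ge0_integral_polar N0 mfT); last by move=> r; rewrite lee_fin mulr_ge0.
have hW0 r : 0 <= flux f r * W r.
  have [r0|r0] := leP 0 r; first by rewrite mulr_ge0// flux_ge0.
  by rewrite Wn// mulr0.
rewrite (ge0_integral_polar N0 mhW); last by move=> r; rewrite lee_fin.
transitivity (\int[leb]_s \int[leb]_r F (s, r))%E.
  apply: eq_integral => s _.
  have fd0 : 0 <= f s * polar_density N s by rewrite mulr_ge0// polar_density_ge0.
  transitivity ((f s * polar_density N s)%:E * (tail W s)%:E)%E.
    by rewrite -!EFinM; congr (_%:E); ring.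
  rewrite -ge0_tailE// integral_mkcond -ge0_integralZl//.
  - apply: eq_integral => r _; rewrite /F/= /patch mem_setE in_itv/= andbT EFinM.
    by case: ifP.
  - apply/(measurable_restrictT _ _).1 => //; apply/measurable_EFinP; exact: measurable_funTS.
  - by move=> r _; rewrite /patch; case: ifP => // _; rewrite lee_fin.
rewrite (@fubini_tonelli _ _ _ _ _ leb leb F mF F0); apply: eq_integral => r _.
have [r0|r0] := ltP r 0.
  rewrite Wn// mulr0 mul0e integral0_eq// => s _ /=.
  by rewrite /F/=; case: leP => sr; rewrite ?Wn// ?mulr0//.
rewrite -EFinM mulrAC flux_density//.
have iw : leb.-integrable `[0, r] (EFin \o (fun s => f s * s ^+ N.-1)).
  exact: continuous_integrable_itv.
transitivity ((ballc R N * N%:R * W r)%:E * (primitive (fun s => f s * s ^+ N.-1) r)%:E)%E; last first.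
  by rewrite -EFinM; congr (_%:E); ring.
rewrite /primitive /Rintegral fineK; last exact: integrable_fin_num iw.
rewrite integral_mkcond -ge0_integralZl//; last 3 first.
- apply/(measurable_restrictT _ _).1 => //; apply/measurable_EFinP; apply: measurable_funTS.
  exact: continuous_measurable_fun.
- move=> s _; rewrite /patch; case: ifPn => //; rewrite inE/= in_itv/= => /andP[s0 _].
  by rewrite lee_fin mulr_ge0// exprn_ge0.
- by rewrite lee_fin !mulr_ge0// ltW// ballc_gt0.
apply: eq_integral => s _; rewrite /F/= /patch mem_setE in_itv/= /polar_density.
case: ltP => s0 /=; first by rewrite mulr0 mul0r mule0.
by case: leP => sr; rewrite ?mulr0 ?mule0// -EFinM; congr (_%:E); ring.
Qed.

Lemma tail_duality (f W : R -> R) : continuous f -> (forall s, 0 <= f s) ->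
  density_profile W -> L1 (fun r => f r * tail W r) ->
  L1 (fun r => flux f r * W r) /\
  \int[nu]_r (f r * tail W r) = \int[nu]_r (flux f r * W r).
Proof.
move=> cf f0 dW fT; have E := ge0_tail_duality cf f0 dW; have [mW W01 Wn _] := dW.
split; last by rewrite /Rintegral E.
apply: L1_fin.
- by apply: measurable_funM => //; exact: measurable_flux.
- move=> r; have /andP[W0 _] := W01 r; have [r0|r0] := leP 0 r; first by rewrite mulr_ge0// flux_ge0.
  by rewrite Wn// mulr0.
- by rewrite -E L1_EFin// ltry.
Qed.

End duality.

Section arithmetic.
Variable R : realType.

(** The three-slope inequality of a convex function with values [l1], [l0], [lV] at [m1 < m < mV],
    with slopes counted negatively. *)
Lemma multiplier_arith (l0 l1 lV m m1 mV : R) : m1 < m -> m < mV ->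
  l0 <= (m - m1) / (mV - m1) * lV + (mV - m) / (mV - m1) * l1 ->
  (l0 - lV) / (mV - m) <= (l1 - l0) / (m - m1).
Proof.
move=> h1 h2 h.
have d1 : 0 < m - m1 by rewrite subr_gt0.
have d2 : 0 < mV - m by rewrite subr_gt0.
have d3 : 0 < mV - m1 by rewrite subr_gt0 (lt_trans h1).
rewrite ler_pdivrMr// mulrAC ler_pdivlMr//.
have := ler_wpM2r (ltW d3) h; rewrite mulrDl.
have -> : (m - m1) / (mV - m1) * lV * (mV - m1) = (m - m1) * lV by field; rewrite gt_eqF.
have -> : (mV - m) / (mV - m1) * l1 * (mV - m1) = (mV - m) * l1 by field; rewrite gt_eqF.
lra.
Qed.

(* Dividing the quadratic inequality by [t] and letting [t] tend to [0]. *)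
Lemma linearize_arith (d mu m mV c : R) : 0 <= mu ->
  (forall t, 0 < t <= 1 -> 0 <= t * d + mu * ((1 - t) ^+ 2 * m + t ^+ 2 * mV + 2 * (1 - t) * t * c - m)) ->
  0 <= d + 2 * mu * (c - m).
Proof.
move=> mu0 H; rewrite leNgt; apply/negP => neg.
set s := d + 2 * mu * (c - m) in neg.
pose E := mu * (m + mV - 2 * c).
pose t := Num.min 1 (- s / (2 * (`|E| + 1))).
have E1 : 0 < 2 * (`|E| + 1) by rewrite mulr_gt0// ltr_pwDr.
have t0 : 0 < t by rewrite lt_min ltr01 divr_gt0// oppr_gt0.
have t1 : t <= 1 by rewrite ge_min lexx.
have t2 : t * (2 * (`|E| + 1)) <= - s by rewrite -ler_pdivlMr// ge_min lexx orbT.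
have := H t; rewrite t0 t1 => /(_ isT).
have -> : t * d + mu * ((1 - t) ^+ 2 * m + t ^+ 2 * mV + 2 * (1 - t) * t * c - m) = t * (s + t * E).
  by rewrite /s /E; ring.
rewrite pmulr_rge0//.
have : t * E <= t * `|E| by rewrite ler_pM2l// ler_norm.
move: t2; clear -t0 neg; move: `|E| => e; rewrite mulrCA mulrDr mulr1; lra.
Qed.

Lemma tangent_arith (p eV e0 qV q0 iV i0 : R) : 0 < p ->
  q0 + p * (iV - i0) <= qV -> e0 - p^-1 * q0 <= eV - p^-1 * qV -> e0 - i0 <= eV - iV.
Proof.
move=> p0 h1 h2; have pi : 0 <= p^-1 by rewrite invr_ge0 ltW.
have := ler_wpM2l pi h1; rewrite mulrDr mulrA mulVf ?gt_eqF// mul1r; lra.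
Qed.

Lemma split_arith (d mu m mV : R) : 0 <= mu -> 0 <= d -> mV <= m ->
  d >= mu * (m - mV) -> 0 <= d + mu * (mV - m).
Proof. by move=> h1 h2 h3 h4; have := h4; rewrite !mulrBr; lra. Qed.

Lemma upper_arith (lV l0 mV m mu : R) : m < mV -> (l0 - lV) / (mV - m) <= mu ->
  0 <= lV - l0 + mu * (mV - m).
Proof. by move=> h; rewrite ler_pdivrMr ?subr_gt0// => h2; lra. Qed.

Lemma affine_arith (t lV l0 : R) : (1 - t) * l0 + t * lV <= t * (lV - l0) + l0.
Proof. by rewrite mulrBl mulrBr mul1r; lra. Qed.

Lemma level_arith (m m1 mV : R) : 0 < mV - m1 ->
  (m - m1) / (mV - m1) * mV + (mV - m) / (mV - m1) * m1 = m.
Proof. by move=> h; field; rewrite gt_eqF. Qed.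

Lemma ell_arith (e e0 i i0 c m mu : R) :
  0 <= (e - i - (e0 - i0)) + 2 * mu * (c - m) ->
  e0 - (i0 - 2 * mu * m) <= e - (i - 2 * mu * c).
Proof. by rewrite mulrBr; lra. Qed.

End arithmetic.

(** * The multiplier and pointwise minimality *)

Section euler_lagrange.
Variables (R : realType) (N : nat).
Hypothesis N2 : (2 <= N)%N.
Let N0 : (0 < N)%N. Proof. exact: ltnW. Qed.
Local Notation nu := (@radm R N).
Local Notation leb := (@lebesgue_measure R).
Local Notation L1 f := (nu.-integrable setT (EFin \o f)).
Local Notation profile := (@profile R N).
Local Notation mass := (@mass_of R N).
Local Notation cross := (@cross_of R N).
Variable p : R.
Hypothesis p2 : 2 < p.
Local Notation pmass := (@pmass_of R N p).
Variables (B : R -> R) (a0 K : R).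
Hypothesis a0_gt0 : 0 < a0.
Hypothesis cB : continuous B.
Hypothesis B_bound : forall w, 0 <= w <= 1 -> a0 / 2 * w ^+ 2 <= B w <= K * w ^+ 2.
Hypothesis B_cvx : forall v w a b, 0 <= v <= 1 -> 0 <= w <= 1 -> 0 <= a -> 0 <= b -> a + b = 1 ->
  B (a * v + b * w) <= a * B v + b * B w.
Local Notation J := (action N p B).
Local Notation energy := (energy N B).
Local Notation iE pW := (L1_energy a0_gt0 cB B_bound pW).

Lemma energy_comb V W a b : profile V -> profile W -> 0 <= a -> 0 <= b -> a + b = 1 ->
  energy (fun t => a * V t + b * W t) <= a * energy V + b * energy W.
Proof.
move=> pV pW a_ge0 b_ge0 ab; have pC := profileC pV pW a_ge0 b_ge0 ab.
have i1 := L1Z a (iE pV); have i2 := L1Z b (iE pW).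
rewrite -(RintegralT_Z _ (iE pV)) -(RintegralT_Z _ (iE pW)) -(RintegralT_D i1 i2).
apply: RintegralT_le; [exact: (iE pC)|exact: L1D|] => r.
have [[_ V01 _ _] _ _] := pV; have [[_ W01 _ _] _ _] := pW.
exact: B_cvx.
Qed.

Variables (W0 : R -> R) (m : R).
Hypothesis pW0 : profile W0.
Hypothesis m_gt0 : 0 < m.
Hypothesis mW0 : mass W0 = m.
Hypothesis W0_min : forall V, profile V -> mass V <= m -> J W0 <= J V.

Let U := tail W0.
Let dW0 : density_profile W0. Proof. by case: pW0. Qed.
Let U0 r : 0 <= U r. Proof. exact: profile_tail_ge0. Qed.

Let L1_f1 V : profile V -> L1 (fun r => U r `^ (p - 1) * tail V r).
Proof.
move=> pV; have [dV _ _] := pV.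
apply: (ge0_le_L1 _ _ (L1Z (tail_bound N m `^ (p - 2)) (L1_cross pW0 pV))) => [r|].
  have V0 := profile_tail_ge0 r dV.
  rewrite mulr_ge0 ?powR_ge0//= mulrA ler_wpM2r// powR_split1// ler_wpM2r//.
  apply: ge0_ler_powR; rewrite ?nnegrE//; first by rewrite subr_ge0 ltW.
    exact/ltW/tail_bound_gt0.
  by apply: tail_le_bound => //; rewrite mW0.
by apply: measurable_funM; [exact: measurable_tail_powR|exact: measurable_tail].
Qed.

Let I1 V := \int[nu]_r (U r `^ (p - 1) * tail V r).
(** The action with [p^-1 U^p] replaced by its linear part at the minimiser [W0]; it is convex, as
    the action is not. *)
Let L V := energy V - I1 V.

Let I1_comb V W a b : profile V -> profile W -> I1 (fun t => a * V t + b * W t) = a * I1 V + b * I1 W.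
Proof.
move=> pV pW; have [[_ _ _ iV] _ _] := pV; have [[_ _ _ iW] _ _] := pW.
rewrite /I1 -(RintegralT_Z _ (L1_f1 pV)) -(RintegralT_Z _ (L1_f1 pW)).
rewrite -(RintegralT_D (L1Z _ (L1_f1 pV)) (L1Z _ (L1_f1 pW))).
by congr (Rintegral _ _ _); apply/funext => r; rewrite tail_comb//; ring.
Qed.

Let L_comb V W a b : profile V -> profile W -> 0 <= a -> 0 <= b -> a + b = 1 ->
  L (fun t => a * V t + b * W t) <= a * L V + b * L W.
Proof.
move=> pV pW a_ge0 b_ge0 ab; rewrite /L (I1_comb _ _ pV pW).
have := energy_comb pV pW a_ge0 b_ge0 ab.
by rewrite !mulrBr addrACA -opprD lerD2r.
Qed.

(** The power lies above its tangent, so [J V - J W0 <= L V - L W0], and minimality for [J] passes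
    to [L]. *)
Let L_min V : profile V -> mass V <= m -> L W0 <= L V.
Proof.
move=> pV mV; have [dV _ _] := pV.
have h : pmass W0 + p * (I1 V - I1 W0) <= pmass V.
  rewrite /I1 -(RintegralT_B (L1_f1 pV) (L1_f1 pW0)) -RintegralT_Z; last exact: L1B (L1_f1 pV) (L1_f1 pW0).
  have i3 := L1Z p (L1B (L1_f1 pV) (L1_f1 pW0)).
  rewrite -(RintegralT_D (L1_tail_powR N0 p2 pW0) i3).
  apply: RintegralT_le; [exact: L1D (L1_tail_powR N0 p2 pW0) i3|exact: L1_tail_powR|] => r.
  rewrite -mulrBr mulrA; apply: powR_ge_tangent => //; first exact: profile_tail_ge0.
  by rewrite (lt_trans _ p2)// ltr1n.
have p0 : 0 < p by rewrite (lt_trans _ p2).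
exact: (tangent_arith p0 h (W0_min pV mV)).
Qed.

(* [mu] is the infimum of the difference quotients over the competitors of smaller
   mass; convexity bounds it below by those of the competitors of larger mass. *)
Lemma multiplier : exists2 mu, 0 <= mu & forall V, profile V ->
  0 <= L V - L W0 + mu * (mass V - m).
Proof.
pose S := [set x | exists V, [/\ profile V, mass V < m & x = (L V - L W0) / (m - mass V)]].
have z0 : S ((L (fun=> 0) - L W0) / (m - 0)).
  exists (fun=> 0); rewrite zero_mass; split => //; exact: zero_profile.
have S0 x : S x -> 0 <= x.
  move=> [V [pV mV ->]]; rewrite divr_ge0// ?subr_ge0 ?(ltW mV)//.
  exact: L_min pV (ltW mV).
have infS : has_inf S by split; [exists ((L (fun=> 0) - L W0) / (m - 0))|exists 0 => x /S0].
pose mu := inf S.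
have mu0 : 0 <= mu by apply: lb_le_inf; [case: infS|move=> x /S0].
exists mu => // V pV.
have [mV|mV|mV] := ltgtP (mass V) m.
- have d0 : 0 < m - mass V by rewrite subr_gt0.
  have : mu <= (L V - L W0) / (m - mass V) by apply: ge_inf; [case: infS|exists V].
  rewrite ler_pdivlMr// => h.
  apply: split_arith => //; last exact: ltW.
  by rewrite subr_ge0; apply: L_min pV (ltW mV).
- have : (L W0 - L V) / (mass V - m) <= mu.
    apply: lb_le_inf; first by case: infS.
    move=> x [V1 [pV1 mV1 ->]]; apply: (multiplier_arith mV1 mV).
    have d3 : 0 < mass V - mass V1 by rewrite subr_gt0 (lt_trans mV1).
    (* With these weights the masses of [V] and [V1] average to exactly [m]; as [mass] is convex,
       the combination of the two profiles is an admissible competitor. *)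
    set a := (m - mass V1) / _; set b := (mass V - m) / _.
    have a_ge0 : 0 <= a by rewrite divr_ge0// ?subr_ge0 ltW// (lt_trans mV1).
    have b_ge0 : 0 <= b by rewrite divr_ge0// ?subr_ge0 ltW// (lt_trans mV1).
    have ab : a + b = 1 by rewrite /a /b -mulrDl addrC subrKA divff// gt_eqF.
    apply: le_trans (L_comb pV pV1 a_ge0 b_ge0 ab).
    apply: L_min; first exact: profileC.
    apply: (le_trans (mass_comb_le pV pV1 a_ge0 b_ge0 ab)).
    rewrite /a /b le_eqVlt; apply/orP; left; apply/eqP.
    exact: level_arith.
  exact: upper_arith.
- by rewrite mV subrr mulr0 addr0 subr_ge0; apply: L_min => //; rewrite mV.
Qed.

(** The multiplier inequality is tested with [(1 - t) W0 + t V]. To first order in [t] the quadratic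
    mass contributes twice its polar form, whence [la = 2 mu]. *)
Lemma lagrange : exists2 la, 0 <= la & forall V, profile V ->
  energy W0 - (I1 W0 - la * cross W0 W0) <= energy V - (I1 V - la * cross W0 V).
Proof.
have [mu mu0 Hmu] := multiplier; exists (2 * mu); first by rewrite mulr_ge0.
move=> V pV.
have cm : cross W0 W0 = m.
  by rewrite -mW0; congr (Rintegral _ _ _); apply/funext => r; rewrite expr2.
rewrite cm; apply: ell_arith.
apply: (@linearize_arith _ _ _ _ (mass V)) => // t /andP[t0 t1].
have a_ge0 : 0 <= 1 - t by rewrite subr_ge0.
have ab : 1 - t + t = 1 by rewrite subrK.
have pC := profileC pW0 pV a_ge0 (ltW t0) ab.
have := Hmu _ pC; rewrite (mass_comb _ _ pW0 pV) mW0 => /le_trans; apply.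
rewrite lerD2r lerBlDr (le_trans (L_comb pW0 pV a_ge0 (ltW t0) ab))//.
exact: affine_arith.
Qed.

Let cU : continuous U. Proof. exact: continuous_tail. Qed.

Lemma continuous_tail_powR : continuous (fun r => U r `^ (p - 1)).
Proof.
have p1 : 1 < p - 1 by rewrite ltrBrDr.
pose C := tail_bound N m.
have UC r : 0 <= U r <= C by rewrite U0/=; apply: tail_le_bound => //; rewrite mW0.
pose D := (p - 1) * C `^ (p - 1 - 1) + 1.
have D0 : 0 < D by rewrite ltr_pwDr// mulr_ge0 ?powR_ge0// ltW// (lt_trans _ p1).
move=> x; apply/cvgrPdist_lt => e e0.
have eD : 0 < e / D by rewrite divr_gt0.
apply: filterS (nbhsx_ballx x _ eD) => y; rewrite /ball/= ltr_pdivlMr// => xy.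
apply: le_lt_trans xy; apply: (le_trans (powR_lip (UC x) (UC y) p1)).
rewrite mulrC; apply: ler_pM => //.
- by rewrite mulr_ge0 ?powR_ge0// ltW// (lt_trans _ p1).
- exact: tail_lip_norm.
- by rewrite lerDl ler01.
Qed.

(** Tail duality moves the linear terms from the tail of [V] to [V] itself. The integrand then
    depends on [V] only through its value at [r], so that it can be minimised radius by radius. *)
Theorem euler_lagrange : exists2 la, 0 <= la &
  let h r := flux N (fun r => U r `^ (p - 1)) r - la * flux N U r in
  forall V, profile V -> L1 (fun r => h r * V r) /\
    energy W0 - \int[nu]_r (h r * W0 r) <= energy V - \int[nu]_r (h r * V r).
Proof.
have [la la0 H] := lagrange; exists la => // h.
have D V : profile V -> L1 (fun r => h r * V r) /\
    \int[nu]_r (h r * V r) = I1 V - la * cross W0 V.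
  move=> pV; have [dV _ _] := pV.
  have [i1 E1] := tail_duality N2 continuous_tail_powR (fun r => powR_ge0 _ _) dV (L1_f1 pV).
  have [i2 E2] := tail_duality N2 cU U0 dV (L1_cross pW0 pV).
  have hV : (fun r => h r * V r) = (fun r => flux N (fun r => U r `^ (p - 1)) r * V r - la * (flux N U r * V r)).
    by apply/funext => r; rewrite /h mulrBl -[la * _ * _]mulrA.
  rewrite hV; split; first exact: L1B i1 (L1Z la i2).
  by rewrite (RintegralT_B i1 (L1Z la i2)) (RintegralT_Z _ i2) /I1 E1 /cross_of E2.
by move=> V pV; have [iV ->] := D V pV; have [_ ->] := D W0 pW0; split => //; exact: H.
Qed.

Section pointwise.
Variables (h w : R -> R).
Hypothesis mw : measurable_fun [set: R] w.
Hypothesis w01 : forall r, 0 <= w r <= 1.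
Hypothesis w_min : forall r v, 0 < r -> 0 <= v <= 1 ->
  B (w r) - h r * w r + a0 / 2 * (v - w r) ^+ 2 <= B v - h r * v.
Hypothesis h_min : forall V, profile V -> L1 (fun r => h r * V r) /\
    energy W0 - \int[nu]_r (h r * W0 r) <= energy V - \int[nu]_r (h r * V r).

Section truncated.
Variable A : R.
Hypothesis A0 : 0 < A.

(** The pointwise minimiser [w] is not known to be a profile; using it only on []0, A[] and [W0]
    elsewhere gives an admissible competitor. *)
Let V (r : R) : R := if (0 < r) && (r < A) then w r else W0 r.

Let mV : measurable_fun [set: R] V.
Proof.
apply: measurable_fun_ifT => //; last by case: dW0.
by apply: measurable_and; apply: measurable_fun_ltr.
Qed.

Let V01 r : 0 <= V r <= 1.
Proof. by rewrite /V; case: ifP => // _; case: dW0. Qed.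

Let VW r : V r <= W0 r + 1 * \1_(`[0, A[%classic : set R) r.
Proof.
have [_ W01 _ _] := dW0; have /andP[W0r _] := W01 r; have /andP[_ V1] := V01 r.
rewrite indicE mem_setE in_itv/= mul1r; have [h1|h1] := boolP (0 <= r < A).
  by rewrite (le_trans V1)// lerDr.
rewrite addr0 /V; case: ifP => // /andP[r0 rA].
by move: h1; rewrite rA (ltW r0).
Qed.

Let one01 : 0 <= (1 : R) <= 1. Proof. by rewrite ler01 lexx. Qed.

(** The tent of slope 1 on [[0, A[] is there for domination: [V] is at most its slope plus [W0], and
    likewise for the tails. *)
Let dT := tent_density A one01.

Let dV : density_profile V.
Proof.
have [mW W01 Wn iW] := dW0; have [_ T01 _ iT] := dT; split => //.
- by move=> t t0; rewrite /V ltNge (ltW t0)/= Wn.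
- apply: (ge0_le_L1 _ _ (L1D iW iT)) => [r|]; last exact: mV.
  by have /andP[-> _] := V01 r; exact: VW.
Qed.

Lemma truncated_profile : profile V.
Proof.
have [_ W2 U2] := pW0; have [mW W01 Wn iW] := dW0; have [_ T01 _ iT] := dT.
have [_ T2 TU2] := tent_profile N0 one01 A0.
split; [exact: dV| |].
- apply: (ge0_le_L1 _ _ (L1Z 2 (L1D W2 T2))) => [r|]; last exact: measurable_funX.
  rewrite sqr_ge0/=; have := sqrB_le (W0 r) (- (1 * \1_(`[0, A[%classic : set R) r)).
  rewrite opprK sqrrN; apply: le_trans.
  have /andP[v0 _] := V01 r; apply: lerXn2r => //; rewrite nnegrE//.
  exact: le_trans (VW r).
- apply: (ge0_le_L1 _ _ (L1Z 2 (L1D U2 TU2))) => [r|]; last first.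
    by apply: measurable_funX; exact: (measurable_tail dV).
  rewrite sqr_ge0/=.
  set t := tail (fun r => 1 * _) r.
  have := sqrB_le (tail W0 r) (- t); rewrite opprK sqrrN; apply: le_trans.
  have [_ _ _ iV'] := dV.
  have tV : tail V r <= tail W0 r + t.
    have := tail_comb 1 1 iW iT r; rewrite !mul1r => <-.
    apply: le_Rintegral => //.
    + by apply: integrableS iV'.
    + by apply: (@integrableS _ _ _ leb _ _ _ _ _ _ (L1D (L1Z 1 iW) (L1Z 1 iT))).
    + move=> x _; rewrite !mul1r; have := VW x; rewrite mul1r; exact.
  have v0 := profile_tail_ge0 r dV; apply: lerXn2r => //; rewrite nnegrE//.
  exact: le_trans tV.
Qed.

(** By strong convexity the pointwise gap between [W0] and [V] is at least [a0 / 2 (W0 - V)^2],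
    whereas the minimality of [W0] makes the integral of the gap nonpositive. *)
Lemma truncated_ae : {ae nu, forall r, 0 < r < A -> W0 r = w r}.
Proof.
have pV := truncated_profile.
have [iV HV] := h_min pV; have [i0 _] := h_min pW0.
have gap r : a0 / 2 * (W0 r - V r) ^+ 2 <= (B (W0 r) - h r * W0 r) - (B (V r) - h r * V r).
  rewrite /V; case: ifP => [/andP[r0 _]|_]; last by rewrite !subrr expr0n mulr0.
  by rewrite lerBrDl; apply: w_min => //; case: dW0.
have d0 := L1B (iE pW0) i0; have dV' := L1B (iE pV) iV.
have q0 r : 0 <= a0 / 2 * (W0 r - V r) ^+ 2.
  by rewrite mulr_ge0 ?sqr_ge0// divr_ge0// ltW.
have iq : L1 (fun r => a0 / 2 * (W0 r - V r) ^+ 2).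
  apply: (ge0_le_L1 _ _ (L1B d0 dV')) => [r|]; first by rewrite q0 gap.
  apply: measurable_funM => //; apply: measurable_funX; apply: measurable_funB; last exact: mV.
  by case: dW0.
have le0 : \int[nu]_r (a0 / 2 * (W0 r - V r) ^+ 2) <= 0.
  apply: (le_trans (RintegralT_le iq (L1B d0 dV') gap)).
  rewrite (RintegralT_B d0 dV') (RintegralT_B (iE pW0) i0) (RintegralT_B (iE pV) iV).
  by rewrite subr_le0.
apply: (ae_imply (L1_ae_eq iq q0 le0)) => r; rewrite /V => + rA.
rewrite rA => /eqP; rewrite mulf_eq0 gt_eqF ?divr_gt0//= sqrf_eq0 subr_eq0.
by move/eqP.
Qed.

End truncated.

Lemma pointwise_ae : {ae nu, forall r, 0 < r -> W0 r = w r}.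
Proof.
have : {ae nu, forall r (n : nat), 0 < r < n.+1%:R -> W0 r = w r}.
  apply: (@ae_all_nat _ (measurableTypeR R) R nu (fun (n : nat) (r : R) => 0 < r < n.+1%:R -> W0 r = w r)) => n.
  by apply: truncated_ae; rewrite ltr0n.
move=> /ae_imply; apply => r H r0.
apply: (H (Num.truncn r)); rewrite r0/=; exact: truncnS_gt.
Qed.

Lemma pointwise_tail : (forall r, r < 0 -> w r = 0) ->
  density_profile w /\ forall r, tail W0 r = tail w r.
Proof.
move=> wn; have ae := radm_ae_lebesgue N0 pointwise_ae.
have [mW W01 Wn iW] := dW0.
have nz : {ae leb, forall t : R, t != 0}.
  exists [set 0]; split => //; first exact: lebesgue_measure_set1.
  by move=> t /= /negP/negPn/eqP.
have aeE : {ae leb, forall r, W0 r = w r}.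
  apply: (ae_imply (ae_and ae nz)) => r [H r0].
  have [rp|rn|r00] := ltgtP 0 r; first exact: H.
    by rewrite Wn// wn.
  by rewrite -r00 eqxx in r0.
have E D : measurable D -> (\int[leb]_(t in D) (W0 t)%:E = \int[leb]_(t in D) (w t)%:E)%E.
  move=> mD; apply: ae_eq_integral => //.
  - by apply/measurable_EFinP; exact: measurable_funTS.
  - by apply/measurable_EFinP; exact: measurable_funTS.
  - by apply: (ae_imply aeE) => r ->.
split; last by move=> r; rewrite /tail /Rintegral E.
split => //.
apply: L1_fin => //; first by move=> r; have /andP[] := w01 r.
by rewrite -E// L1_EFin// ltry.
Qed.

End pointwise.
End euler_lagrange.

(** * Removal of the truncation *)

Section monotone_primitive.
Variable R : realType.
Local Notation leb := (@lebesgue_measure R).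
Variable c : R -> R.
Hypothesis cc : continuous c.

Lemma primitive_between (r s m M : R) : 0 <= r -> r <= s ->
  (forall x, r <= x <= s -> m <= c x <= M) ->
  m * (s - r) <= primitive c s - primitive c r <= M * (s - r).
Proof.
move=> r0 rs cmM; rewrite primitive_sub//.
have i : leb.-integrable `]r, s] (EFin \o c).
  apply: (integrableS _ _ _ (continuous_integrable_itv cc r s)) => //.
  by apply: subset_itvr; rewrite bnd_simp.
have ic (k : R) : leb.-integrable `]r, s] (EFin \o cst k).
  apply: measurable_bounded_integrable => //.
    apply: (@le_lt_trans _ _ (lebesgue_measure (`]r, s]%classic : set R))) => //.
    by rewrite lebesgue_measure_itv/=; case: ifP => // _; rewrite -EFinB ltry.
  by exists `|k|; split => // x kx y _ /=; exact: ltW.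
have E (k : R) : \int[leb]_(t in `]r, s]) k = k * (s - r).
  rewrite Rintegral_cst//; congr (_ * _).
  have -> : fine (leb (`]r, s]%classic : set R)) = fine (lebesgue_measure (`]r, s]%classic : set R)) by [].
  rewrite lebesgue_measure_itv/= lte_fin; case: ltP => //= sr.
  by rewrite (@le_anti _ _ r s) ?subrr// rs sr.
have cmM' x : `]r, s]%classic x -> m <= c x <= M.
  by rewrite /= in_itv/= => /andP[rx xs]; apply: cmM; rewrite (ltW rx).
apply/andP; split; rewrite -E; apply: le_Rintegral => //.
- exact: ic.
- by move=> x /cmM' /andP[].
- exact: ic.
- by move=> x /cmM' /andP[].
Qed.

Lemma primitive_tangent : (forall x y : R, 0 <= x -> x <= y -> c x <= c y) ->
  forall w v : R, 0 <= w -> 0 <= v ->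
  primitive c w + c w * (v - w) <= primitive c v.
Proof.
move=> cmono w v w0 v0; have [wv|/ltW vw] := leP w v.
  have H x : w <= x <= v -> c w <= c x <= c v.
    by move=> /andP[wx xv]; rewrite !cmono// (le_trans w0 wx).
  by have /andP[+ _] := primitive_between w0 wv H; rewrite lerBrDl.
have H x : v <= x <= w -> c v <= c x <= c w.
  by move=> /andP[wx xv]; rewrite !cmono// (le_trans v0 wx).
have /andP[_] := primitive_between v0 vw H.
by rewrite lerBlDr -(opprB w v) mulrN lerBlDl.
Qed.

End monotone_primitive.

Section strongly_convex.
Variable R : realType.
Variables (B b : R -> R) (a0 : R).
Hypothesis a0_gt0 : 0 < a0.
Hypothesis tangent : forall w v, 0 <= w <= 1 -> 0 <= v <= 1 ->
  B w + b w * (v - w) + a0 / 2 * (v - w) ^+ 2 <= B v.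

Lemma tangent_convex v w x y : 0 <= v <= 1 -> 0 <= w <= 1 -> 0 <= x -> 0 <= y ->
  x + y = 1 -> B (x * v + y * w) <= x * B v + y * B w.
Proof.
move=> v01 w01 x0 y0 xy1.
set m := x * v + y * w.
have m01 : 0 <= m <= 1.
  have /andP[v0 v1] := v01; have /andP[w0 w1] := w01.
  rewrite addr_ge0 ?mulr_ge0//= -xy1 lerD//.
  - by rewrite -[leRHS]mulr1 ler_wpM2l.
  - by rewrite -[leRHS]mulr1 ler_wpM2l.
have a2 : 0 <= a0 / 2 by rewrite divr_ge0// ltW.
have h1 : x * (B m + b m * (v - m)) <= x * B v.
  apply: ler_wpM2l => //; apply: le_trans (tangent m01 v01).
  by rewrite lerDl mulr_ge0// sqr_ge0.
have h2 : y * (B m + b m * (w - m)) <= y * B w.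
  apply: ler_wpM2l => //; apply: le_trans (tangent m01 w01).
  by rewrite lerDl mulr_ge0// sqr_ge0.
apply: le_trans (lerD h1 h2).
rewrite le_eqVlt; apply/orP; left; apply/eqP.
have -> : y = 1 - x by rewrite -xy1 addrAC subrr add0r.
by rewrite /m (_ : y = 1 - x); [ring|rewrite -xy1 addrAC subrr add0r].
Qed.

(** In the average of the two tangent inequalities at the midpoint the linear terms cancel, and each
    quadratic term is [a0 / 8 (v - w)^2]. *)
Lemma tangent_midpoint v w : 0 <= v <= 1 -> 0 <= w <= 1 ->
  B (2^-1 * v + 2^-1 * w) <= 2^-1 * B v + 2^-1 * B w - a0 / 8 * (v - w) ^+ 2.
Proof.
move=> v01 w01; set m := _ + _.
have m01 : 0 <= m <= 1.
  have /andP[v0 v1] := v01; have /andP[w0 w1] := w01.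
  by rewrite /m; apply/andP; split; lra.
have h1 := tangent m01 v01; have h2 := tangent m01 w01.
have e1 : v - m = (v - w) / 2 by rewrite /m; field.
have e2 : w - m = - ((v - w) / 2) by rewrite /m; field.
move: h1 h2; rewrite e1 e2; move: (B m) (b m) (B v) (B w) => Bm bm Bv Bw.
rewrite sqrrN exprMn; set d := v - w => h1 h2.
have h3 := lerD h1 h2.
rewrite -(@ler_pM2l _ 2)//.
have -> : 2 * (2^-1 * Bv + 2^-1 * Bw - a0 / 8 * d ^+ 2) = Bv + Bw - a0 / 2 * (d ^+ 2 / 2).
  by field.
rewrite lerBrDr; apply: le_trans h3.
by rewrite le_eqVlt; apply/orP; left; apply/eqP; field.
Qed.

Lemma tangent_nondecreasing v w : (forall x, 0 <= x -> 0 <= b x) -> 0 <= v -> v <= w -> w <= 1 ->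
  B v <= B w.
Proof.
move=> b0 v0 vw w1; have v01 : 0 <= v <= 1 by rewrite v0 (le_trans vw).
have w01 : 0 <= w <= 1 by rewrite w1 (le_trans v0).
apply: le_trans (tangent v01 w01); rewrite -addrA lerDl addr_ge0//.
  by rewrite mulr_ge0 ?b0// subr_ge0.
by rewrite mulr_ge0 ?sqr_ge0// divr_ge0// ltW.
Qed.

Lemma tangent_argmin h w v : 0 <= w <= 1 -> 0 <= v <= 1 -> b w = h ->
  B w - h * w + a0 / 2 * (v - w) ^+ 2 <= B v - h * v.
Proof.
move=> w01 v01 bw; have := tangent w01 v01; rewrite bw.
by move: (_ / 2 * _) (B w) (B v) => e x y; rewrite mulrBr; lra.
Qed.

End strongly_convex.

(** * The truncated coefficient, its force and its potential *)

Section truncated_potential.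
Variable R : realType.
Variables (a : R -> R) (s0 : R).
Hypothesis a_pos : forall s : R, 0 <= s < 1 -> 0 < a s.
Hypothesis a_cont : {within `[0, 1[, continuous a}.
Hypothesis a_incr : forall s t : R, 0 <= s -> s <= t -> t < 1 -> a s <= a t.
Hypothesis s0_gt0 : 0 < s0.
Hypothesis s0_lt1 : s0 < 1.

(** The hypotheses on [a] concern [[0, 1[] alone; clamping to [[0, s0]] turns it into a bounded
    continuous nondecreasing function on the whole line. *)
Definition clamp (s : R) : R := Num.min (Num.max s 0) s0.

Lemma clamp_itv s : 0 <= clamp s <= s0.
Proof. by rewrite /clamp le_min le_max lexx orbT (ltW s0_gt0)/= ge_min lexx orbT. Qed.

Lemma clamp_id s : 0 <= s <= s0 -> clamp s = s.
Proof. by move=> /andP[h0 h1]; rewrite /clamp (max_idPl h0) (min_idPl h1). Qed.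

Lemma clamp_nondecreasing s t : s <= t -> clamp s <= clamp t.
Proof.
move=> st; rewrite /clamp le_min !ge_min lexx orbT andbT.
by rewrite ge_max !le_max st lexx orbT.
Qed.

Lemma continuous_clamp : continuous clamp.
Proof.
move=> x; apply: (@continuous_min _ R (fun s : R => Num.max s 0) (cst s0)); last exact: cvg_cst.
by apply: (@continuous_max _ R id (cst 0)); [exact: cvg_id|exact: cvg_cst].
Qed.

Definition coeff (s : R) : R := a (clamp s).

Lemma clamp_lt1 s : clamp s < 1.
Proof. by have /andP[_ h] := clamp_itv s; exact: le_lt_trans h s0_lt1. Qed.

Lemma coeff_between s : a 0 <= coeff s <= a s0.
Proof.
have /andP[h0 h1] := clamp_itv s.
by rewrite /coeff !a_incr// clamp_lt1.
Qed.

Lemma coeff_nondecreasing s t : s <= t -> coeff s <= coeff t.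
Proof.
move=> st; have /andP[h0 h1] := clamp_itv s.
by apply: a_incr => //; [exact: clamp_nondecreasing|exact: clamp_lt1].
Qed.

Lemma continuous_coeff : continuous coeff.
Proof.
move=> x; have /subspace_continuousP/(_ (clamp x)) := a_cont.
have cl y : `[0, 1[%classic (clamp y).
  by rewrite /= in_itv/= clamp_lt1; have /andP[-> _] := clamp_itv y.
move=> /(_ (cl x)) ax S /ax aS.
have aS' : nbhs (clamp x) (fun z : R => `[0, 1[%classic z -> S (a z)) := aS.
have : nbhs x (fun y : R => `[0, 1[%classic (clamp y) -> S (a (clamp y))) := continuous_clamp aS'.
by apply: filterS => y /(_ (cl y)).
Qed.

Lemma continuous_coeff_sqr : continuous (fun t : R => coeff (t ^+ 2)).
Proof. by move=> x; apply: (cvg_comp _ _ (@exprn_continuous R 2 x) (@continuous_coeff (x ^+ 2))). Qed.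

Definition force (w : R) : R := coeff (w ^+ 2) * w.

(** On [w >= 0] this is the primitive of [force]. With the quadratic part split off, the rest is the
    primitive of a nondecreasing function, so strong convexity with constant [a 0] is visible
    without differentiating [a]. *)
Definition potential (w : R) : R :=
  a 0 / 2 * w ^+ 2 + primitive (fun t => (coeff (t ^+ 2) - a 0) * t) w.

Let a00 : 0 < a 0. Proof. by apply: a_pos; rewrite lexx ltr01. Qed.

Let cc : continuous (fun t : R => (coeff (t ^+ 2) - a 0) * t).
Proof.
move=> x; apply: cvgM; last exact: cvg_id.
by apply: cvgB; [exact: continuous_coeff_sqr|exact: cvg_cst].
Qed.

Lemma continuous_potential : continuous potential.
Proof.
move=> x; apply: cvgD; last exact: (continuous_primitive cc).
by apply: cvgM; [exact: cvg_cst|exact: exprn_continuous].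
Qed.

Lemma continuous_force : continuous force.
Proof.
by move=> x; apply: cvgM; [exact: continuous_coeff_sqr|exact: cvg_id].
Qed.

Let excess_nondecreasing (x y : R) : 0 <= x -> x <= y ->
  (coeff (x ^+ 2) - a 0) * x <= (coeff (y ^+ 2) - a 0) * y.
Proof.
move=> x0 xy; have /andP[h _] := coeff_between (x ^+ 2).
by apply: ler_pM => //; rewrite ?subr_ge0// lerD2r; apply: coeff_nondecreasing;
  apply: lerXn2r; rewrite ?nnegrE// (le_trans x0).
Qed.

Lemma force_sub_ge (v w : R) : 0 <= v -> v <= w -> a 0 * (w - v) <= force w - force v.
Proof.
move=> v0 vw; have := excess_nondecreasing v0 vw; rewrite /force.
by move: (coeff _) (coeff _) (a 0) => x y z; rewrite !mulrBl mulrBr; lra.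
Qed.

Lemma force_ge0 w : 0 <= w -> 0 <= force w.
Proof.
move=> w0; rewrite /force mulr_ge0//.
by have /andP[h _] := coeff_between (w ^+ 2); exact: le_trans (ltW a00) h.
Qed.

Lemma potential_tangent w v : 0 <= w <= 1 -> 0 <= v <= 1 ->
  potential w + force w * (v - w) + a 0 / 2 * (v - w) ^+ 2 <= potential v.
Proof.
move=> /andP[w0 _] /andP[v0 _].
have := primitive_tangent cc excess_nondecreasing w0 v0.
rewrite /potential /force; set P := primitive _ w; set Q := primitive _ v.
move: (coeff _) (a 0) P Q => x y P Q h.
have -> : y / 2 * w ^+ 2 + P + x * w * (v - w) + y / 2 * (v - w) ^+ 2 =
  y / 2 * v ^+ 2 + (P + (x - y) * w * (v - w)) by field.
by rewrite lerD2l.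
Qed.

Lemma potential_bound w : 0 <= w <= 1 ->
  a 0 / 2 * w ^+ 2 <= potential w <= a s0 * w ^+ 2.
Proof.
move=> /andP[w0 _]; have /andP[l u] := coeff_between (w ^+ 2).
have E0 : primitive (fun t => (coeff (t ^+ 2) - a 0) * t) 0 = 0 by rewrite primitive_le0.
have := primitive_tangent cc excess_nondecreasing w0 (lexx 0).
have := primitive_tangent cc excess_nondecreasing (lexx 0) w0.
rewrite E0 mulr0 mul0r addr0 sub0r /potential; set P := primitive _ w => P0.
have h1 : (a 0) * w ^+ 2 <= (a s0) * w ^+ 2.
  by rewrite ler_wpM2r ?sqr_ge0// (le_trans l u).
have h2 : coeff (w ^+ 2) * w ^+ 2 <= a s0 * w ^+ 2 by rewrite ler_wpM2r ?sqr_ge0.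
have h3 : 0 <= a 0 * w ^+ 2 by rewrite mulr_ge0 ?sqr_ge0// ltW.
have -> : (coeff (w ^+ 2) - a 0) * w * - w = a 0 * w ^+ 2 - coeff (w ^+ 2) * w ^+ 2 by ring.
move=> h; apply/andP; split; first by rewrite lerDl.
have -> : a 0 / 2 * w ^+ 2 = a 0 * w ^+ 2 / 2 by field.
move: h1 h2 h3 h; move: (a 0 * _) (a s0 * _) (coeff _ * _) => x y z; lra.
Qed.

Lemma force_surjective h : 0 <= h <= force 1 -> exists2 w, 0 <= w <= 1 & force w = h.
Proof.
move=> h01; have [||w w01 <-] := @IVT _ force 0 1 h ler01.
- exact: continuous_subspaceT continuous_force.
- rewrite /force mulr0 -/(force 1); have f1 := force_ge0 ler01.
  by rewrite (min_idPl f1) (max_idPr f1).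
- by exists w => //; move: w01; rewrite in_itv.
Qed.

Lemma force_lt v w : 0 <= v -> 0 <= w -> force v < force w -> v < w.
Proof.
move=> v0 w0 h; rewrite ltNge; apply/negP => wv.
have := force_sub_ge w0 wv; rewrite leNgt => /negP; apply.
by apply: lt_le_trans (mulr_ge0 (ltW a00) _); rewrite ?subr_lt0 ?subr_ge0.
Qed.

(** Strong monotonicity makes the inverse of [force] Lipschitz, which is how continuity passes from
    [h] to the slope. *)
Lemma force_inv_lip v w : 0 <= v -> 0 <= w -> a 0 * `|v - w| <= `|force v - force w|.
Proof.
move=> v0 w0; have [vw|/ltW wv] := leP v w; last first.
  rewrite ger0_norm ?subr_ge0//; apply: le_trans (ler_norm _); exact: force_sub_ge.
rewrite distrC ger0_norm ?subr_ge0// distrC; apply: le_trans (ler_norm _).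
exact: force_sub_ge.
Qed.

End truncated_potential.

(** * Upper bound and sign of the flux *)

Section sign.
Variable R : realType.
Local Notation leb := (@lebesgue_measure R).

Lemma primitive_comb (f g : R -> R) (k r : R) : continuous f -> continuous g ->
  primitive f r - k * primitive g r = primitive (fun s => f s - k * g s) r.
Proof.
move=> cf cg; rewrite /primitive.
have i1 := continuous_integrable_itv cf 0 r.
have i2 := continuous_integrable_itv cg 0 r.
have i3 : leb.-integrable `[0, r] (EFin \o (fun s => k * g s)).
  apply: (continuous_integrable_itv (f := fun s => k * g s)) => x.
  by apply: cvgM; [exact: cvg_cst|exact: cg].
by rewrite RintegralB// RintegralZl.
Qed.

(** On [[0, r]] the integrand [f(s) s^(N-1)] is at most [M s^(N-2) <= M r^(N-2)], where [N >= 2]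
    enters; integration gives [M r^(N-1)], and the flux divides by this power. *)
Lemma flux_le N (f : R -> R) (M r : R) : (2 <= N)%N -> continuous f ->
  (forall s, 0 < s -> s * `|f s| <= M) -> 0 < r -> `|flux N f r| <= M.
Proof.
case: N => [//|[//|n]] N2 cf fM r0.
have M0 : 0 <= M by apply: le_trans (fM 1 ltr01); rewrite mul1r.
rewrite /flux normf_div [X in _ / X]ger0_norm ?exprn_ge0 ?(ltW r0)// ler_pdivrMr ?exprn_gt0//=.
have H x : 0 <= x <= r -> `|f x * x ^+ n.+1| <= M * r ^+ n.
  move=> /andP[]; rewrite le_eqVlt => /predU1P[<-|x0] xr.
    by rewrite expr0n mulr0 normr0 mulr_ge0// exprn_ge0// ltW.
  rewrite normrM [X in _ * X]ger0_norm ?exprn_ge0 ?(ltW x0)// exprS mulrA [_ * x]mulrC.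
  apply: ler_pM; rewrite ?mulr_ge0 ?exprn_ge0 ?(ltW x0)//; first exact: fM.
  by apply: lerXn2r; rewrite ?nnegrE// ltW.
have := primitive_sub_le (continuous_weight (N := n.+2) cf) (lexx 0) (ltW r0) H.
by rewrite (primitive_le0 _ (lexx 0)) !subr0 -mulrA -exprSr.
Qed.

(* If [primitive F r < 0], take [t < r] where the primitive is half as large: [F]
   vanishes from [t] on, so the primitive is constant there. *)
Lemma primitive_ge0_sign (F : R -> R) : continuous F ->
  (forall r : R, 0 <= r -> primitive F r < 0 -> forall s : R, r <= s -> F s <= 0) ->
  (forall r : R, 0 <= r -> (forall s : R, r <= s -> primitive F s < 0) -> forall s : R, r <= s -> F s = 0) ->
  forall r, 0 <= primitive F r.
Proof.
move=> cF Hsign Hzero r; rewrite leNgt; apply/negP => Gr.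
have G0 : primitive F 0 = 0 by rewrite primitive_le0.
have r0 : 0 <= r by rewrite leNgt; apply/negP => /ltW /(primitive_le0 F) E; rewrite E ltxx in Gr.
have [||t t01 Gt] := @IVT _ (primitive F) 0 r (primitive F r / 2) r0.
- exact: continuous_subspaceT (continuous_primitive cF).
- rewrite G0 (min_idPr (ltW Gr)) (max_idPl (ltW Gr)); apply/andP; split; lra.
move: t01; rewrite in_itv/= => /andP[t0 tr].
have Gt0 : primitive F t < 0 by rewrite Gt; lra.
have Fle := Hsign _ t0 Gt0.
have Gneg s : t <= s -> primitive F s < 0.
  move=> ts; apply: le_lt_trans Gt0.
  rewrite -subr_le0 primitive_sub//.
  apply: (@le_trans _ _ (\int[leb]_(x in `]t, s]) 0)); last by rewrite Rintegral_cst// mul0r.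
  apply: le_Rintegral => //.
  - by apply: (integrableS _ _ _ (continuous_integrable_itv cF t s)) => //; apply: subset_itvr; rewrite bnd_simp.
  - exact: integrable0.
  - by move=> x; rewrite /= in_itv/= => /andP[/ltW tx _]; exact: Fle.
have F0 := Hzero _ t0 Gneg.
have : primitive F r - primitive F t = 0.
  rewrite primitive_sub// /Rintegral integral0_eq// => x /=; rewrite in_itv/= => /andP[/ltW tx _].
  by rewrite F0.
by rewrite Gt; lra.
Qed.

End sign.

Section radial_solution.
Variables (R : realType) (N : nat).
Hypothesis N2 : (2 <= N)%N.
Let N0 : (0 < N)%N. Proof. exact: ltnW. Qed.
Local Notation nu := (@radm R N).
Local Notation leb := (@lebesgue_measure R).
Local Notation L1 f := (nu.-integrable setT (EFin \o f)).
Local Notation profile := (@profile R N).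
Local Notation mass := (@mass_of R N).
Variables (a : R -> R) (p m : R).
Hypothesis a_pos : forall s : R, 0 <= s < 1 -> 0 < a s.
Hypothesis a_cont : {within `[0, 1[, continuous a}.
Hypothesis a_lim : a s @[s --> 1^'-] --> +oo.
Hypothesis a_incr : forall s t : R, 0 <= s -> s <= t -> t < 1 -> a s <= a t.
Hypothesis p2 : 2 < p.
Hypothesis p4 : p < 2 + 4 / N%:R.
Hypothesis m_gt0 : 0 < m.

(** Once [s > 1/4] the square root exceeds [1/2], so it suffices that [a s > 2 |H|]. *)
Lemma truncation_level H : exists s0, [/\ 0 < s0, s0 < 1 & H < a s0 * Num.sqrt s0].
Proof.
have /cvgryPgt/(_ (2 * `|H|)) h1 := a_lim.
have h2 : \forall s \near (1:R)^'-, 4^-1 < s by apply: nbhs_left_gt; lra.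
have h3 : \forall s \near (1:R)^'-, s < 1 by exact: nbhs_left_lt.
have [s [[s1 s2] s3]] := @filter_ex _ _ (at_left_proper_filter 1) _ (filterI (filterI h1 h2) h3).
exists s; split => //; first by apply: lt_trans s2; lra.
have q : 2^-1 <= Num.sqrt s.
  have -> : 2^-1 = Num.sqrt (4^-1 : R).
    have -> : (4^-1 : R) = 2^-1 ^+ 2 by field.
    by rewrite sqrtr_sqr ger0_norm.
  by rewrite ler_wsqrtr// ltW.
apply: (le_lt_trans (ler_norm H)).
have n0 := normr_ge0 H; nra.
Qed.

Let C := tail_bound N m.
(** Bounds [s U(s)^(p-1) = U^(p-2) (s U)], with [C] for both [U] and [s U]. *)
Let H0 := C `^ (p - 2) * C.

(** The minimiser of the truncated problem is replaced by a version [w] that is continuous at every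
    positive radius and satisfies the equation there everywhere, not just almost everywhere. *)
Theorem radial_solution_exists : exists W la, [/\ profile W, mass W = m,
  (forall r, 0 < r -> {for r, continuous W}),
  (forall r, 0 < r -> 0 <= W r < 1) &
  forall r, 0 < r -> a (W r ^+ 2) * W r =
    flux N (fun s => tail W s `^ (p - 1)) r - la * flux N (tail W) r].
Proof.
have [s0 [s0_gt0 s0_lt1 s0H]] := truncation_level H0.
have a00 : 0 < a 0 by apply: a_pos; rewrite lexx ltr01.
pose B := potential a s0; pose b := force a s0.
have tangent := potential_tangent a_cont a_incr s0_gt0 s0_lt1.
have cB : continuous B := continuous_potential a_cont s0_gt0 s0_lt1.
have B_bound := potential_bound a_pos a_cont a_incr s0_gt0 s0_lt1.
have b_ge0 := force_ge0 a_pos a_incr s0_gt0 s0_lt1.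
have B_mid := tangent_midpoint tangent.
have B_mono v w := @tangent_nondecreasing _ _ _ _ a00 tangent v w b_ge0.
have B_cvx := tangent_convex a00 tangent.
have [W0 [pW0 mW0 W0_min]] := minimizer_exists N0 N2 p2 a00 cB B_bound B_mid m_gt0.
have massW0 : mass W0 = m.
  exact: (minimizer_mass N0 p2 a00 cB B_bound B_mono m_gt0 p4 pW0 mW0 W0_min).
have [la la0 h_min] := euler_lagrange N2 p2 a00 cB B_bound B_cvx pW0 m_gt0 massW0 W0_min.
pose U := tail W0; pose F s := U s `^ (p - 1).
pose h r := flux N F r - la * flux N U r.
have {}h_min : forall V, profile V -> L1 (fun r => h r * V r) /\
  energy N B W0 - \int[nu]_r (h r * W0 r) <= energy N B V - \int[nu]_r (h r * V r) := h_min.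
have [dW0 W02 U2] := pW0; have [mW0' W01 W0n iW0] := dW0.
have U0 r : 0 <= U r by exact: profile_tail_ge0.
have cU : continuous U by exact: continuous_tail.
have cF : continuous F by exact: (continuous_tail_powR N2 p2 pW0 massW0).
have UF s : F s = U s `^ (p - 2) * U s by exact: powR_split1.
have UC s : U s <= C by apply: (tail_le_bound N0 s pW0); rewrite massW0.
have hle r : 0 < r -> h r <= H0.
  move=> r0; apply: (@le_trans _ _ (flux N F r)).
    by rewrite /h lerBlDr lerDl mulr_ge0// flux_ge0// ltW.
  apply: le_trans (ler_norm _) _; apply: flux_le => // s sp.
  rewrite ger0_norm ?powR_ge0// UF mulrCA /H0; apply: ler_pM.
  - exact: powR_ge0.
  - by rewrite mulr_ge0// ltW.
  - by apply: ge0_ler_powR; rewrite ?nnegrE ?subr_ge0 ?(ltW p2)// (le_trans (U0 s)).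
  - by apply: (tail_decay N0 N2 pW0) => //; rewrite massW0.
have s0_bound : H0 < b (Num.sqrt s0).
  rewrite /b /force sqr_sqrtr ?(ltW s0_gt0)//.
  by rewrite /coeff clamp_id// lexx ltW.
have sq1 : Num.sqrt s0 <= 1 by rewrite -[leRHS]sqrtr1 ler_wsqrtr// ltW.
have b1 : H0 <= b 1.
  apply: (le_trans (ltW s0_bound)); rewrite -subr_ge0.
  apply: le_trans (force_sub_ge a_incr s0_gt0 s0_lt1 (sqrtr_ge0 _) sq1).
  by rewrite mulr_ge0 ?subr_ge0// ltW.
have H0_ge0 : 0 <= H0 by rewrite mulr_ge0 ?powR_ge0// ltW// tail_bound_gt0.
(* The range of [b] on [[0, 1]] is [[0, b 1]], which contains the positive part of [h] because
   [H0 <= b 1]. The positive part stays until [h >= 0] is known. *)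
have /choice[g Hg] : forall r : R, exists v : R, 0 <= v <= 1 /\ (0 < r -> b v = Num.max (h r) 0).
  move=> r; have [r0|r0] := ltP 0 r; last by exists 0; rewrite lexx ler01; split.
  have [|v v01 bv] := @force_surjective _ _ _ a_pos a_cont a_incr s0_gt0 s0_lt1 (Num.max (h r) 0).
    by rewrite le_max lexx orbT/= ge_max (le_trans (hle _ r0) b1) (le_trans H0_ge0 b1).
  by exists v; split.
(* Copying [W0] for [r <= 0] preserves the vanishing at negative radii and makes [w] equal to [W0]
   at the origin too. *)
pose w (r : R) : R := if r <= 0 then W0 r else g r.
have w01 r : 0 <= w r <= 1 by rewrite /w; case: ifP => // _; have [] := Hg r.
have bw r : 0 < r -> b (w r) = Num.max (h r) 0.
  by move=> r0; rewrite /w leNgt r0/=; have [_ ->] := Hg r.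
have ch r : 0 < r -> {for r, continuous h}.
  move=> r0; apply: cvgB; first exact: continuous_flux.
  by apply: cvgM; [exact: cvg_cst|exact: continuous_flux].
have cw r : 0 < r -> {for r, continuous w}.
  move=> r0; apply/cvgrPdist_lt => e e0.
  have cm : {for r, continuous (fun t => Num.max (h t) 0)}.
    by apply: (@continuous_max _ R h (cst 0)); [exact: ch|exact: cvg_cst].
  have ae0 : 0 < a 0 * e by rewrite mulr_gt0.
  move/cvgrPdist_lt : cm => /(_ _ ae0) near1.
  have near2 : \forall t \near r, 0 < t by exact: lt_nbhsr.
  apply: filterS2 near1 near2 => t ht t0; rewrite -(ltr_pM2l a00).
  apply: le_lt_trans ht; rewrite -!bw//.
  have /andP[wr0 _] := w01 r; have /andP[wt0 _] := w01 t.
  exact: (force_inv_lip a_incr s0_gt0 s0_lt1).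
have mw : measurable_fun [set: R] w.
  have -> : [set: R] = `]-oo, 0] `|` `]0, +oo[.
    by apply/seteqP; split => // x _ /=; rewrite !in_itv/= andbT; case: (leP x 0) => ?; [left|right].
  apply/measurable_funU => //; split.
    apply: (eq_measurable_fun W0); last exact: measurable_funTS.
    by move=> x; rewrite inE/= in_itv/= /w => ->.
  apply: open_continuous_measurable_fun; first exact: interval_open.
  by move=> x; rewrite inE/= in_itv/= andbT => x0; exact: cw.
have wz r : 0 < r -> h r <= 0 -> w r = 0.
  move=> r0 h0; have := bw r r0; rewrite (max_idPr h0) => E.
  have /andP[wr0 _] := w01 r.
  have := force_inv_lip a_incr s0_gt0 s0_lt1 wr0 (lexx 0).
  have b0 : b 0 = 0 by rewrite /b /force mulr0.
  rewrite -/b E b0 !subr0 normr0 pmulr_rle0// => H.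
  by apply/eqP; rewrite -normr_eq0 eq_le normr_ge0 H.
have wn r : r < 0 -> w r = 0 by move=> r0; rewrite /w (ltW r0) W0n.
(* Where [h r <= 0] the minimum over [[0, 1]] is at the endpoint 0: the inequality with [h] replaced
   by 0 is improved by [- h r * v >= 0]. *)
have w_min r v : 0 < r -> 0 <= v <= 1 ->
    B (w r) - h r * w r + a 0 / 2 * (v - w r) ^+ 2 <= B v - h r * v.
  move=> r0 v01; have := bw r r0; have [h0 E|h0 E] := leP (h r) 0; last first.
    exact: (tangent_argmin tangent (w01 r) v01 E).
  have := tangent_argmin tangent (w01 r) v01 E; rewrite !mul0r !subr0 => H.
  rewrite (wz r r0 h0) in H *; rewrite mulr0 subr0; apply: (le_trans H).
  by rewrite lerDl oppr_ge0 mulr_le0_ge0//; have /andP[] := v01.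
have [dw tailw] := pointwise_tail N2 a00 cB B_bound pW0 mw w01 w_min h_min wn.
have pw_ae := pointwise_ae N2 a00 cB B_bound pW0 mw w01 w_min h_min.
have w2 : L1 (fun r => w r ^+ 2).
  apply: L1_fin; [exact: measurable_funX|by move=> x; rewrite sqr_ge0|].
  rewrite -(_ : \int[nu]_r (W0 r ^+ 2)%:E = \int[nu]_r (w r ^+ 2)%:E)%E; first by rewrite L1_EFin// ltry.
  apply: ae_eq_integral => //.
  - by apply/measurable_EFinP; apply: measurable_funX.
  - by apply/measurable_EFinP; apply: measurable_funX.
  - apply: (ae_imply pw_ae) => r Hr _; have [r0|r0] := leP r 0; last by rewrite Hr.
    by rewrite /w r0.
have Uw : tail w = U by apply/funext => r; rewrite -tailw.
have pw : profile w by split => //; rewrite Uw.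
pose G (s : R) := (F s - la * U s) * s ^+ N.-1.
have cG : continuous G.
  by move=> x; apply: cvgM; [apply: cvgB; [exact: cF|apply: cvgM; [exact: cvg_cst|exact: cU]]|exact: exprn_continuous].
have hG r : h r = primitive G r / r ^+ N.-1.
  rewrite /h /flux mulrA -mulrBl primitive_comb; [|exact: continuous_weight..].
  by congr (primitive _ _ / _); apply/funext => s; rewrite /G mulrBl mulrA.
have GE s : G s = (U s `^ (p - 2) - la) * U s * s ^+ N.-1 by rewrite /G UF -mulrBl.
(* If [U^(p-2) >= la] at [r], monotonicity of [U] makes [G] nonnegative on [[0, r]]; so a negative
   primitive forces [U^(p-2) < la] at [r], hence [G <= 0] from [r] on. If the primitive is negative
   on all of [[r, +oo[], then [h <= 0] and [w = 0] there, thus [U = 0] and [G = 0]. *)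
have G_ge0 r : 0 <= primitive G r.
  apply: primitive_ge0_sign => // {}r r0 Gr.
    have Ur : U r `^ (p - 2) < la.
      rewrite ltNge; apply/negP => Ur; move: Gr; rewrite ltNge => /negP; apply.
      apply: Rintegral_ge0 => s /=; rewrite in_itv/= => /andP[s0' sr].
      rewrite GE; apply: mulr_ge0; last exact: exprn_ge0.
      apply: mulr_ge0 => //; rewrite subr_ge0; apply: (le_trans Ur).
      apply: ge0_ler_powR; rewrite ?nnegrE ?subr_ge0 ?(ltW p2)//.
      exact: tail_nonincr.
    move=> s rs; rewrite GE; apply: mulr_le0_ge0; last by rewrite exprn_ge0// (le_trans r0).
    apply: mulr_le0_ge0 => //; rewrite subr_le0; apply: le_trans (ltW Ur).
    apply: ge0_ler_powR; rewrite ?nnegrE ?subr_ge0 ?(ltW p2)//.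
    exact: tail_nonincr.
  move=> s rs; have rp : 0 < r.
    rewrite lt_neqAle r0 andbT; apply/eqP => E.
    by have := Gr r (lexx r); rewrite -E primitive_le0// ltxx.
  have Us : U s = 0.
    rewrite /U tailw /tail /Rintegral integral0_eq// => t /=; rewrite in_itv/= andbT => st.
    have rt := le_trans rs st; have t0 := lt_le_trans rp rt.
    by rewrite wz// hG mulr_le0_ge0 ?invr_ge0 ?exprn_ge0 ?(ltW t0)// ltW// Gr.
  by rewrite GE Us mulr0 mul0r.
have h_ge0 r : 0 < r -> 0 <= h r by move=> r0; rewrite hG divr_ge0// exprn_ge0// ltW.
have bwh r : 0 < r -> b (w r) = h r.
  by move=> r0; rewrite bw// (max_idPl (h_ge0 _ r0)).
have wlt r : 0 < r -> w r < Num.sqrt s0.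
  move=> r0; have /andP[wr0 _] := w01 r.
  apply: (force_lt a_pos a_incr s0_gt0 s0_lt1 wr0 (sqrtr_ge0 _)).
  by rewrite -/b bwh//; apply: le_lt_trans s0_bound; exact: hle.
exists w, la; split; [exact: pw|by rewrite /mass_of Uw|exact: cw| |].
- move=> r r0; have /andP[-> _] := w01 r.
  exact: lt_le_trans (wlt r r0) sq1.
- move=> r r0; rewrite Uw -/(h r) -bwh// /b /force /coeff clamp_id//.
  rewrite sqr_ge0/=; have /andP[wr0 _] := w01 r.
  rewrite -[leRHS](sqr_sqrtr (ltW s0_gt0)); apply: lerXn2r; rewrite ?nnegrE ?sqrtr_ge0//.
  exact/ltW/wlt.
Qed.

End radial_solution.

(** * The weak equation *)

Section test_functions.
Variables (R : realType) (N : nat).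
Hypothesis N0 : (0 < N)%N.
Local Notation nu := (@radm R N).
Local Notation leb := (lebesgue_rV R N).
Local Notation L1 f := (leb.-integrable setT (EFin \o f)).
Implicit Types (f g phi : 'rV[R]_N -> R) (x y : 'rV[R]_N).

Lemma continuous_measurable_rV f : continuous f ->
  measurable_fun [set: borel_rV R N] (f : borel_rV R N -> measurableTypeR R).
Proof.
move=> cf; apply: (measurability (@RGenOpens.G R)); first exact: RGenOpens.measurableE.
move=> _ [_ [a [b ->]] <-]; rewrite setTI.
apply: sub_sigma_algebra; apply: open_comp; last exact: interval_open.
by move=> x _; exact: cf.
Qed.

Lemma continuous_sum (I : Type) (r : seq I) (F : I -> 'rV[R]_N -> R) :
  (forall i, continuous (F i)) -> continuous (fun x => \sum_(i <- r) F i x).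
Proof.
move=> cF x; elim: r => [|i r IH].
  by under [X in continuous_at _ X]eq_fun do rewrite big_nil; exact: cst_continuous.
under [X in continuous_at _ X]eq_fun do rewrite big_cons.
by apply: continuousD; [exact: cF|exact: IH].
Qed.

Lemma coord_le_norm x i : `|x ord0 i| <= `|x|.
Proof. by rewrite [leRHS]mx_normrE; exact: (le_bigmax _ (fun ij => `|x ij.1 ij.2|) (ord0, i)). Qed.

Lemma derive_grad f x y : differentiable f x -> 'D_y f x = dotv y (grad f x).
Proof.
move=> df; rewrite deriveE// [in LHS](row_sum_delta y) linear_sum/=.
by apply: eq_bigr => i _; rewrite linearZ/= mxE /partial deriveE.
Qed.

Lemma continuous_dot_grad f : smooth f -> continuous (fun x => dotv x (grad f x)).
Proof.
move=> sf; rewrite /dotv; apply: continuous_sum => i x.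
under [X in continuous_at _ X]eq_fun do rewrite mxE.
apply: (@continuousM _ _ (fun x : 'rV[R]_N => x ord0 i) (partial i f)); first exact: coord_continuous.
by apply: differentiable_continuous; exact: (sf [:: i]).
Qed.

(** Against a radial field the gradient of a test function enters only through [x . grad f]. *)
Lemma test_function_grad_bounds f : test_function f -> exists M A, [/\ 0 < A, 0 <= M,
  (forall x, A < enorm x -> f x = 0 /\ dotv x (grad f x) = 0),
  (forall x, `|f x| <= M) & (forall x, `|dotv x (grad f x)| <= M)].
Proof.
move=> [sf cK]; set K := closure _ in cK.
have f0 x : ~ K x -> f x = 0.
  move=> xK; apply/eqP/negPn/negP => fx; apply: xK; exact: subset_closure.
have g0 x : ~ K x -> dotv x (grad f x) = 0.
  move=> xK; rewrite /dotv big1// => i _; rewrite mxE /partial.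
  rewrite (@near_eq_derive _ _ _ _ (cst 0)) ?derive_cst ?mulr0//.
  have : open_nbhs x (~` K) by split => //; apply: closed_openC; exact: closed_closure.
  by move=> /open_nbhs_nbhs; apply: filterS => y /f0.
have bK (h : 'rV[R]_N -> R) : continuous h -> (forall x, ~ K x -> h x = 0) -> exists M, forall x, `|h x| <= M.
  move=> ch h0; have : compact (h @` K).
    by apply: continuous_compact => //; exact: continuous_subspaceT.
  move=> /compact_bounded[M [_ HM]]; exists (Num.max (M + 1) 0) => x; rewrite le_max.
  have [xK|/h0 ->] := pselect (K x); last by rewrite normr0 lexx orbT.
  by rewrite HM ?ltrDl//; exists x.
have [M1 H1] := bK _ (fun x => differentiable_continuous (sf [::] x)) f0.
have [M2 H2] := bK _ (continuous_dot_grad sf) g0.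
have /compact_bounded[A [_ HA]] := cK.
pose A' := N%:R * Num.max (A + 1) 0 + 1.
have A'0 : 0 < A' by rewrite ltr_pwDr// mulr_ge0// le_max lexx orbT.
exists (Num.max M1 M2), A'; split => //.
- by rewrite le_max (le_trans _ (H1 0)).
- move=> x Ax; have xK : ~ K x.
    move=> Kx; move: Ax; rewrite ltNge => /negP; apply.
    apply: (@le_trans _ _ (N%:R * Num.max (A + 1) 0)); last by rewrite lerDl.
    apply: enorm_le; first by rewrite le_max lexx orbT.
    move=> i; apply: le_trans (coord_le_norm x i) _; rewrite le_max.
    by rewrite (HA (A + 1))// ltrDl.
  by split; [exact: f0|exact: g0].
- by move=> x; rewrite le_max H1.
- by move=> x; rewrite le_max H2 orbT.
Qed.

Lemma L1_compact_support f (A M : R) : measurable_fun [set: borel_rV R N] f ->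
  0 < A -> 0 <= M -> (forall x, A < enorm x -> f x = 0) -> (forall x, `|f x| <= M) -> L1 f.
Proof.
move=> mf A0 M0 fA fM.
have mi : measurable_fun [set: R] (\1_(`]-oo, A + 1[) : R -> R) by exact: measurable_indic.
have iM : L1 (fun x => M * \1_(`]-oo, A + 1[ : set R) (enorm x)).
  apply: L1Z; apply: L1_fin.
  - exact: (measurableT_comp mi (@measurable_enorm R N)).
  - by [].
  - rewrite -(@ge0_integral_radm R N (fun r => (\1_(`]-oo, A + 1[ : set R) r)%:E)).
    + by rewrite integral_ball ?ltry// ltr_wpDl// ltW.
    + exact/measurable_EFinP.
    + by move=> r; rewrite lee_fin.
apply: (L1_dominated mf iM) => x; rewrite indicE mem_setE in_itv/=.
have [xA|xA] := ltP (enorm x) (A + 1); first by rewrite mulr1.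
by rewrite fA ?normr0 ?mulr0// (lt_le_trans _ xA)// ltrDl.
Qed.

Lemma is_derive_ray f y (t : R) : smooth f -> t != 0 ->
  is_derive t (1 : R) (fun t : R => f (t^-1 *: y)) (- dotv (t^-1 *: y) (grad f (t^-1 *: y)) / t).
Proof.
move=> sf t0; pose g (s : R) := f (s *: y).
have dg (s : R) : is_derive s (1 : R) g (dotv y (grad f (s *: y))).
  have df : differentiable f (s *: y) by exact: (sf [::]).
  have E : (fun h : R => h^-1 *: ((g \o shift s) (h *: (1 : R)) - g s)) =
           (fun h : R => h^-1 *: ((f \o shift (s *: y)) (h *: y) - f (s *: y))).
    by apply/funext => h; rewrite /g/= scalerDl /GRing.scale/= mulr1.
  have dv : derivable f (s *: y) y by exact: diff_derivable.
  apply: DeriveDef.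
    by rewrite /derivable E.
  by rewrite -derive_grad// /derive E.
have di := @is_deriveV R id t 1 1 t0 (is_derive_id _ _).
have := is_derive1_comp (dg t^-1) di.
rewrite (_ : _ * _ = - dotv (t^-1 *: y) (grad f (t^-1 *: y)) / t)//.
by rewrite dotvZl /GRing.scale/= mulr1 mulrN mulNr expr2 invfM; congr (- _); ring.
Qed.

End test_functions.

(** * Integration along rays *)

Section ray_tonelli.
Variables (R : realType) (N : nat).
Hypothesis N2 : (2 <= N)%N.
Let N0 : (0 < N)%N. Proof. exact: ltnW. Qed.
Local Notation nu := (@radm R N).
Local Notation leb1 := (@lebesgue_measure R).
Local Notation leb := (lebesgue_rV R N).
Local Notation L1 f := (leb.-integrable setT (EFin \o f)).
Local Notation I01 := (`]0%R, 1%R]%classic : set R).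
Implicit Types (x y : 'rV[R]_N).

Lemma measurable_inv : measurable_fun [set: R] (fun t : R => t^-1).
Proof.
rewrite (_ : (fun t : R => t^-1) = fun t => if t < 0 then - ((- t) `^ (-1)) else t `^ (-1)).
  apply: measurable_fun_ifT.
  - exact: measurable_fun_ltr.
  - apply: measurableT_comp => //.
    have mN : measurable_fun [set: R] (fun t : R => - t) by exact: oppr_measurable.
    have mP : measurable_fun [set: R] (fun t : R => t `^ (-1)) by exact: measurable_powR.
    exact: (measurableT_comp mP mN).
  - exact: measurable_powR.
apply/funext => t; case: ltP => t0; last by rewrite powR_inv1.
by rewrite powR_inv1 ?oppr_ge0 ?(ltW t0)// invrN opprK.
Qed.

Variables (f : R -> R) (g : 'rV[R]_N -> R).
Hypothesis mf : measurable_fun [set: R] f.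
Hypothesis f0 : forall r, 0 <= f r.
Hypothesis mg : measurable_fun [set: borel_rV R N] (g : borel_rV R N -> measurableTypeR R).
Hypothesis g0 : forall x, 0 <= g x.

(* Used with the positive and negative parts of [g = - x . grad phi]; their
   difference gives [phi y], as [d/dt phi (y / t) = g (y / t) / t]. *)
Definition ray_integral y : \bar R := (\int[leb1]_(t in I01) (g (t^-1 *: y) / t)%:E)%E.

Let F (z : R * borel_rV R N) : \bar R :=
  ((\1_I01 z.1 : R) * (f (z.1 * enorm (z.2 : 'rV[R]_N)) * z.1 ^+ N.-1 * g z.2))%:E.

Let H (z : R * borel_rV R N) : \bar R :=
  ((\1_I01 z.1 : R) * (f (enorm (z.2 : 'rV[R]_N)) * (g (z.1^-1 *: (z.2 : 'rV[R]_N)) / z.1)))%:E.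

Let mI : measurable_fun [set: (R * borel_rV R N)%type] (fun z => \1_I01 z.1 : R).
Proof. exact: (measurableT_comp (measurable_indic (measurable_itv _)) measurable_fst). Qed.

Let menorm : measurable_fun [set: (R * borel_rV R N)%type] (fun z => enorm (z.2 : 'rV[R]_N)).
Proof. exact: (measurableT_comp (@measurable_enorm R N) measurable_snd). Qed.

Let mF : measurable_fun [set: (R * borel_rV R N)%type] F.
Proof.
apply/measurable_EFinP; apply: measurable_funM; first exact: mI.
apply: measurable_funM; last exact: (measurableT_comp mg measurable_snd).
apply: measurable_funM; last by apply: measurable_funX; exact: measurable_fst.
by apply: (measurableT_comp mf); apply: measurable_funM; [exact: measurable_fst|exact: menorm].
Qed.

Let mK : measurable_fun [set: (R * borel_rV R N)%type]
  (fun z => g (z.1^-1 *: (z.2 : 'rV[R]_N)) / z.1).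
Proof.
have mi : measurable_fun [set: (R * borel_rV R N)%type] (fun z => z.1^-1).
  exact: (measurableT_comp measurable_inv measurable_fst).
apply: measurable_funM; last exact: mi.
apply: (measurableT_comp mg); apply: measurable_rV => i.
rewrite (_ : (fun t => _) = (fun z : R * borel_rV R N => z.1^-1 * (z.2 : 'rV[R]_N) ord0 i)).
  by apply: measurable_funM; [exact: mi|exact: (measurableT_comp (measurable_coord i) measurable_snd)].
by apply/funext => z; rewrite mxE.
Qed.

Let mH : measurable_fun [set: (R * borel_rV R N)%type] H.
Proof.
apply/measurable_EFinP; apply: measurable_funM; first exact: mI.
by apply: measurable_funM; [exact: (measurableT_comp mf menorm)|exact: mK].
Qed.

Let mKy (y : borel_rV R N) : measurable_fun [set: R] (fun t : R => g (t^-1 *: (y : 'rV[R]_N)) / t).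
Proof.
have mp : measurable_fun [set: R] (fun t : R => (t, y)) by apply: measurable_fun_pair.
exact: (measurableT_comp mK mp).
Qed.

Let F0 z : (0 <= F z)%E.
Proof.
rewrite lee_fin indicE mem_setE in_itv/=; case: (boolP (0 < z.1 <= 1)) => [/andP[t0 _]|_]; last by rewrite mul0r.
by rewrite mul1r !mulr_ge0// exprn_ge0// ltW.
Qed.

Let H0 z : (0 <= H z)%E.
Proof.
rewrite lee_fin indicE mem_setE in_itv/=; case: (boolP (0 < z.1 <= 1)) => [/andP[t0 _]|_]; last by rewrite mul0r.
by rewrite mul1r !mulr_ge0// invr_ge0 ltW.
Qed.

Lemma measurable_ray_integral : measurable_fun [set: borel_rV R N] ray_integral.
Proof.
pose K (z : R * borel_rV R N) : \bar R :=
  ((\1_I01 z.1 : R) * (g (z.1^-1 *: (z.2 : 'rV[R]_N)) / z.1))%:E.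
have mK' : measurable_fun [set: (R * borel_rV R N)%type] K.
  by apply/measurable_EFinP; exact: measurable_funM.
have K0 z : (0 <= K z)%E.
  rewrite lee_fin indicE mem_setE in_itv/=; case: (boolP (0 < z.1 <= 1)) => [/andP[t0 _]|_]; last by rewrite mul0r.
  by rewrite mul1r !mulr_ge0// invr_ge0 ltW.
have := @measurable_fun_fubini_tonelli_G _ _ _ _ _ leb1 K mK' K0.
apply: eq_measurable_fun => y _; rewrite /ray_integral integral_mkcond /fubini_G.
apply: eq_integral => t _; rewrite /K/= /patch indicE; case: ifP => _.
  by rewrite mul1r.
by rewrite mul0r.
Qed.

(** Between two uses of Tonelli, [y = t x] is substituted at fixed [t]. The Jacobian [t^-N] and the
    weight [t^(N-1)] leave the factor [1 / t] of the ray integral. *)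
Lemma ray_tonelli :
  (\int[leb]_x ((\int[leb1]_(t in I01) (f (t * enorm x) * t ^+ N.-1)%:E) * (g x)%:E) =
   \int[leb]_y ((f (enorm y))%:E * ray_integral y))%E.
Proof.
transitivity (\int[leb]_x \int[leb1]_t F (t, x))%E.
  apply: eq_integral => x _.
  rewrite muleC integral_mkcond -ge0_integralZl//.
  - apply: eq_integral => t _; rewrite /F/= /patch indicE; case: ifP => _.
      by rewrite -EFinM mul1r mulrC.
    by rewrite mul0r mule0.
  - apply/(measurable_restrictT _ _).1 => //; apply/measurable_EFinP; apply: measurable_funTS.
    apply: measurable_funM; last exact: measurable_funX.
    by apply: (measurableT_comp mf); exact: measurable_funM.
  - move=> t _; rewrite /patch; case: ifP => //; rewrite inE/= in_itv/= => /andP[t0 _].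
    by rewrite lee_fin mulr_ge0// exprn_ge0// ltW.
  - by rewrite lee_fin.
rewrite -(@fubini_tonelli _ _ _ _ _ leb1 leb F mF F0).
transitivity (\int[leb1]_t \int[leb]_y H (t, y))%E; last first.
  rewrite (@fubini_tonelli _ _ _ _ _ leb1 leb H mH H0).
  apply: eq_integral => y _; rewrite /ray_integral [X in _ = (_ * X)%E]integral_mkcond -ge0_integralZl//.
  - apply: eq_integral => t _; rewrite /H/= /patch indicE; case: ifP => _.
      by rewrite -EFinM mul1r.
    by rewrite mul0r mule0.
  - apply/(measurable_restrictT _ _).1 => //; apply/measurable_EFinP; apply: measurable_funTS.
    exact: mKy.
  - move=> t _; rewrite /patch; case: ifP => //; rewrite inE/= in_itv/= => /andP[t0 _].
    by rewrite lee_fin mulr_ge0// invr_ge0 ltW.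
  - by rewrite lee_fin.
apply: eq_integral => t _.
have [|tI] := boolP (t \in I01); last first.
  by rewrite !integral0_eq// => x _; rewrite /F /H/= indicE (negbTE tI) mul0r.
rewrite inE/= in_itv/= => /andP[t0 t1].
pose G (y : borel_rV R N) : \bar R := (f (enorm (y : 'rV[R]_N)) * g (t^-1 *: (y : 'rV[R]_N)))%:E.
have mG : measurable_fun setT G.
  apply/measurable_EFinP; apply: measurable_funM; first exact: (measurableT_comp mf (@measurable_enorm R N)).
  exact: (measurableT_comp mg (@measurable_rV_scale R N t^-1)).
have G0 y : (0 <= G y)%E by rewrite lee_fin mulr_ge0.
have tI : \1_I01 t = 1 :> R by rewrite indicE mem_set//= in_itv/= t0.
have tn : 0 <= t ^+ N.-1 by rewrite exprn_ge0// ltW.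
have ti : 0 <= t^-1 by rewrite invr_ge0 ltW.
transitivity ((t ^+ N.-1)%:E * \int[leb]_x G (t *: (x : 'rV[R]_N))%R)%E.
  rewrite -ge0_integralZl//.
  - apply: eq_integral => x _; rewrite /F/G/= tI mul1r enormZ (gtr0_norm t0) scalerA mulVf ?gt_eqF// scale1r.
    by rewrite -EFinM; congr (_%:E); ring.
  - exact: (measurableT_comp mG (@measurable_rV_scale R N t)).
rewrite (ge0_integral_scale t0 mG G0) muleA -EFinM -ge0_integralZl//.
- apply: eq_integral => y _; rewrite /G /H/= tI mul1r -EFinM; congr (_%:E).
  have -> : t ^+ N.-1 * t^-1 ^+ N = t^-1.
    by rewrite -[in t^-1 ^+ N](prednK N0) exprSr mulrA -exprMn mulfV ?gt_eqF// expr1n mul1r.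
  by ring.
- by rewrite lee_fin mulr_ge0// exprn_ge0.
Qed.

(** The substitution [s = r t] yields [r^-N] times the primitive that defines the flux. *)
Lemma ray_weight (r : R) : continuous f -> 0 < r ->
  (\int[leb1]_(t in I01) (f (t * r) * t ^+ N.-1)%:E = (flux N f r / r)%:E)%E.
Proof.
move=> cf r0.
pose G (s : R) : \bar R := ((\1_(`[0%R, r]%classic : set R) s : R) * (f s * s ^+ N.-1))%:E.
have iw : leb1.-integrable `[0, r] (EFin \o (fun s => f s * s ^+ N.-1)).
  exact: (continuous_integrable_itv (continuous_weight cf)).
have mw : measurable_fun [set: R] (fun s => f s * s ^+ N.-1).
  by apply: continuous_measurable_fun; exact: continuous_weight.
have mG : measurable_fun [set: R] G.
  by apply/measurable_EFinP; apply: measurable_funM => //; exact: measurable_indic.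
have G0 s : (0 <= G s)%E.
  rewrite lee_fin indicE mem_setE in_itv/=; case: (boolP (0 <= s <= r)) => [/andP[t0 _]|_]; last by rewrite mul0r.
  by rewrite mul1r !mulr_ge0// exprn_ge0.
have rn : 0 < r ^+ N.-1 by rewrite exprn_gt0.
have GE : (\int[leb1]_s G s = (primitive (fun s => f s * s ^+ N.-1) r)%:E)%E.
  rewrite /primitive /Rintegral fineK; last exact: integrable_fin_num iw.
  rewrite [RHS]integral_mkcond; apply: eq_integral => s _; rewrite /G/= /patch indicE.
  by case: ifP => _; rewrite ?mul1r// mul0r.
transitivity (\int[leb1]_t ((r ^- N.-1)%:E * G (r * t)%R))%E.
  rewrite integral_itv_obnd_cbnd; last first.
    apply: measurable_funTS; apply/measurable_EFinP; apply: measurable_funM; last exact: measurable_funX.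
    by apply: (measurableT_comp mf); exact: measurable_funM.
  rewrite [LHS]integral_mkcond; apply: eq_integral => t _.
  have tr : (r * t <= r) = (t <= 1) by rewrite -[leRHS]mulr1 ler_pM2l.
  rewrite /G /patch -EFinM indicE !mem_setE !in_itv/= pmulr_rge0// tr.
  case: ifP => _; last by rewrite mul0r mulr0.
  by rewrite mul1r exprMn [t * r]mulrC; congr (_%:E); field; rewrite gt_eqF.
have ml : measurable_fun [set: R] (fun t : R => r * t) by exact: measurable_funM.
rewrite ge0_integralZl//; last 2 first.
- exact: (measurableT_comp mG ml).
- by rewrite lee_fin invr_ge0 ltW.
rewrite (ge0_integral_scale1 r0 mG G0) GE -!EFinM; congr (_%:E).
by rewrite /flux; field; rewrite gt_eqF//= gt_eqF.
Qed.

End ray_tonelli.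

(** * The weak divergence identity for radial fields *)

Section weak_identity.
Variables (R : realType) (N : nat).
Hypothesis N2 : (2 <= N)%N.
Let N0 : (0 < N)%N. Proof. exact: ltnW. Qed.
Local Notation nu := (@radm R N).
Local Notation leb1 := (@lebesgue_measure R).
Local Notation leb := (lebesgue_rV R N).
Local Notation L1 f := (leb.-integrable setT (EFin \o f)).
Local Notation I01 := (`]0%R, 1%R]%classic : set R).
Implicit Types (x y : 'rV[R]_N).

Lemma ae_neq0 : {ae leb, forall y : borel_rV R N, (y : 'rV[R]_N) != 0}.
Proof.
have m0 : measurable_fun [set: R] (fun r => (\1_([set 0%R] : set R) r : R)%:E).
  by apply/measurable_EFinP; apply: measurable_indic; exact: measurable_set1.
have E : (\int[leb]_x (\1_([set 0%R] : set R) (enorm (x : 'rV[R]_N)) : R)%:E = 0)%E.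
  rewrite -(@ge0_integral_radm R N (fun r => (\1_([set 0%R] : set R) r : R)%:E))//.
  rewrite (ge0_integral_polar N0 m0)//.
  apply: integral0_eq => r _; rewrite indicE; have [->|r0] := eqVneq r 0.
    by rewrite /polar_density ltxx; move: N2; case: (N) => [//|[//|n]] _; rewrite expr0n mulr0 mule0.
  by rewrite memNset ?mul0e//; exact/eqP.
have m1 : measurable_fun [set: borel_rV R N] (fun x => (\1_([set 0%R] : set R) (enorm (x : 'rV[R]_N)) : R)%:E).
  exact: (measurableT_comp m0 (@measurable_enorm R N)).
have := (ae_eq_integral_abs leb measurableT m1).1.
have -> : (\int[leb]_x `|(\1_([set 0%R] : set R) (enorm (x : 'rV[R]_N)) : R)%:E| = 0)%E.
  by rewrite -[RHS]E; apply: eq_integral => x _; rewrite gee0_abs.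
move=> /(_ erefl) H; apply: (ae_imply H) => x /(_ I) /= [] /eqP.
rewrite indicE pnatr_eq0 eqb0; apply: contra => /eqP ->.
by rewrite enorm0; apply/mem_set.
Qed.

Section identity.
Variables (f : R -> R) (M : R).
Hypothesis cf : continuous f.
Hypothesis f0 : forall r, 0 <= f r.
Hypothesis fM : forall r, f r <= M.
Let M0 : 0 <= M. Proof. exact: le_trans (f0 0) (fM 0). Qed.
Let mf : measurable_fun [set: R] f. Proof. exact: continuous_measurable_fun. Qed.
Let k (r : R) := flux N f r / r.

Lemma weight_bound r : 0 <= r -> 0 <= k r <= M.
Proof.
rewrite le_eqVlt => /predU1P[<-|r0]; first by rewrite /k invr0 mulr0 lexx M0.
have rn : 0 < r ^+ N.-1 by rewrite exprn_gt0.
rewrite /k divr_ge0 ?flux_ge0 ?(ltW r0)//=.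
have H s : 0 <= s <= r -> `|f s * s ^+ N.-1| <= M * r ^+ N.-1.
  move=> /andP[s0 sr]; rewrite ger0_norm ?mulr_ge0 ?exprn_ge0//.
  apply: ler_pM; rewrite ?exprn_ge0//.
  by apply: lerXn2r; rewrite ?nnegrE// ltW.
have := primitive_sub_le (continuous_weight (N := N) cf) (lexx 0) (ltW r0) H.
rewrite (primitive_le0 _ (lexx 0)) !subr0 => /(le_trans (ler_norm _)) h.
by rewrite /flux !ler_pdivrMr// mulrAC.
Qed.

Let mk : measurable_fun [set: R] k.
Proof. by apply: measurable_funM; [exact: measurable_flux|exact: measurable_inv]. Qed.

Let mk' : measurable_fun [set: borel_rV R N] (fun x => k (enorm (x : 'rV[R]_N))).
Proof. exact: (measurableT_comp mk (@measurable_enorm R N)). Qed.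

Let mf' : measurable_fun [set: borel_rV R N] (fun x => f (enorm (x : 'rV[R]_N))).
Proof. exact: (measurableT_comp mf (@measurable_enorm R N)). Qed.

Lemma ray_identity (g : 'rV[R]_N -> R) :
  measurable_fun [set: borel_rV R N] (g : borel_rV R N -> measurableTypeR R) ->
  (forall x, 0 <= g x) -> g 0 = 0 -> L1 g ->
  L1 (fun x => k (enorm (x : 'rV[R]_N)) * g x) /\
  (\int[leb]_y ((f (enorm (y : 'rV[R]_N)))%:E * ray_integral g y) =
  (\int[leb]_x (k (enorm (x : 'rV[R]_N)) * g x))%:E)%E.
Proof.
move=> mg g0 g00 ig.
have ikg : L1 (fun x => k (enorm (x : 'rV[R]_N)) * g x).
  apply: (L1_dominated _ (L1Z M ig)); first exact: measurable_funM.
  move=> x; have /andP[k0 kM] := weight_bound (enorm_ge0 x).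
  rewrite ger0_norm; last exact: mulr_ge0.
  exact: (ler_wpM2r (g0 x) kM).
split => //; rewrite -L1_EFin// -(ray_tonelli N2 mf f0 mg g0).
apply: eq_integral => x _; have [->|x0] := eqVneq (x : 'rV[R]_N) 0.
  by rewrite g00 mule0 mulr0.
have xp : 0 < enorm (x : 'rV[R]_N).
  by rewrite lt_neqAle enorm_ge0 andbT eq_sym; apply: contra x0 => /eqP /enorm_eq0 ->.
by rewrite (ray_weight N mf f0 cf xp).
Qed.


Section test.
Variable phi : 'rV[R]_N -> R.
Hypothesis tphi : test_function phi.
Let psi x : R := - dotv x (grad phi x).
Let pos x : R := Num.max (psi x) 0.
Let neg x : R := Num.max (- psi x) 0.

Let cpsi : continuous psi.
Proof. by have [sphi _] := tphi; move=> x; exact: (cvgN (@continuous_dot_grad R N phi sphi x)). Qed.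

Let cmax (g : 'rV[R]_N -> R) : continuous g -> continuous (fun x => Num.max (g x) 0).
Proof. by move=> cg x; exact: (continuous_max (cg x) (@cst_continuous _ _ (0 : R) x)). Qed.

Let cpos : continuous pos. Proof. exact: (cmax cpsi). Qed.

Let cneg : continuous neg.
Proof. by apply: (cmax (g := fun x => - psi x)) => x; exact: (cvgN (@cpsi x)). Qed.

Let psi0 : psi 0 = 0.
Proof. by rewrite /psi -[X in dotv X _](scale0r 0) dotvZl mul0r oppr0. Qed.

Let bounds : exists B A, [/\ 0 < A, 0 <= B, (forall x, A < enorm x -> phi x = 0 /\ psi x = 0),
  (forall x, `|phi x| <= B) & forall x, `|psi x| <= B].
Proof.
have [B [A [A0 B0 H1 H2 H3]]] := test_function_grad_bounds tphi.
exists B, A; split => //; first by move=> x /H1[-> H]; rewrite /psi H oppr0.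
by move=> x; rewrite /psi normrN.
Qed.

Let max_norm (t : R) : `|Num.max t 0| <= `|t|.
Proof. by have := max0_lip t 0; rewrite maxxx !subr0. Qed.

Let ipos : L1 pos.
Proof.
have [B [A [A0 B0 H1 H2 H3]]] := bounds.
apply: (L1_compact_support N0 (continuous_measurable_rV cpos) A0 B0).
- by move=> x /H1[_ E]; rewrite /pos E maxxx.
- by move=> x; apply: le_trans (H3 x); exact: max_norm.
Qed.

Let ineg : L1 neg.
Proof.
have [B [A [A0 B0 H1 H2 H3]]] := bounds.
apply: (L1_compact_support N0 (continuous_measurable_rV cneg) A0 B0).
- by move=> x /H1[_ E]; rewrite /neg E oppr0 maxxx.
- by move=> x; apply: le_trans (H3 x); rewrite -(normrN (psi x)); exact: max_norm.
Qed.

Let pos_neg x : pos x - neg x = psi x.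
Proof.
rewrite /pos /neg; have [h|/ltW h] := leP (psi x) 0.
  by rewrite max_l ?oppr_ge0// sub0r opprK.
by rewrite max_r ?oppr_le0// subr0.
Qed.

(** For [t <= d] the point [y / t] is outside the support of [phi], so the ray integrals are proper
    integrals over [[d, 1]]. The fundamental theorem of calculus then gives [phi y - phi (y / d)],
    whose last term vanishes. *)
Lemma ray_integral_test y : y != 0 -> exists P Q, [/\ ray_integral pos y = P%:E,
  ray_integral neg y = Q%:E & P - Q = phi y].
Proof.
move=> y0; have [B [A [A0 B0 H1 _ _]]] := bounds.
have yp : 0 < enorm y.
  by rewrite lt_neqAle enorm_ge0 andbT eq_sym; apply: contra y0 => /eqP /enorm_eq0 ->.
pose d := Num.min 1 (enorm y / (A + 1)).
have A1 : 0 < A + 1 by rewrite addr_gt0.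
have d0 : 0 < d by rewrite lt_min ltr01 divr_gt0.
have d1 : d <= 1 by rewrite ge_min lexx.
have large t : 0 < t -> t <= d -> A < enorm (t^-1 *: y).
  move=> t0; rewrite le_min => /andP[_ td]; rewrite enormZ gtr0_norm ?invr_gt0//.
  rewrite mulrC ltr_pdivlMr//; move: td; rewrite ler_pdivlMr// => td.
  by apply: lt_le_trans td; rewrite mulrC ltr_pM2l// ltrDl.
have split_int (g : 'rV[R]_N -> R) : (forall x, A < enorm x -> g x = 0) ->
    ray_integral g y = (\int[leb1]_(t in `[d, 1%R]) (g (t^-1 *: y) / t)%:E)%E.
  move=> gA; rewrite /ray_integral [LHS]integral_mkcond [RHS]integral_mkcond; apply: eq_integral => t _.
  rewrite /patch !mem_setE !in_itv/=; have [td|td] := leP d t.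
    by rewrite (lt_le_trans d0 td).
  by case: ifP => // /andP[t0 _]; rewrite gA ?mul0r// large// ltW.
have cray (g : 'rV[R]_N -> R) (t : R) : continuous g -> 0 < t -> {for t, continuous (fun t : R => g (t^-1 *: y) / t)}.
  move=> cg t0.
  have ci : {for t, continuous (fun t : R => t^-1)} by apply: inv_continuous; rewrite gt_eqF.
  apply: cvgM; last exact: ci.
  have cs : {for t, continuous (fun t : R => t^-1 *: y)} by apply: cvgZr_tmp; exact: ci.
  exact: (cvg_comp _ _ cs (@cg _)).
have iray (g : 'rV[R]_N -> R) : continuous g -> leb1.-integrable `[d, 1] (EFin \o (fun t : R => g (t^-1 *: y) / t)).
  move=> cg; apply: continuous_compact_integrable; first exact: segment_compact.
  apply: continuous_in_subspaceT => t; rewrite inE/= in_itv/= => /andP[dt _].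
  by apply: cray => //; exact: lt_le_trans dt.
pose P := \int[leb1]_(t in `[d, 1]) (pos (t^-1 *: y) / t).
pose Q := \int[leb1]_(t in `[d, 1]) (neg (t^-1 *: y) / t).
exists P, Q; split.
- rewrite split_int; last by move=> x /H1[_ E]; rewrite /pos E maxxx.
  by rewrite /P /Rintegral fineK//; exact: integrable_fin_num (iray _ cpos).
- rewrite split_int; last by move=> x /H1[_ E]; rewrite /neg E oppr0 maxxx.
  by rewrite /Q /Rintegral fineK//; exact: integrable_fin_num (iray _ cneg).
- rewrite /P /Q -RintegralB//; [|exact: iray|exact: iray].
  have -> : (\int[leb1]_(t in `[d, 1]) (pos (t^-1 *: y) / t - neg (t^-1 *: y) / t)) =
            \int[leb1]_(t in `[d, 1]) (psi (t^-1 *: y) / t).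
    by congr (Rintegral _ _ _); apply/funext => t; rewrite -mulrBl pos_neg.
  have E : (\int[leb1]_(t in `[d, 1%R]) (psi (t^-1 *: y) / t)%:E = (phi (1^-1 *: y) - phi (d^-1 *: y))%:E)%E.
    apply: (@integral_FTC2 R (fun t => psi (t^-1 *: y) / t) (fun t => phi (t^-1 *: y)) d 1 d1).
    + move=> t /andP[dt _]; apply: is_derive_ray; first by case: tphi.
      by rewrite gt_eqF// (lt_le_trans d0).
    + by move=> t /andP[dt _]; apply: cray => //; exact: lt_le_trans dt.
  rewrite /Rintegral E/= invr1 scale1r; have /H1[-> _] := large _ d0 (lexx d).
  by rewrite subr0.
Qed.

(** The field [k(|x|) x] has divergence [f(|x|)] in the sense of distributions. It comes from
    integrating the ray formula for [phi y] against [f(|y|)] and applying [ray_identity] to the two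
    parts of [psi] separately. *)
Theorem radial_weak_identity :
  [/\ L1 (fun x => k (enorm (x : 'rV[R]_N)) * psi x), L1 (fun x => f (enorm (x : 'rV[R]_N)) * phi x) &
   \int[leb]_x (k (enorm (x : 'rV[R]_N)) * psi x) = \int[leb]_x (f (enorm (x : 'rV[R]_N)) * phi x)].
Proof.
have [B [A [A0 B0 H1 H2 H3]]] := bounds.
have mphi : measurable_fun [set: borel_rV R N] (phi : borel_rV R N -> measurableTypeR R).
  by apply: continuous_measurable_rV => x; apply: differentiable_continuous; have [sphi _] := tphi; exact: (sphi [::]).
have iphi : L1 phi.
  by apply: (L1_compact_support N0 mphi A0 B0) => // x /H1[].
have ifphi : L1 (fun x => f (enorm (x : 'rV[R]_N)) * phi x).
  have iab : L1 (fun x => `|phi x|) by have := integrable_abse iphi.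
  apply: (L1_dominated _ (L1Z M iab)); first exact: measurable_funM.
  by move=> x; rewrite normrM ger0_norm// ler_wpM2r.
have mpos := continuous_measurable_rV cpos; have mneg := continuous_measurable_rV cneg.
have pos_ge0 x : 0 <= pos x by rewrite le_max lexx orbT.
have neg_ge0 x : 0 <= neg x by rewrite le_max lexx orbT.
have [ikp Ep] := ray_identity mpos pos_ge0 (etrans (congr1 (fun t => Num.max t 0) psi0) (maxxx 0)) ipos.
have [ikn En] := ray_identity mneg neg_ge0 (etrans (congr1 (fun t => Num.max (- t) 0) psi0) (etrans (congr1 (fun t => Num.max t 0) (@oppr0 R)) (maxxx 0))) ineg.
have Ek : (fun x => k (enorm (x : 'rV[R]_N)) * psi x) =
    (fun x => k (enorm (x : 'rV[R]_N)) * pos x - k (enorm (x : 'rV[R]_N)) * neg x).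
  by apply/funext => x; rewrite -mulrBr pos_neg.
have key (g : 'rV[R]_N -> R) : measurable_fun [set: borel_rV R N] (g : borel_rV R N -> measurableTypeR R) ->
    (forall x, 0 <= g x) -> (forall y, y != 0 -> ray_integral g y \is a fin_num) ->
    (\int[leb]_y ((f (enorm (y : 'rV[R]_N)))%:E * ray_integral g y) < +oo)%E ->
    L1 (fun y => f (enorm (y : 'rV[R]_N)) * fine (ray_integral g y)) /\
    (\int[leb]_y ((f (enorm (y : 'rV[R]_N)))%:E * ray_integral g y) =
    (\int[leb]_y (f (enorm (y : 'rV[R]_N)) * fine (ray_integral g y)))%:E)%E.
  move=> mg g0 gfin glt.
  have mr := measurable_ray_integral mg g0.
  have mfr : measurable_fun [set: borel_rV R N] (fun y => f (enorm (y : 'rV[R]_N)) * fine (ray_integral g y)).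
    by apply: measurable_funM => //; exact: (measurableT_comp (@fine_measurable R setT measurableT) mr).
  have E : (\int[leb]_y ((f (enorm (y : 'rV[R]_N)))%:E * ray_integral g y) =
      \int[leb]_y (f (enorm (y : 'rV[R]_N)) * fine (ray_integral g y))%:E)%E.
    apply: ae_eq_integral => //.
    - by apply: emeasurable_funM => //; exact/measurable_EFinP.
    - exact/measurable_EFinP.
    - by apply: (ae_imply ae_neq0) => y y0 _; rewrite EFinM fineK// gfin.
  have i : L1 (fun y => f (enorm (y : 'rV[R]_N)) * fine (ray_integral g y)).
    apply: L1_fin => //; last by rewrite -E.
    move=> y; rewrite mulr_ge0// fine_ge0// integral_ge0// => t; rewrite /= in_itv/= => /andP[t0 _].
    by rewrite lee_fin mulr_ge0// invr_ge0 ltW.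
  by split => //; rewrite E L1_EFin.
have [||i1 E1] := key _ mpos pos_ge0.
- by move=> y /ray_integral_test[P [Q [-> _ _]]].
- by rewrite Ep ltry.
have [||i2 E2] := key _ mneg neg_ge0.
- by move=> y /ray_integral_test[P [Q [_ -> _]]].
- by rewrite En ltry.
split => //; first by rewrite Ek; exact: L1B ikp ikn.
rewrite Ek (RintegralT_B ikp ikn).
move: Ep En; rewrite E1 E2 => -[<-] [<-]; rewrite -(RintegralT_B i1 i2).
congr fine; apply: ae_eq_integral => //.
- by apply/measurable_EFinP; have := L1_measurable (L1B i1 i2).
- by apply/measurable_EFinP; exact: L1_measurable ifphi.
- apply: (ae_imply ae_neq0) => y y0 _.
  by have [P [Q [-> -> <-]]] := ray_integral_test y0; rewrite /= mulrBr.
Qed.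

End test.
End identity.
End weak_identity.

(** * Approximation by test functions *)

Section flat.
Variable R : realType.
Implicit Types (Q : {poly R}) (t y : R).

(** Write [expR y] as [expR (y / n)^n] and use [expR z >= z]. *)
Lemma powR_expR_le n y : 0 <= y -> y ^+ n * expR (- y) <= n%:R ^+ n.
Proof.
move=> y0; case: n => [|n].
  by rewrite !expr0 mul1r -expR0 ler_expR oppr_le0.
rewrite expRN -ler_pdivlMr ?invr_gt0 ?expR_gt0// invrK.
have -> : expR y = expR (y / n.+1%:R) ^+ n.+1.
  by rewrite -expRM_natl; congr expR; field; rewrite gt_eqF// ltr0n.
rewrite -exprMn; apply: lerXn2r; rewrite ?nnegrE ?mulr_ge0 ?expR_ge0//.
rewrite mulrC -ler_pdivrMr ?ltr0n//.
by apply: le_trans (expR_ge1Dx _); rewrite lerDr.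
Qed.

(** The extra power [y^n] lets the induction on [Q] absorb a factor [y]. *)
Lemma poly_expR_bound Q n : exists2 C, 0 <= C &
  forall y, 0 <= y -> `|y ^+ n * Q.[y] * expR (- y)| <= C.
Proof.
elim/poly_ind: Q n => [|Q c IH] n.
  by exists 0 => // y _; rewrite horner0 mulr0 mul0r normr0.
have [C C0 HC] := IH n.+1; exists (C + `|c| * n%:R ^+ n).
  by rewrite addr_ge0// mulr_ge0// exprn_ge0.
move=> y y0; rewrite hornerMXaddC.
have -> : y ^+ n * (Q.[y] * y + c) * expR (- y) =
  y ^+ n.+1 * Q.[y] * expR (- y) + c * (y ^+ n * expR (- y)) by rewrite exprS; ring.
apply: le_trans (ler_normD _ _) _; apply: lerD; first exact: HC.
rewrite normrM ler_wpM2l// ger0_norm ?mulr_ge0 ?exprn_ge0 ?expR_ge0//.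
exact: powR_expR_le.
Qed.

Lemma quadratic_is_derive0 (f : R -> R) (C : R) : (forall h, `|f h| <= C * h ^+ 2) ->
  is_derive (0 : R) (1 : R) f 0.
Proof.
move=> fC.
have f0 : f 0 = 0.
  by apply/eqP; rewrite -normr_eq0 eq_le normr_ge0 andbT (le_trans (fC 0))// expr0n mulr0.
have C0 : 0 <= C by have := fC 1; rewrite expr1n mulr1; apply: le_trans.
have H : h^-1 *: ((f \o shift 0) (h *: (1 : R)) - f 0) @[h --> 0^'] --> (0 : R).
  apply/cvgrPdist_lt => e e0.
  have d0 : 0 < e / (C + 1) by rewrite divr_gt0// ltr_pwDr.
  near=> h.
  have h0 : h != 0 by near: h; exact: nbhs_dnbhs_neq.
  have hd : `|h| < e / (C + 1).
    by near: h; apply: dnbhs0_lt.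
  rewrite f0 subr0 sub0r normrN /= addr0 /GRing.scale/= mulr1 normrM normfV.
  rewrite mulrC ltr_pdivrMr ?normr_gt0//; apply: le_lt_trans (fC h) _.
  have hp : 0 < `|h| by rewrite normr_gt0.
  rewrite -real_normK ?num_real// expr2 mulrA ltr_pM2r//.
  rewrite ltr_pdivlMr ?ltr_pwDr// in hd.
  by apply: le_lt_trans hd; rewrite mulrC ler_wpM2l// lerDl.
by apply: DeriveDef; [apply/cvg_ex; exists 0|exact: (cvg_lim _ H)].
Unshelve. all: by end_near.
Qed.

(** Allowing an arbitrary polynomial [Q] in front of [exp (-1/t)] makes the family stable under
    differentiation, so that smoothness at 0 needs only first derivatives. *)
Definition flat Q t : R := if 0 < t then Q.[t^-1] * expR (- t^-1) else 0.

Lemma flat_le0 Q t : t <= 0 -> flat Q t = 0.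
Proof. by move=> t0; rewrite /flat ltNge t0. Qed.

Lemma is_derive_flat Q t : is_derive t (1 : R) (flat Q) (flat ('X^2 * (Q - Q^`())) t).
Proof.
have [t0|t0|->] := ltgtP t 0.
- rewrite flat_le0 ?ltW//.
  have H : {near t, cst 0 =1 flat Q}.
    have : \forall x \near t, x < 0 by exact: lt_nbhsl.
    by apply: filterS => x x0; rewrite flat_le0// ltW.
  exact: (near_eq_is_derive H (is_derive_cst (0 : R) t 1)).
- have H : {near t, (fun t => Q.[t^-1] * expR (- t^-1)) =1 flat Q}.
    have : \forall x \near t, 0 < x by exact: lt_nbhsr.
    by apply: filterS => x x0; rewrite /flat x0.
  have tn : t != 0 by rewrite gt_eqF.
  have di := @is_deriveV R id t 1 1 tn (is_derive_id _ _).
  have d1 := is_derive1_comp (is_derive_poly Q t^-1) di.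
  have dn : is_derive t (1 : R) (fun t : R => - t^-1) (- (- t ^- 2 *: (1 : R))) by exact: is_deriveN.
  have d2 := @is_derive1_comp _ expR (fun t : R => - t^-1) t _ _ (is_derive_expR (- t^-1)) dn.
  have d3 := is_deriveM d1 d2.
  apply: (near_eq_is_derive H); apply: (is_derive_eq d3).
  by rewrite /flat t0 /= /GRing.scale/= !hornerE /= exprVn; ring.
- rewrite (flat_le0 _ (lexx 0)).
  have [C C0 HC] := poly_expR_bound Q 2.
  apply: (@quadratic_is_derive0 _ C) => h.
  have [h0|h0] := leP h 0; first by rewrite flat_le0// normr0 mulr_ge0 ?sqr_ge0.
  rewrite /flat h0; have := HC h^-1; rewrite invr_ge0 => /(_ (ltW h0)).
  rewrite -mulrA normrM exprVn normfV [`|h ^+ 2|]ger0_norm ?sqr_ge0//.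
  by rewrite mulrC ler_pdivrMr ?exprn_gt0.
Qed.

End flat.

Section smooth_functions.
Variable R : realType.
Local Notation leb := (@lebesgue_measure R).

Lemma is_derive_primitive (g : R -> R) (t : R) : continuous g -> (forall s, s <= 0 -> g s = 0) ->
  is_derive t (1 : R) (primitive g) (g t).
Proof.
(* Integration starts at a point below both [t] and 0, so that [t] is interior; nothing is added,
   because [g] vanishes up to 0. *)
move=> cg g0; pose a : R := Num.min t 0 - 1.
have at_ : a < t by rewrite /a ltrBlDr (@le_lt_trans _ _ t)// ?ltrDl// ge_min lexx.
have a0 : a <= 0 by rewrite /a lerBlDr (@le_trans _ _ 0)// ?lerDl// ge_min lexx orbT.
have E : primitive g = (fun x => \int[leb]_(s in `[a, x]) g s).
  apply/funext => x; rewrite /primitive /Rintegral [in LHS]integral_mkcond [in RHS]integral_mkcond.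
  congr fine; apply: eq_integral => s _; rewrite /patch !mem_setE !in_itv/=.
  have [s0|s0] := leP 0 s; first by rewrite (le_trans a0 s0).
  by rewrite g0 ?(ltW s0)//; case: ifP.
have ht : t < t + 1 by rewrite ltrDl.
have [d1 d2] := @continuous_FTC1_closed R g a t (t + 1) ht (continuous_integrable_itv cg a (t + 1)) at_ (cg t).
rewrite E; apply: DeriveDef; first exact: d1.
by rewrite -derive1E; exact: d2.
Qed.

(* [primitive f] integrates from 0 only to the right, hence the condition on [f]. *)
Inductive smooth1 : (R -> R) -> Prop :=
| smooth1_flat Q : smooth1 (flat Q)
| smooth1_cst c : smooth1 (fun=> c)
| smooth1D f g : smooth1 f -> smooth1 g -> smooth1 (fun t => f t + g t)
| smooth1M f g : smooth1 f -> smooth1 g -> smooth1 (fun t => f t * g t)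
| smooth1_affine f a b : smooth1 f -> smooth1 (fun t => f (a * t + b))
| smooth1_primitive f : smooth1 f -> (forall t, t <= 0 -> f t = 0) -> smooth1 (primitive f).

Lemma smooth1_continuous f : (exists g : R -> R, forall t, is_derive t (1 : R) f (g t)) -> continuous f.
Proof.
move=> [g dg] t; apply: differentiable_continuous; apply/derivable1_diffP.
by have [] := dg t.
Qed.

(** Closure of the class under differentiation is the purpose of its inductive form: derivatives of
    all orders exist at once. *)
Lemma smooth1_derive f : smooth1 f ->
  exists2 g, smooth1 g & forall t, is_derive t (1 : R) f (g t).
Proof.
elim => {f} [Q|c|f g sf [f' sf' df] sg [g' sg' dg]|f g sf [f' sf' df] sg [g' sg' dg]|f a b sf [f' sf' df]|f sf [f' sf' df] f0].
- by exists (flat ('X^2 * (Q - Q^`()))); [exact: smooth1_flat|exact: is_derive_flat].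
- by exists (fun=> 0); [exact: smooth1_cst|move=> t; exact: is_derive_cst].
- by exists (fun t => f' t + g' t); [exact: smooth1D|move=> t; exact: is_deriveD].
- exists (fun t => f t * g' t + g t * f' t).
    by apply: smooth1D; exact: smooth1M.
  by move=> t; exact: (is_deriveM (df t) (dg t)).
- exists (fun t => f' (a * t + b) * a).
    by apply: smooth1M; [exact: smooth1_affine|exact: smooth1_cst].
  move=> t; have da : is_derive t (1 : R) (fun t => a * t + b) a.
    have := is_deriveD (is_deriveZ a (is_derive_id t (1:R))) (is_derive_cst b t 1).
    by rewrite /GRing.scale/= mulr1 addr0.
  exact: (is_derive1_comp (df _) da).
- exists f => // t; apply: is_derive_primitive => //.
  by apply: smooth1_continuous; exists f'.
Qed.

Lemma continuous_smooth1 f : smooth1 f -> continuous f.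
Proof. by move=> /smooth1_derive[g _ dg]; apply: smooth1_continuous; exists g. Qed.

Lemma smooth1_sum (I : Type) (r : seq I) (F : I -> R -> R) :
  (forall i, smooth1 (F i)) -> smooth1 (fun t => \sum_(i <- r) F i t).
Proof.
move=> sF; elim: r => [|i r IH].
  under eq_fun do rewrite big_nil; exact: smooth1_cst.
by under eq_fun do rewrite big_cons; exact: smooth1D.
Qed.

End smooth_functions.

(** * Uniform approximation by smooth functions of one variable *)

Section smooth_approximation.
Variable R : realType.
Local Notation leb := (@lebesgue_measure R).
Implicit Types (s t : R).

Lemma compact_unif_continuous (f : R -> R) (a b e : R) : continuous f -> 0 < e ->
  exists2 h, 0 < h & forall s t, a <= s <= b -> `|s - t| <= h -> `|f s - f t| <= e.
Proof.
move=> cf e0; have /compact_near_coveringP cov := @segment_compact R a b.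
pose P (h s : R) := forall t, `|s - t| <= h -> `|f s - f t| <= e.
have near_h : \forall h \near (0 : R)^'+, `[a, b]%classic `<=` P h.
  apply: cov => x _.
  have e2 : 0 < e / 2 by rewrite divr_gt0.
  have /cvgrPdist_lt/(_ _ e2)/nbhs_ballP[d /= d0 Hd] := cf x.
  have d2 : 0 < d / 2 by rewrite divr_gt0.
  exists (ball x (d / 2), [set h | h < d / 2]) => /=.
    by split; [exact: nbhsx_ballx|exact: nbhs_right_lt].
  move=> [s h]/= [xs hd] t st.
  have xs' : ball x d s by apply: le_ball xs; lra.
  have xt' : ball x d t.
    rewrite /ball/= -(subrKA s); apply: le_lt_trans (ler_normD _ _) _.
    by rewrite [d]splitr ltrD//; exact: le_lt_trans st hd.
  rewrite -(subrKA (f x)) (le_trans (ler_normD _ _))// [e]splitr lerD//.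
    by rewrite distrC ltW//; exact: Hd.
  by rewrite ltW//; exact: Hd.
have [h [h0 Hh]] := @filter_ex _ _ (at_right_proper_filter (0 : R)) _ (filterI (nbhs_right_gt (0 : R)) near_h).
by exists h => // s t sab; apply: Hh; rewrite /= in_itv.
Qed.

Definition bump t : R := flat 1 t * flat 1 (1 - t).

Lemma flat1_bounds t : 0 <= flat 1 t <= (1 : R).
Proof.
rewrite /flat; case: ifP => [t0|_]; last by rewrite lexx ler01.
by rewrite hornerC mul1r expR_ge0/= -expR0 ler_expR oppr_le0 invr_ge0 ltW.
Qed.

Lemma bump_bounds t : 0 <= bump t <= 1.
Proof.
have /andP[a b] := flat1_bounds t; have /andP[c d] := flat1_bounds (1 - t).
by rewrite /bump mulr_ge0//= -[leRHS]mulr1 ler_pM.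
Qed.

Lemma bump_le0 t : t <= 0 -> bump t = 0.
Proof. by move=> t0; rewrite /bump flat_le0// mul0r. Qed.

Lemma bump_ge1 t : 1 <= t -> bump t = 0.
Proof. by move=> t1; rewrite /bump (@flat_le0 _ _ (1 - t)) ?mulr0// subr_le0. Qed.

Lemma smooth1_bump : smooth1 bump.
Proof.
apply: smooth1M; first exact: smooth1_flat.
have := smooth1_affine (-1) 1 (smooth1_flat (1 : {poly R})).
by congr smooth1; apply/funext => t; rewrite mulN1r addrC.
Qed.

Let cbump := continuous_smooth1 smooth1_bump.

Lemma primitive_bump_nondecreasing s t : s <= t -> primitive bump s <= primitive bump t.
Proof.
move=> st; have [s0|/ltW s0] := leP 0 s; last first.
  rewrite (primitive_le0 _ s0); apply: Rintegral_ge0 => x _.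
  by have /andP[] := bump_bounds x.
rewrite -subr_ge0 primitive_sub//; apply: Rintegral_ge0 => x _.
by have /andP[] := bump_bounds x.
Qed.

Lemma primitive_bump_ge1 t : 1 <= t -> primitive bump t = primitive bump 1.
Proof.
move=> t1; apply/eqP; rewrite -subr_eq0 primitive_sub// /Rintegral integral0_eq// => x /=.
by rewrite in_itv/= => /andP[/ltW x1 _]; rewrite bump_ge1.
Qed.

Lemma primitive_bump_gt0 : 0 < primitive bump 1.
Proof.
pose m := flat 1 (4^-1) * flat 1 (4^-1) : R.
have m0 : 0 < m.
  have q : 0 < (4^-1 : R) by rewrite invr_gt0.
  by rewrite /m /flat q hornerC mul1r mulr_gt0// expR_gt0.
have flat_mono t : 4^-1 <= t -> flat 1 (4^-1) <= flat 1 t :> R.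
  move=> t4; have q : 0 < (4^-1 : R) by rewrite invr_gt0.
  have t0 := lt_le_trans q t4.
  by rewrite /flat q t0 !hornerC !mul1r ler_expR lerN2 lef_pV2.
have H x : 4^-1 <= x <= 3 / 4 -> m <= bump x <= 1.
  move=> /andP[x1 x2]; have /andP[_ ->] := bump_bounds x; rewrite andbT.
  have /andP[f0 _] := flat1_bounds 4^-1.
  by apply: ler_pM => //; apply: flat_mono => //; lra.
have h1 : (4^-1 : R) <= 3 / 4 by lra.
have h0 : 0 <= (4^-1 : R) by lra.
have /andP[h _] := primitive_between cbump h0 h1 H.
have h2 : primitive bump (3 / 4) <= primitive bump 1 by apply: primitive_bump_nondecreasing; lra.
have h3 : 0 <= primitive bump (4^-1).
  by rewrite -(primitive_le0 bump (lexx 0)); apply: primitive_bump_nondecreasing.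
have h4 : 0 < m * (3 / 4 - 4^-1) by rewrite mulr_gt0//; lra.
by apply: lt_le_trans h2; apply: lt_le_trans h4 _; apply: le_trans h _; rewrite gerBl.
Qed.

Definition step t : R := primitive bump t / primitive bump 1.

Lemma step_le0 t : t <= 0 -> step t = 0.
Proof. by move=> t0; rewrite /step primitive_le0// mul0r. Qed.

Lemma step_ge1 t : 1 <= t -> step t = 1.
Proof. by move=> t1; rewrite /step primitive_bump_ge1// divff// gt_eqF// primitive_bump_gt0. Qed.

Lemma step_nondecreasing s t : s <= t -> step s <= step t.
Proof.
by move=> st; rewrite ler_wpM2r ?primitive_bump_nondecreasing// invr_ge0 ltW// primitive_bump_gt0.
Qed.

Lemma smooth1_step : smooth1 step.
Proof.
apply: smooth1M; last exact: smooth1_cst.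
by apply: smooth1_primitive; [exact: smooth1_bump|exact: bump_le0].
Qed.

(** A difference of consecutive smooth steps: its integer translates telescope to a partition of
    unity. *)
Definition hat t : R := step (t + 1) - step t.

Lemma smooth1_hat : smooth1 hat.
Proof.
have h1 := smooth1_affine 1 1 smooth1_step.
have h2 := smooth1M (smooth1_cst (-1)) smooth1_step.
have := smooth1D h1 h2.
by congr smooth1; apply/funext => t; rewrite /hat mul1r mulN1r.
Qed.

Lemma hat_ge0 t : 0 <= hat t.
Proof. by rewrite subr_ge0 step_nondecreasing// lerDl. Qed.

Lemma hat_support t : 1 <= `|t| -> hat t = 0.
Proof.
rewrite /hat ler_normr => /orP[t1|t1].
  by rewrite !step_ge1 ?subrr// (le_trans t1)// lerDl.
by rewrite !step_le0 ?subrr//; lra.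
Qed.

Lemma hat_telescope n t : \sum_(j < n) hat (t - j%:R) = step (t + 1) - step (t + 1 - n%:R).
Proof.
elim: n => [|n IH]; first by rewrite big_ord0 subr0 subrr.
rewrite big_ord_recr/= IH /hat -[n.+1%:R]natr1.
have -> : t - n%:R + 1 = t + 1 - n%:R by ring.
have -> : t - n%:R = t + 1 - (n%:R + 1) by ring.
by rewrite addrA subrK.
Qed.

Lemma hat_partition n t : 0 <= t -> t + 1 <= n%:R -> \sum_(j < n) hat (t - j%:R) = 1.
Proof.
move=> t0 tn; rewrite hat_telescope step_ge1 ?lerDr// step_le0 ?subr0//.
by rewrite subr_le0.
Qed.

Section approximation.
Variables (f : R -> R) (al A e : R).
Hypothesis cf : continuous f.
Hypothesis al0 : 0 < al.
Hypothesis f_le : forall s, s <= al -> f s = 0.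
Hypothesis f_ge : forall s, A <= s -> f s = 0.
Hypothesis e0 : 0 < e.

(** The values of [f] at the nodes [j h] are blended by the partition of unity. At [s] only nodes
    closer than [h] contribute, and there [f] differs from [f s] by at most [e]. *)
Lemma smooth1_approximation : exists g, [/\ smooth1 g, (forall s, s <= 0 -> g s = 0),
  (forall s, A + 1 <= s -> g s = 0) & forall s, `|g s - f s| <= e].
Proof.
have [h1 h1_gt0 H1] := compact_unif_continuous 0 (A + 1) cf e0.
(* The bound [h <= al] keeps the approximation zero on []-oo, 0]], and [h <= 1] keeps it zero beyond
   [A + 1]. *)
pose h := Num.min h1 (Num.min al 1).
have h0 : 0 < h by rewrite !lt_min h1_gt0 al0 ltr01.
have hh1 : h <= h1 by rewrite ge_min lexx.
have hal : h <= al by rewrite !ge_min lexx orbT.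
have h_1 : h <= 1 by rewrite !ge_min lexx !orbT.
pose n := (Num.truncn ((A + 1) / h + 1)).+1.
have nh : (A + 1) / h + 1 <= n%:R by exact/ltW/truncnS_gt.
pose g s := \sum_(j < n) f (j%:R * h) * hat (s / h - j%:R).
have far s (j : 'I_n) : h <= `|s - j%:R * h| -> hat (s / h - j%:R) = 0.
  move=> sj; apply: hat_support.
  have -> : s / h - j%:R = (s - j%:R * h) / h by rewrite mulrBl mulfK// gt_eqF.
  by rewrite normrM normfV (gtr0_norm h0) ler_pdivlMr// mul1r.
have g_le s : s <= 0 -> g s = 0.
  move=> s0; rewrite /g big1// => j _.
  have [jal|jal] := leP (j%:R * h) al; first by rewrite f_le// mul0r.
  rewrite far ?mulr0// ler_normr; apply/orP; right; lra.
have g_ge s : A + 1 <= s -> g s = 0.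
  move=> s0; rewrite /g big1// => j _.
  have [jA|jA] := leP A (j%:R * h); first by rewrite f_ge// mul0r.
  rewrite far ?mulr0// ler_normr; apply/orP; left; lra.
exists g; split => //.
- apply: smooth1_sum => j; apply: smooth1M; first exact: smooth1_cst.
  have := smooth1_affine h^-1 (- j%:R) smooth1_hat.
  by congr smooth1; apply/funext => s; rewrite mulrC.
- move=> s; have [s0|s0] := leP s 0.
    by rewrite g_le// f_le ?subrr ?normr0 ?(ltW e0)// (le_trans s0)// ltW.
  have [sA|sA] := leP (A + 1) s.
    by rewrite g_ge// f_ge ?subrr ?normr0 ?(ltW e0)// (le_trans _ sA)// lerDl.
  have part : \sum_(j < n) hat (s / h - j%:R) = 1.
    apply: hat_partition; first by rewrite divr_ge0// ltW.
    by apply: le_trans nh; rewrite lerD2r ler_pM2r ?invr_gt0// ltW.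
  have -> : g s - f s = \sum_(j < n) (f (j%:R * h) - f s) * hat (s / h - j%:R).
    by under eq_bigr do rewrite mulrBl; rewrite sumrB -mulr_sumr part mulr1.
  apply: le_trans (ler_norm_sum _ _ _) _.
  have -> : e = \sum_(j < n) e * hat (s / h - j%:R) by rewrite -mulr_sumr part mulr1.
  apply: ler_sum => j _; rewrite normrM (ger0_norm (hat_ge0 _)).
  have [sj|sj] := leP h `|s - j%:R * h|; first by rewrite far// !mulr0.
  apply: ler_wpM2r; first exact: hat_ge0.
  rewrite distrC; apply: H1; first by rewrite !ltW.
  by apply: le_trans (ltW sj) _.
Qed.

End approximation.
End smooth_approximation.

(** * Smooth radial functions on R^N *)

Section smoothN.
Variables (R : realType) (N : nat).
Implicit Types (f g : 'rV[R]_N -> R) (x v : 'rV[R]_N).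

Lemma is_derive_coord x v i : is_derive x v (fun x : 'rV[R]_N => x ord0 i) (v ord0 i).
Proof.
have H : h^-1 *: (((fun x : 'rV[R]_N => x ord0 i) \o shift x) (h *: v) - x ord0 i) @[h --> 0^'] --> v ord0 i.
  apply: cvg_near_cst; near=> h.
  have h0 : h != 0 by near: h; exact: nbhs_dnbhs_neq.
  by rewrite /= !mxE addrK /GRing.scale/= mulKf.
by apply: DeriveDef; [apply/cvg_ex; exists (v ord0 i)|exact: (cvg_lim _ H)].
Unshelve. all: by end_near.
Qed.

Lemma dotv_sumE : (fun x => dotv x x) = \sum_(i < N) (fun x : 'rV[R]_N => x ord0 i * x ord0 i).
Proof. by apply/funext => x; rewrite fct_sumE. Qed.

Lemma differentiable_dotvv x : differentiable (fun x => dotv x x) x.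
Proof.
rewrite dotv_sumE; apply: differentiable_sum => i.
by apply: differentiableM; exact: differentiable_coord.
Qed.

Lemma is_derive_dotvv x v : is_derive x v (fun x => dotv x x) (2 * dotv v x).
Proof.
rewrite dotv_sumE (_ : 2 * dotv v x = \sum_(i < N) (x ord0 i *: v ord0 i + x ord0 i *: v ord0 i)).
  apply: is_derive_sum => i; exact: (is_deriveM (is_derive_coord x v i) (is_derive_coord x v i)).
by rewrite /dotv mulr_sumr; apply: eq_bigr => i _; rewrite /GRing.scale/=; ring.
Qed.

Lemma differentiable_radial (P P' : R -> R) x : (forall t, is_derive t (1 : R) P (P' t)) ->
  differentiable (fun x => P (dotv x x)) x.
Proof.
move=> dP; apply: (@differentiable_comp _ _ _ _ (fun x => dotv x x) P); first exact: differentiable_dotvv.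
by apply/derivable1_diffP; have [] := dP (dotv x x).
Qed.

Lemma partial_radial (P P' : R -> R) i x : (forall t, is_derive t (1 : R) P (P' t)) ->
  partial i (fun x => P (dotv x x)) x = 2 * P' (dotv x x) * x ord0 i.
Proof.
move=> dP; have dfP : differentiable P (dotv x x).
  by apply/derivable1_diffP; have [] := dP (dotv x x).
have dq := differentiable_dotvv x.
rewrite /partial deriveE; last exact: differentiable_radial dP.
rewrite (_ : (fun x => P (dotv x x)) = P \o (fun x => dotv x x))// diff_comp//=.
have [_ E1] := is_derive_dotvv x (delta_mx ord0 i); have [_ E2] := dP (dotv x x).
rewrite -[X in 'd P _ X]deriveE// E1.
have -> : 2 * dotv (delta_mx ord0 i) x = (2 * x ord0 i) *: (1 : R).
  rewrite /GRing.scale/= mulr1; congr (_ * _).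
  rewrite /dotv (bigD1 i)//= big1 ?addr0 ?mxE ?eqxx ?mul1r// => j ji.
  by rewrite mxE (negbTE ji) andbF mul0r.
rewrite linearZ/= -deriveE// E2 /GRing.scale/=; ring.
Qed.

(** Radial functions are written through the square of the Euclidean norm, which unlike the norm is
    smooth at the origin. Coordinates are included because they appear in the partial
    derivatives. *)
Inductive smoothN : ('rV[R]_N -> R) -> Prop :=
| smoothN_radial P : smooth1 P -> smoothN (fun x => P (dotv x x))
| smoothN_coord i : smoothN (fun x => x ord0 i)
| smoothND f g : smoothN f -> smoothN g -> smoothN (fun x => f x + g x)
| smoothNM f g : smoothN f -> smoothN g -> smoothN (fun x => f x * g x).

Lemma smoothN_derive f : smoothN f -> (forall x, differentiable f x) /\ forall i, smoothN (partial i f).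
Proof.
elim => {f} [P|i|f g _ [df pf] _ [dg pg]|f g sf [df pf] sg [dg pg]].
- move=> /smooth1_derive[P' sP' dP]; split => [x|i]; first exact: differentiable_radial dP.
  rewrite (_ : partial _ _ = (fun x => (fun=> 2) (dotv x x) * P' (dotv x x) * x ord0 i)).
    apply: smoothNM; last exact: smoothN_coord.
    exact: (smoothNM (smoothN_radial (smooth1_cst 2)) (smoothN_radial sP')).
  by apply/funext => x; rewrite (partial_radial _ _ dP).
- split => [x|j]; first exact: differentiable_coord.
  rewrite (_ : partial _ _ = (fun x => (fun=> (delta_mx ord0 j : 'rV[R]_N) ord0 i) (dotv x x))).
    exact: (smoothN_radial (smooth1_cst _)).
  by apply/funext => x; have [_ E] := is_derive_coord x (delta_mx ord0 j) i; rewrite /partial E.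
- split => [x|j]; first exact: differentiableD.
  rewrite (_ : partial _ _ = (fun x => partial j f x + partial j g x)); first exact: smoothND.
  by apply/funext => x; rewrite /partial deriveD//; exact: diff_derivable.
- split => [x|j]; first exact: differentiableM.
  rewrite (_ : partial _ _ = (fun x => f x * partial j g x + g x * partial j f x)).
    by apply: smoothND; exact: smoothNM.
  by apply/funext => x; rewrite /partial deriveM//; exact: diff_derivable.
Qed.

Lemma smoothN_smooth f : smoothN f -> smooth f.
Proof.
move=> sf s; suff : smoothN (foldr (@partial R N) f s) by move=> /smoothN_derive[].
by elim: s => //= i s /smoothN_derive[_]; exact.
Qed.

Lemma norm_le_enorm x : `|x| <= enorm x.
Proof.
rewrite [leLHS]mx_normrE; apply: bigmax_le => [|[i j] _]; first exact: enorm_ge0.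
by rewrite (ord1 i); exact: le_coord_enorm.
Qed.

Lemma radial_test_function (P : R -> R) (S : R) : smooth1 P -> (forall s, S <= s -> P s = 0) ->
  test_function (fun x : 'rV[R]_N => P (dotv x x)).
Proof.
move=> sP PS; split; first by apply: smoothN_smooth; exact: smoothN_radial.
pose K : set 'rV[R]_N := [set x | dotv x x <= S].
have cq : continuous (fun x : 'rV[R]_N => dotv x x).
  by move=> x; apply: differentiable_continuous; exact: differentiable_dotvv.
have clK : closed K.
  apply: (@closed_comp _ _ (fun x : 'rV[R]_N => dotv x x) [set y | y <= S]); last exact: closed_le.
  by move=> x _; exact: cq.
have cK : compact K.
  apply: bounded_closed_compact => //.
  exists (Num.sqrt S); split; first exact: num_real.
  move=> M SM x xK; apply: le_trans (norm_le_enorm x) _; apply: le_trans (ltW SM).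
  by rewrite /enorm ler_wsqrtr.
apply: (subclosed_compact (@closed_closure _ _) cK).
rewrite closureE => x; apply; split => // y /= /eqP Py.
by rewrite /K /= leNgt; apply/negP => /ltW /PS.
Qed.

End smoothN.

Lemma dominated_to0 d (T : measurableType d) (R : realType) (mu : {measure set T -> \bar R})
  (f_ : nat -> T -> R) (g : T -> R) :
  (forall n, measurable_fun setT (f_ n)) -> mu.-integrable setT (EFin \o g) ->
  (forall n x, 0 <= f_ n x <= g x) -> {ae mu, forall x, f_ n x @[n --> \oo] --> (0 : R)} ->
  \int[mu]_x f_ n x @[n --> \oo] --> (0 : R).
Proof.
move=> mf ig fg f0.
have fi n : mu.-integrable setT (EFin \o f_ n) by apply: ge0_le_L1 (fg n) (mf n) ig.
have m1 n : measurable_fun [set: T] (fun x => (f_ n x)%:E) by exact/measurable_EFinP.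
have m2 : measurable_fun [set: T] (fun x : T => (0%R : R)%:E) by exact: measurable_cst.
have ae1 : {ae mu, forall x : T, [set: T] x -> (fun n => (f_ n x)%:E) @ \oo --> (0%R : R)%:E}.
  move: f0; apply: filterS => x Hx _.
  by apply/fine_cvgP; split; [exact: nearW|exact: Hx].
have ae2 : {ae mu, forall x n, [set: T] x -> (`|(f_ n x)%:E| <= (EFin \o g) x)%E}.
  by apply: aeW => x n _ /=; have /andP[? ?] := fg n x; rewrite lee_fin ger0_norm.
have [_ _] := @dominated_convergence _ _ R mu setT measurableT
  (fun n x => (f_ n x)%:E) (fun x => (0%R : R)%:E) (EFin \o g) m1 m2 ae1 ig ae2.
rewrite integral0 => H.
have : (fun n => (\int[mu]_x f_ n x)%:E) @ \oo --> (0%R : R)%:E.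
  apply: cvg_trans H; apply: near_eq_cvg; apply: nearW => n /=.
  by rewrite L1_EFin.
by move/fine_cvgP => [].
Qed.

(** * Cutting the slope off near the origin and near infinity *)

Section cutoff.
Variables (R : realType) (N : nat).
Hypothesis N2 : (2 <= N)%N.
Let N0 : (0 < N)%N. Proof. exact: ltnW. Qed.
Local Notation nu := (@radm R N).
Local Notation leb := (@lebesgue_measure R).
Local Notation L1 f := (nu.-integrable setT (EFin \o f)).
Local Notation profile := (@profile R N).

Lemma radm_ae_neq0 : {ae nu, forall r : R, r != 0}.
Proof.
have m0 : measurable_fun [set: R] (fun r => (\1_([set 0%R] : set R) r : R)%:E).
  by apply/measurable_EFinP; apply: measurable_indic; exact: measurable_set1.
have E : (\int[nu]_r (\1_([set 0%R] : set R) r : R)%:E = 0)%E.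
  rewrite (ge0_integral_polar N0 m0)//.
  apply: integral0_eq => r _; rewrite indicE; have [->|r0] := eqVneq r 0.
    by rewrite /polar_density ltxx; move: N2; case: (N) => [//|[//|n]] _; rewrite expr0n mulr0 mule0.
  by rewrite memNset ?mul0e//; exact/eqP.
have := (ae_eq_integral_abs nu measurableT m0).1.
have -> : (\int[nu]_r `|(\1_([set 0%R] : set R) r : R)%:E| = 0)%E.
  by rewrite -[RHS]E; apply: eq_integral => x _; rewrite gee0_abs.
move=> /(_ erefl) H; apply: (ae_imply H) => x /(_ I) /= [] /eqP.
rewrite indicE pnatr_eq0 eqb0; apply: contra => /eqP ->.
exact/mem_set.
Qed.

Variable W : R -> R.
Hypothesis pW : profile W.
Hypothesis cW : forall r, 0 < r -> {for r, continuous W}.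
Let U := tail W.

(** Equal to 1 on [[2 / (n+1), n+1]] when [n >= 1], and to 0 outside [[1 / (n+1), n+2]]. Cutting the
    slope instead of the function preserves density profiles, and the cut at the origin removes a
    possible discontinuity of [W] there. *)
Let cut n (r : R) : R := clamp 1 (n.+1%:R * r - 1) * clamp 1 (n.+2%:R - r).
Let V n (r : R) : R := W r * cut n r.

Let clamp01 (t : R) : 0 <= clamp 1 t <= 1. Proof. exact: clamp_itv. Qed.

Let cut01 n r : 0 <= cut n r <= 1.
Proof.
have /andP[a b] := clamp01 (n.+1%:R * r - 1); have /andP[c d] := clamp01 (n.+2%:R - r).
by rewrite mulr_ge0//= -[leRHS]mulr1 ler_pM.
Qed.

Let clamp_le0 (t : R) : t <= 0 -> clamp 1 t = 0.
Proof. by move=> t0; rewrite /clamp (max_idPr t0) (min_idPl ler01). Qed.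

Let clamp_ge1 (t : R) : 1 <= t -> clamp 1 t = 1.
Proof. by move=> t1; rewrite /clamp (max_idPl (le_trans ler01 t1)) (min_idPr t1). Qed.

Let dW : density_profile W. Proof. by case: pW. Qed.

Let V_low n r : r <= n.+1%:R^-1 -> V n r = 0.
Proof.
move=> rn; rewrite /V /cut clamp_le0 ?mul0r ?mulr0// subr_le0 mulrC -ler_pdivlMr ?div1r//.
Qed.

Let V_high n r : n.+2%:R <= r -> V n r = 0.
Proof. by move=> rn; rewrite /V /cut (@clamp_le0 (n.+2%:R - r)) ?mulr0// subr_le0. Qed.

Let V_itv n r : 0 <= V n r <= W r.
Proof.
have [_ W01 _ _] := dW; have /andP[w0 _] := W01 r; have /andP[c0 c1] := cut01 n r.
by rewrite mulr_ge0//= -[leRHS]mulr1 ler_wpM2l.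
Qed.

Let ccut n : continuous (cut n).
Proof.
move=> x; apply: cvgM.
  apply: (@continuous_comp _ _ _ (fun r : R => n.+1%:R * r - 1) (clamp 1)); last exact: continuous_clamp.
  by apply: cvgB; [apply: cvgM; [exact: cvg_cst|exact: cvg_id]|exact: cvg_cst].
apply: (@continuous_comp _ _ _ (fun r : R => n.+2%:R - r) (clamp 1)); last exact: continuous_clamp.
by apply: cvgB; [exact: cvg_cst|exact: cvg_id].
Qed.

Let cV n : continuous (V n).
Proof.
move=> r; have [r0|r0] := ltP 0 r; first by apply: cvgM; [exact: cW|exact: ccut].
have H : {near r, cst 0 =1 V n}.
  have : \forall x \near r, x < n.+1%:R^-1.
    by apply: lt_nbhsl; rewrite (le_lt_trans r0)// invr_gt0.
  by apply: filterS => x /ltW xn; rewrite V_low.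
have V0 : V n r = 0 by rewrite V_low// (le_trans r0)// invr_ge0.
rewrite /continuous_at V0; apply: cvg_trans (near_eq_cvg H) _; exact: cvg_cst.
Qed.

Let dV n : density_profile (V n).
Proof.
have [mW W01 Wn iW] := dW; split.
- exact: continuous_measurable_fun.
- by move=> t; have /andP[-> /le_trans ->] := V_itv n t; have /andP[] := W01 t.
- by move=> t t0; rewrite /V Wn// mul0r.
- exact: (@ge0_le_L1 _ _ R leb _ _ (V_itv n) (continuous_measurable_fun (@cV n)) iW).
Qed.

Let V_cvg r : r != 0 -> V n r @[n --> \oo] --> W r.
Proof.
move=> r0; have [_ _ Wn _] := dW.
apply: cvg_near_cst; have [rp|rn|e] := ltgtP 0 r; last by rewrite -e eqxx in r0.
- near=> n.
  have n1 : 2 / r <= n%:R by near: n; exact: nbhs_infty_ger.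
  have n2 : r <= n%:R by near: n; exact: nbhs_infty_ger.
  rewrite /V /cut !clamp_ge1 ?mulr1//.
    by rewrite lerBrDr -[n.+2%:R]natr1 -natr1; lra.
  rewrite ler_pdivrMr// in n1; rewrite -natr1 mulrDl mul1r; lra.
- by apply: nearW => n; rewrite /V Wn// mul0r.
Unshelve. all: by end_near.
Qed.

(** Three dominated convergences: the slopes in L^2 of [nu], the slopes in L^1 of the line, which
    makes the tails converge at every radius, and from this the tails in L^2 of [nu]. *)
Lemma cutoff_approximation c : 0 < c -> exists V1 al A, [/\ density_profile V1, continuous V1,
  0 < al < A, (forall r, r <= al \/ A <= r -> V1 r = 0) &
  [/\ L1 (fun r => (W r - V1 r) ^+ 2), \int[nu]_r ((W r - V1 r) ^+ 2) <= c,
    L1 (fun r => (tail W r - tail V1 r) ^+ 2) & \int[nu]_r ((tail W r - tail V1 r) ^+ 2) <= c]].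
Proof.
move=> c0; have [mW W01 Wn iW] := dW; have [_ W2 U2] := pW.
have diff0 n r : 0 <= W r - V n r <= W r.
  by have /andP[a b] := V_itv n r; rewrite subr_ge0 b gerBl a.
have sq0 n r : 0 <= (W r - V n r) ^+ 2 <= W r ^+ 2.
  have /andP[a b] := diff0 n r; rewrite sqr_ge0/=; apply: lerXn2r; rewrite ?nnegrE//.
  exact: le_trans b.
have mV n : measurable_fun [set: R] (V n) by exact: continuous_measurable_fun.
have mWV n : measurable_fun [set: R] (fun r => W r - V n r) by exact: measurable_funB.
have mWV2 n : measurable_fun [set: R] (fun r => (W r - V n r) ^+ 2) by exact: measurable_funX.
have I1 : \int[nu]_r ((W r - V n r) ^+ 2) @[n --> \oo] --> (0 : R).
  apply: (@dominated_to0 _ _ R nu (fun n r => (W r - V n r) ^+ 2) _ mWV2 W2 sq0); apply: (ae_imply radm_ae_neq0) => r r0.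
  have H : W r - V n r @[n --> \oo] --> (0 : R).
    by rewrite -(subrr (W r)); apply: cvgB; [exact: cvg_cst|exact: V_cvg].
  by rewrite -(mulr0 (0 : R)); exact: (cvgM H H).
have I2 : \int[leb]_r (W r - V n r) @[n --> \oo] --> (0 : R).
  apply: (@dominated_to0 _ _ R leb (fun n r => W r - V n r) _ mWV iW diff0).
  have nz : {ae leb, forall t : R, t != 0}.
    exists [set 0]; split => //; first exact: lebesgue_measure_set1.
    by move=> t /= /negP/negPn/eqP.
  apply: (ae_imply nz) => r r0.
  by rewrite -(subrr (W r)); apply: cvgB; [exact: cvg_cst|exact: V_cvg].
have iV n : leb.-integrable setT (EFin \o V n) by have [] := dV n.
have iWV n : leb.-integrable setT (EFin \o (fun r => W r - V n r)) by exact: L1B.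
have tailE n r : tail W r - tail (V n) r = \int[leb]_(t in `[r, +oo[) (W t - V n t).
  by rewrite RintegralB//; [apply: integrableS iW|apply: integrableS (iV n)].
have tail_diff n r : 0 <= tail W r - tail (V n) r <= tail W r.
  rewrite gerBl (profile_tail_ge0 r (dV n)) andbT tailE; apply: Rintegral_ge0 => t _.
  by have /andP[] := diff0 n t.
have tail_small n r : tail W r - tail (V n) r <= \int[leb]_t (W t - V n t).
  rewrite tailE -lee_fin /Rintegral !fineK; last 2 first.
  - by apply: integrable_fin_num => //; exact: iWV.
  - by apply: integrable_fin_num => //; apply: integrableS (iWV n).
  apply: ge0_subset_integral => //; first by apply/measurable_EFinP; exact: mWV.
  by move=> t _; rewrite lee_fin; have /andP[] := diff0 n t.
have mT n : measurable_fun [set: R] (fun r => (tail W r - tail (V n) r) ^+ 2).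
  by apply: measurable_funX; apply: measurable_funB; [exact: measurable_tail dW|exact: measurable_tail (dV n)].
have tsq n r : 0 <= (tail W r - tail (V n) r) ^+ 2 <= tail W r ^+ 2.
  have /andP[a b] := tail_diff n r; rewrite sqr_ge0/=; apply: lerXn2r; rewrite ?nnegrE//.
  exact: le_trans b.
have I3 : \int[nu]_r ((tail W r - tail (V n) r) ^+ 2) @[n --> \oo] --> (0 : R).
  apply: (@dominated_to0 _ _ R nu (fun n r => (tail W r - tail (V n) r) ^+ 2) _ mT U2 tsq); apply: aeW => r.
  have H : tail W r - tail (V n) r @[n --> \oo] --> (0 : R).
    apply: (squeeze_cvgr _ (cvg_cst 0) I2); apply: nearW => n.
    by have /andP[-> _] := tail_diff n r; exact: tail_small.
  by rewrite -(mulr0 (0 : R)); exact: (cvgM H H).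
have n1 : \forall n \near \oo, \int[nu]_r ((W r - V n r) ^+ 2) <= c.
  by have /cvgrPdist_lt/(_ _ c0) := I1; apply: filterS => n; rewrite sub0r normrN => /(le_lt_trans (ler_norm _))/ltW.
have n2 : \forall n \near \oo, \int[nu]_r ((tail W r - tail (V n) r) ^+ 2) <= c.
  by have /cvgrPdist_lt/(_ _ c0) := I3; apply: filterS => n; rewrite sub0r normrN => /(le_lt_trans (ler_norm _))/ltW.
have [n [H1 H2]] := filter_ex (filterI n1 n2).
exists (V n), n.+1%:R^-1, n.+2%:R; split.
- exact: dV.
- exact: cV.
- rewrite invr_gt0 ltr0Sn/=; apply: (@le_lt_trans _ _ 1); last by rewrite ltr1n.
  by rewrite invf_le1 ?ltr0n// ler1n.
- by move=> r [rn|rn]; [exact: V_low|exact: V_high].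
- split; [|exact: H1| |exact: H2].
    exact: (@ge0_le_L1 _ _ R nu _ _ (sq0 n) (mWV2 n) W2).
  exact: (@ge0_le_L1 _ _ R nu _ _ (tsq n) (mT n) U2).
Qed.

End cutoff.

Section radial_smoothing.
Variables (R : realType) (N : nat).
Local Notation leb := (@lebesgue_measure R).
Variables (V : R -> R) (al A e : R).
Hypothesis cV : continuous V.
Hypothesis al0 : 0 < al.
Hypothesis alA : al < A.
Hypothesis V_supp : forall r, r <= al \/ A <= r -> V r = 0.
Hypothesis e0 : 0 < e.

Let A0 : 0 < A. Proof. exact: lt_trans alA. Qed.
Let B := A + 1.
(** A profile [P(r^2)] has slope [- 2 P'(r^2) r], so [- P'] must approximate
    [V(sqrt s) / (2 sqrt s)]. The maximum with [al] keeps the denominator positive and changes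
    nothing, because [V] vanishes up to [al]. *)
Let f (s : R) : R := V (Num.sqrt s) / (2 * Num.max (Num.sqrt s) al).

Let max_gt0 (s : R) : 0 < Num.max (Num.sqrt s) al.
Proof. by rewrite lt_max al0 orbT. Qed.

Let cf : continuous f.
Proof.
move=> s; apply: cvgM.
  exact: (cvg_comp _ _ (@sqrt_continuous R s) (@cV (Num.sqrt s))).
apply: cvgV; first by rewrite mulf_neq0// gt_eqF.
apply: cvgM; first exact: cvg_cst.
apply: (@continuous_max _ R (fun s : R => Num.sqrt s) (cst al)); last exact: cst_continuous.
exact: sqrt_continuous.
Qed.

Let f_le s : s <= al ^+ 2 -> f s = 0.
Proof.
move=> sl; rewrite /f V_supp ?mul0r//; left.
by rewrite -[leRHS]ger0_norm ?(ltW al0)// -sqrtr_sqr ler_wsqrtr.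
Qed.

Let f_ge s : A ^+ 2 <= s -> f s = 0.
Proof.
move=> sl; rewrite /f V_supp ?mul0r//; right.
by rewrite -[leLHS]ger0_norm ?(ltW A0)// -sqrtr_sqr ler_wsqrtr.
Qed.

Let f_sqr r : 0 <= r -> 2 * f (r ^+ 2) * r = V r.
Proof.
move=> r0; rewrite /f sqrtr_sqr ger0_norm//.
have [ral|/ltW ral] := leP r al; first by rewrite V_supp ?mul0r ?mulr0 ?mul0r//; left.
by field; rewrite gt_eqF// (lt_le_trans al0).
Qed.

Lemma radial_smoothing : exists P P' : R -> R, [/\ smooth1 P,
  (forall t, is_derive t (1 : R) P (P' t)), (forall s, B ^+ 2 <= s -> P s = 0),
  (forall r, 0 <= r -> `|V r + 2 * P' (r ^+ 2) * r| <= if r < B then e else 0) &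
  (forall r, 0 <= r -> `|P (r ^+ 2) - tail V r| <= if r < B then e * B else 0)].
Proof.
have B0 : 0 < B by rewrite addr_gt0.
(* [smooth1_approximation] enlarges the support from [A^2] to [A^2 + 1], which is still within
   [B^2]. *)
have B2 : A ^+ 2 + 1 <= B ^+ 2.
  by rewrite /B sqrrD1 lerD2r lerDl mulrn_wge0// ltW.
(* In the slope the error of [p] is multiplied by [2 r], at most [2 B]. *)
have eB : 0 < e / (2 * B) by rewrite divr_gt0// mulr_gt0.
have al2 : 0 < al ^+ 2 by rewrite exprn_gt0.
have [p [sp p_le p_ge pf]] := smooth1_approximation cf al2 f_le f_ge eB.
have cp := continuous_smooth1 sp.
pose P s := primitive p (B ^+ 2) - primitive p s.
have dP t : is_derive t (1 : R) P (- p t).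
  have := is_deriveB (is_derive_cst (primitive p (B ^+ 2)) t (1 : R)) (is_derive_primitive t cp p_le).
  by rewrite sub0r.
have P0 s : B ^+ 2 <= s -> P s = 0.
  move=> Bs; apply/eqP; rewrite subr_eq0 eq_sym -subr_eq0 primitive_sub ?sqr_ge0//.
  rewrite /Rintegral integral0_eq// => x /=; rewrite in_itv/= => /andP[/ltW Bx _].
  by rewrite p_ge// (le_trans B2).
have key r : 0 <= r -> `|V r + 2 * - p (r ^+ 2) * r| <= if r < B then e else 0.
  move=> r0; rewrite -f_sqr// mulrN mulNr -mulrBl -mulrBr.
  case: ltP => rB; last first.
    have r2 : B ^+ 2 <= r ^+ 2 by rewrite lerXn2r// ?nnegrE// ltW.
    rewrite p_ge ?(le_trans B2)// f_ge ?subrr ?mulr0 ?mul0r ?normr0//.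
    by apply: le_trans r2; apply: le_trans B2; rewrite lerDl.
  rewrite !normrM (ger0_norm r0) [`|2|]ger0_norm// distrC.
  have -> : e = 2 * (e / (2 * B)) * B by field; rewrite gt_eqF.
  by apply: ler_pM => //; rewrite ?mulr_ge0 ?ler_wpM2l// ltW.
exists P, (fun t => - p t); split => //.
  have := smooth1D (smooth1_cst (primitive p (B ^+ 2))) (smooth1M (smooth1_cst (-1)) (smooth1_primitive sp p_le)).
  by congr smooth1; apply/funext => t; rewrite mulN1r.
move=> r r0; case: ltP => rB; last first.
  rewrite P0 ?lerXn2r// ?nnegrE//; last exact: ltW.
  rewrite sub0r normrN /tail /Rintegral integral0_eq ?normr0// => t /=.
  rewrite in_itv/= andbT => rt; rewrite V_supp//; right.
  by apply: le_trans (le_trans rB rt); rewrite lerDl.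
have cm : continuous (fun t : R => 2 * p (t ^+ 2) * t).
  move=> t; apply: cvgM; last exact: cvg_id.
  apply: cvgM; first exact: cvg_cst.
  exact: (cvg_comp _ _ (@exprn_continuous R 2 t) (@cp (t ^+ 2))).
have EP : P (r ^+ 2) = \int[leb]_(t in `[r, B]) (2 * p (t ^+ 2) * t).
  have dF (t : R) : is_derive t (1 : R) (fun t => - P (t ^+ 2)) (2 * p (t ^+ 2) * t).
    have dq : is_derive t (1 : R) (fun t : R => t ^+ 2) (2 * t).
      rewrite (_ : (fun t : R => t ^+ 2) = (id : R -> R) * id); last first.
        by apply/funext => s; rewrite expr2.
      apply: (is_derive_eq (is_deriveM (is_derive_id t (1 : R)) (is_derive_id t (1 : R)))).
      by rewrite /GRing.scale/=; ring.
    have dc := is_deriveN (@is_derive1_comp _ P (fun t : R => t ^+ 2) t _ _ (dP (t ^+ 2)) dq).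
    by apply: (is_derive_eq dc); ring.
  have E := @integral_FTC2 R (fun t => 2 * p (t ^+ 2) * t) (fun t => - P (t ^+ 2)) r B (ltW rB)
    (fun t _ => dF t) (fun t _ => @cm t).
  by rewrite /Rintegral E/= (P0 _ (lexx _)) oppr0 sub0r opprK.
have iV : leb.-integrable `[r, B] (EFin \o V) by exact: continuous_integrable_itv.
have im : leb.-integrable `[r, B] (EFin \o (fun t => 2 * p (t ^+ 2) * t)) by exact: continuous_integrable_itv.
have EV : tail V r = \int[leb]_(t in `[r, B]) V t.
  rewrite /tail /Rintegral [in LHS]integral_mkcond [in RHS]integral_mkcond; congr fine.
  apply: eq_integral => t _; rewrite /patch !mem_setE !in_itv/= andbT.
  case: (leP r t) => //= rt; case: leP => // Bt; rewrite V_supp//; right.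
  by apply: le_trans (ltW Bt); rewrite lerDl.
rewrite distrC EP EV -RintegralB//.
have iB : leb.-integrable `[r, B] (EFin \o (fun t => V t - 2 * p (t ^+ 2) * t)).
  by apply: (continuous_integrable_itv (f := fun t => V t - 2 * p (t ^+ 2) * t)) => t; apply: cvgB; [exact: cV|exact: cm].
apply: (le_trans (le_normr_Rintegral _ iB)) => //.
have ic : leb.-integrable `[r, B] (EFin \o cst e).
  by apply: (continuous_integrable_itv (f := cst e)); exact: cst_continuous.
apply: (@le_trans _ _ (\int[leb]_(t in `[r, B]) e)).
  apply: le_Rintegral => //; first by have := integrable_abse iB.
  move=> t; rewrite /= in_itv/= => /andP[rt tB].
  have := key t (le_trans r0 rt); rewrite mulrN mulNr => /le_trans; apply.
  by case: ifP => // _; exact: ltW.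
rewrite Rintegral_cst//; apply: ler_wpM2l; first exact: ltW.
have -> : fine (leb (`[r, B]%classic : set R)) = fine (lebesgue_measure (`[r, B]%classic : set R)) by [].
rewrite lebesgue_measure_itv/= lte_fin rB/=; lra.
Qed.

End radial_smoothing.

Lemma bump_arith (R : realType) (D K c : R) : 1 <= D -> 0 <= K -> 0 < c ->
  exists2 e, 0 < e & D * e <= 1 /\ 2 * (D * e) ^+ 2 * K <= c.
Proof.
move=> D1 K0 c0; have D0 := lt_le_trans ltr01 D1.
pose t := Num.min 1 (c / (2 * K + 1)).
have k1 : 0 < 2 * K + 1 by rewrite ltr_pwDr// mulr_ge0.
have t0 : 0 < t by rewrite lt_min ltr01 divr_gt0.
have t1 : t <= 1 by rewrite ge_min lexx.
have tc : t * (2 * K + 1) <= c by rewrite -ler_pdivlMr// ge_min lexx orbT.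
exists (t / D); first exact: divr_gt0.
rewrite mulrC divfK ?gt_eqF//; split => //; apply: le_trans tc.
have tt : t ^+ 2 <= t by rewrite expr2 ler_piMl// ltW.
have -> : 2 * t ^+ 2 * K = t ^+ 2 * (2 * K) by ring.
apply: (@le_trans _ _ (t * (2 * K))); first by rewrite ler_wpM2r// mulr_ge0.
by rewrite ler_pM2l// lerDl.
Qed.

(** * Test functions close to the radial profile *)

Section approximation.
Variables (R : realType) (N : nat).
Hypothesis N2 : (2 <= N)%N.
Let N0 : (0 < N)%N. Proof. exact: ltnW. Qed.
Local Notation nu := (@radm R N).
Local Notation leb := (lebesgue_rV R N).
Local Notation L1 f := (nu.-integrable setT (EFin \o f)).
Variable W : R -> R.
Hypothesis pW : profile N W.
Hypothesis cW : forall r, 0 < r -> {for r, continuous W}.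
Implicit Types x : 'rV[R]_N.

Definition radial_profile x : R := tail W (enorm x).
(** The gradient of the radial profile away from the origin, where it has Euclidean norm [W |x|]; at
    the origin it is zero. *)
Definition radial_field x : 'rV[R]_N := - (W (enorm x) / enorm x) *: x.

Lemma measurable_radial_field : measurable_fun [set: borel_rV R N]
  (radial_field : borel_rV R N -> borel_rV R N).
Proof.
have [[mW _ _ _] _ _] := pW.
apply: measurable_rV => i.
rewrite (_ : (fun t => _) = (fun x : borel_rV R N => - (W (enorm (x : 'rV[R]_N)) * (enorm (x : 'rV[R]_N))^-1) * (x : 'rV[R]_N) ord0 i)).
  apply: measurable_funM; last exact: measurable_coord.
  apply: measurableT_comp => //; apply: measurable_funM.
    exact: (measurableT_comp mW (@measurable_enorm R N)).
  exact: (measurableT_comp (@measurable_inv R) (@measurable_enorm R N)).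
by apply/funext => x; rewrite /radial_field mxE.
Qed.

Lemma measurable_radial_profile : measurable_fun [set: borel_rV R N]
  (radial_profile : borel_rV R N -> measurableTypeR R).
Proof. by have [dW _ _] := pW; exact: (measurableT_comp (measurable_tail dW) (@measurable_enorm R N)). Qed.

Let integral_le_radial (f : 'rV[R]_N -> R) (h : R -> R) (c : R) :
  measurable_fun [set: borel_rV R N] (f : borel_rV R N -> measurableTypeR R) ->
  (forall x, 0 <= f x) -> (forall r, 0 <= h r) -> (forall x, f x <= h (enorm x)) ->
  L1 h -> \int[nu]_r h r <= c -> (\int[leb]_x (f x)%:E <= c%:E)%E.
Proof.
move=> mf f0 h0 fh ih hc.
have mh := L1_measurable ih.
have mhe : measurable_fun [set: borel_rV R N] (fun x => h (enorm (x : 'rV[R]_N))).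
  exact: (measurableT_comp mh (@measurable_enorm R N)).
apply: (@le_trans _ _ (\int[leb]_x (h (enorm (x : 'rV[R]_N)))%:E)%E).
  apply: ge0_le_integral => //.
  - by move=> x _; rewrite lee_fin.
  - exact/measurable_EFinP.
  - exact/measurable_EFinP.
  - by move=> x _; rewrite lee_fin.
rewrite -(@ge0_integral_radm R N (fun r => (h r)%:E)) ?L1_EFin ?lee_fin//.
exact/measurable_EFinP.
Qed.

(** The uniform bound 2 on the gradient error is what later turns smallness in L^2 into smallness in
    L^q. *)
Lemma approximation c : 0 < c -> exists phi, [/\ test_function phi,
  (\int[leb]_x ((phi x - radial_profile x) ^+ 2)%:E <= c%:E)%E,
  (\int[leb]_x ((enorm (grad phi x - radial_field x)) ^+ 2)%:E <= c%:E)%E,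
  (forall x, enorm (grad phi x - radial_field x) <= 2) &
  measurable_fun [set: borel_rV R N] (fun x => enorm (grad phi x - radial_field x) : measurableTypeR R)].
Proof.
(* By [(X + Z)^2 <= 2 X^2 + 2 Z^2] the cutoff error [c / 4] counts double, and the smoothing error
   takes the remaining [c / 2]. *)
move=> c0; have c4 : 0 < c / 4 by rewrite divr_gt0.
have [dW _ _] := pW; have [mW W01 _ _] := dW.
have [V [al [A [dV cV /andP[al0 alA] V_supp [iWV WV iUV UV]]]]] := cutoff_approximation N2 pW cW c4.
have [_ V01 _ _] := dV.
have A0 : 0 < A by exact: lt_trans alA.
pose B := A + 1; pose K := ballc R N * B ^+ N.
have B0 : 0 < B by rewrite addr_gt0.
have B1 : 1 <= B by rewrite lerDr ltW.
have K0 : 0 <= K by rewrite mulr_ge0 ?exprn_ge0 ?ltW// ballc_gt0.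
have c2 : 0 < c / 2 by rewrite divr_gt0.
have [e e0 [De DK]] := bump_arith B1 K0 c2.
have [P [P' [sP dP P0 HV HU]]] := radial_smoothing cV al0 alA V_supp e0.
have eB : e <= B * e by rewrite ler_peMl// ltW.
have iB : L1 (fun r => 2 * (B * e) ^+ 2 * \1_(`]-oo, B[ : set R) r) by exact: L1_ball.
have EB : \int[nu]_r (2 * (B * e) ^+ 2 * \1_(`]-oo, B[ : set R) r) = 2 * (B * e) ^+ 2 * K by exact: Rintegral_ball.
pose h1 r : R := 2 * (B * e) ^+ 2 * \1_(`]-oo, B[ : set R) r + 2 * (W r - V r) ^+ 2.
pose h2 r : R := 2 * (B * e) ^+ 2 * \1_(`]-oo, B[ : set R) r + 2 * (tail W r - tail V r) ^+ 2.
have ih1 : L1 h1 := L1D iB (L1Z _ iWV).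
have ih2 : L1 h2 := L1D iB (L1Z _ iUV).
have Bh r : (if r < B then B * e else 0) = B * e * \1_(`]-oo, B[ : set R) r.
  by rewrite indicE mem_setE in_itv/=; case: ifP => _; rewrite ?mulr1// mulr0.
have h1c : \int[nu]_r h1 r <= c.
  rewrite /h1 (RintegralT_D iB (L1Z _ iWV)) (RintegralT_Z _ iWV) EB.
  move: DK WV; move: (_ * K) (\int[nu]_r _) => X Y ? ?; lra.
have h2c : \int[nu]_r h2 r <= c.
  rewrite /h2 (RintegralT_D iB (L1Z _ iUV)) (RintegralT_Z _ iUV) EB.
  move: DK UV; move: (_ * K) (\int[nu]_r _) => X Y ? ?; lra.
have ind2 r : (\1_(`]-oo, B[ : set R) r : R) ^+ 2 = \1_(`]-oo, B[ : set R) r.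
  by rewrite indicE; case: (_ \in _); rewrite ?expr1n// expr0n.
have h10 r : 0 <= h1 r.
  apply: addr_ge0; last by apply: mulr_ge0 => //; exact: sqr_ge0.
  by apply: mulr_ge0; [apply: mulr_ge0 => //; exact: sqr_ge0|rewrite indicE].
have h20 r : 0 <= h2 r.
  apply: addr_ge0; last by apply: mulr_ge0 => //; exact: sqr_ge0.
  by apply: mulr_ge0; [apply: mulr_ge0 => //; exact: sqr_ge0|rewrite indicE].
pose phi x := P (dotv x x).
have tphi : test_function phi by apply: (@radial_test_function R N P (B ^+ 2)).
have gradE x : grad phi x = (2 * P' (dotv x x)) *: x.
  by apply/rowP => i; rewrite !mxE (partial_radial _ _ dP).
have dE x : enorm (grad phi x - radial_field x) <= `|W (enorm x) + 2 * P' (enorm x ^+ 2) * enorm x|.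
  rewrite gradE /radial_field -enorm_sqr scaleNr opprK -scalerDl enormZ.
  set r := enorm x; have r0 : 0 <= r := enorm_ge0 x.
  have [rE|rn] := eqVneq r 0; first by rewrite rE mulr0.
  by rewrite -[X in _ * X](ger0_norm r0) -normrM mulrDl divfK// addrC.
have Vd x : `|V (enorm x) + 2 * P' (enorm x ^+ 2) * enorm x| <= B * e * \1_(`]-oo, B[ : set R) (enorm x).
  apply: le_trans (HV _ (enorm_ge0 x)) _; rewrite -Bh -/B.
  by case: ifP.
have sqr_bound (X Y Z : R) : `|X| <= Y -> (X + Z) ^+ 2 <= 2 * Y ^+ 2 + 2 * Z ^+ 2.
  move=> XY; apply: (@le_trans _ _ (2 * X ^+ 2 + 2 * Z ^+ 2)).
    by have := sqr_ge0 (X - Z); rewrite sqrrB sqrrD; lra.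
  rewrite lerD2r ler_wpM2l// -real_normK ?num_real//; apply: lerXn2r; rewrite ?nnegrE//.
  exact: le_trans XY.
have mphi : measurable_fun [set: borel_rV R N] (phi : borel_rV R N -> measurableTypeR R).
  by apply: continuous_measurable_rV => x; apply: differentiable_continuous; have [sphi _] := tphi; exact: (sphi [::]).
have md : measurable_fun [set: borel_rV R N] (fun x => enorm (grad phi x - radial_field x) : measurableTypeR R).
  apply: (measurableT_comp (@measurable_enorm R N)); apply: measurable_rV => i.
  rewrite (_ : (fun t => _) = (fun x : borel_rV R N => partial i phi (x : 'rV[R]_N) - (radial_field (x : 'rV[R]_N)) ord0 i)); last first.
    by apply/funext => x; rewrite !mxE.
  apply: measurable_funB.
    by apply: continuous_measurable_rV => x; apply: differentiable_continuous; have [sphi _] := tphi; exact: (sphi [:: i]).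
  exact: (measurableT_comp (measurable_coord i) measurable_radial_field).
exists phi; split => //.
- apply: (integral_le_radial _ _ h20 _ ih2 h2c).
  + by apply: measurable_funX; apply: measurable_funB => //; exact: measurable_radial_profile.
  + by move=> x; rewrite sqr_ge0.
  + move=> x; have /sqr_bound : `|P (enorm x ^+ 2) - tail V (enorm x)| <= B * e * \1_(`]-oo, B[ : set R) (enorm x).
      by apply: le_trans (HU _ (enorm_ge0 x)) _; rewrite -Bh -/B [e * B]mulrC.
    move=> /(_ (tail V (enorm x) - tail W (enorm x))); rewrite addrA subrK.
    rewrite /phi -enorm_sqr /radial_profile /h2 => /le_trans; apply.
    by rewrite exprMn ind2 mulrA -[X in _ + 2 * X <= _]sqrrN opprB.
- apply: (integral_le_radial _ _ h10 _ ih1 h1c).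
  + exact: measurable_funX.
  + by move=> x; rewrite sqr_ge0.
  + move=> x; have /sqr_bound := Vd x => /(_ (W (enorm x) - V (enorm x))).
    rewrite addrAC [V _ + _]addrC subrK => H.
    apply: (@le_trans _ _ (`|W (enorm x) + 2 * P' (enorm x ^+ 2) * enorm x| ^+ 2)).
      by apply: lerXn2r; rewrite ?nnegrE ?enorm_ge0.
    by rewrite real_normK ?num_real//; apply: le_trans H _; rewrite exprMn ind2 mulrA.
- move=> x; apply: le_trans (dE x) _.
  rewrite -[W _](subrK (V (enorm x))) -addrA; apply: le_trans (ler_normD _ _) _.
  have /andP[w0 w1] := W01 (enorm x); have /andP[v0 v1] := V01 (enorm x).
  have -> : (2 : R) = 1 + 1 by [].
  apply: lerD; first by rewrite ler_norml; apply/andP; split; lra.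
  by apply: le_trans (Vd x) _; rewrite indicE; case: (_ \in _); rewrite ?mulr1 ?mulr0 ?ler01.
Qed.

End approximation.

Section norms.
Variables (R : realType) (N : nat).
Local Notation leb := (lebesgue_rV R N).
Implicit Types (f : 'rV[R]_N -> R).

Lemma Lnorm_le (s e : R) f : 0 < s -> 0 <= e ->
  (\int[leb]_x (`|f x| `^ s)%:E <= (e `^ s)%:E)%E ->
  (Lnorm leb s%:E (fun x => (f x)%:E) <= e%:E)%E.
Proof.
move=> s0 e0 H; rewrite unlock.
have -> : (\int[leb]_x `|(f x)%:E| `^ s = \int[leb]_x (`|f x| `^ s)%:E)%E.
  by apply: eq_integral => x _; rewrite abse_EFin poweR_EFin.
have -> : e%:E = (((e `^ s)%:E) `^ s^-1)%E.
  by rewrite poweR_EFin -powRrM mulfV ?gt_eqF// powRr1.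
apply: gt0_ler_poweR => //; first by rewrite invr_ge0 ltW.
- by rewrite in_itv/= leey andbT integral_ge0// => x _; rewrite lee_fin powR_ge0.
- by rewrite in_itv/= leey andbT lee_fin powR_ge0.
Qed.

Lemma sqr_powR (t : R) : `|t| `^ 2 = t ^+ 2.
Proof. by rewrite powR_mulrn// real_normK// num_real. Qed.

(** Three squares of at most [e^2] add up to at most [(2 e)^2]. *)
Lemma normX_le (q e : R) (u : 'rV[R]_N -> R) (v : 'rV[R]_N -> 'rV[R]_N) : 0 <= e ->
  (Lnorm leb 2%:E (fun x => (enorm (v x))%:E) <= e%:E)%E ->
  (Lnorm leb 2%:E (fun x => (u x)%:E) <= e%:E)%E ->
  (Lnorm leb q%:E (fun x => (enorm (v x))%:E) <= e%:E)%E ->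
  (normX q u v <= (2 * e)%:E)%E.
Proof.
move=> e0 h1 h2 h3.
have sq0 (X : \bar R) : (0 <= X -> 0 <= X ^+ 2)%E by move=> X0; rewrite expe2 mule_ge0.
have sq (X : \bar R) : (0 <= X)%E -> (X <= e%:E)%E -> (X ^+ 2 <= (e ^+ 2)%:E)%E.
  by move=> X0 Xe; rewrite expe2 expr2 EFinM; apply: lee_pmul.
have -> : (2 * e)%:E = ((((2 * e) ^+ 2)%:E) `^ 2^-1)%E.
  rewrite poweR_EFin -sqr_powR -powRrM mulfV// powRr1 ?ger0_norm// mulr_ge0//.
rewrite /normX; apply: gt0_ler_poweR => //; first 2 last.
- have -> : ((2 * e) ^+ 2)%:E = ((e ^+ 2)%:E + (e ^+ 2)%:E + (e ^+ 2)%:E + (e ^+ 2)%:E)%E.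
    by rewrite -!EFinD; congr (_%:E); ring.
  apply: (@le_trans _ _ ((e ^+ 2)%:E + (e ^+ 2)%:E + (e ^+ 2)%:E)%E).
    by apply: leeD; [apply: leeD|]; apply: sq => //; exact: Lnorm_ge0.
  by rewrite leeDl// lee_fin sqr_ge0.
- rewrite in_itv/= leey andbT; apply: adde_ge0; [apply: adde_ge0|]; apply: sq0; exact: Lnorm_ge0.
- by rewrite in_itv/= leey andbT lee_fin sqr_ge0.
Qed.

End norms.

Section membership.
Variables (R : realType) (N : nat).
Hypothesis N2 : (2 <= N)%N.
Let N0 : (0 < N)%N. Proof. exact: ltnW. Qed.
Local Notation leb := (lebesgue_rV R N).
Variables (W : R -> R) (q : R).
Hypothesis pW : profile N W.
Hypothesis cW : forall r, 0 < r -> {for r, continuous W}.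
Hypothesis q2 : 2 < q.

Lemma radial_inX : inX q (@radial_profile R N W) (@radial_field R N W).
Proof.
split; [exact: measurable_radial_profile|exact: measurable_radial_field|].
have step (k : nat) : exists phi : 'rV[R]_N -> R, test_function phi /\
  (normX q (fun x => phi x - radial_profile W x)%R (fun x => grad phi x - radial_field W x)%R
    <= (2 * k.+1%:R^-1)%R%:E)%E.
  pose e : R := k.+1%:R^-1; have e0 : 0 < e by rewrite invr_gt0.
  (* As the gradient error is at most 2, its [q]-th power is at most [2^(q-2)] times its square. *)
  pose d : R := 2 `^ (q - 2).
  have d0 : 0 < d by rewrite powR_gt0.
  pose c := Num.min (e ^+ 2) (e `^ q / d).
  have c0 : 0 < c by rewrite lt_min exprn_gt0//= divr_gt0// powR_gt0.
  have c1 : c <= e ^+ 2 by rewrite ge_min lexx.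
  have c2 : d * c <= e `^ q by rewrite mulrC -ler_pdivlMr// ge_min lexx orbT.
  have [phi [tphi H1 H2 H3 md]] := approximation N2 pW cW c0.
  exists phi; split => //; apply: (normX_le (ltW e0)).
  - apply: (Lnorm_le _ (ltW e0)) => //.
    rewrite -[in X in (_ <= X)%E](ger0_norm (ltW e0)) sqr_powR.
    under eq_integral do rewrite sqr_powR.
    by apply: le_trans H2 _; rewrite lee_fin.
  - apply: (Lnorm_le _ (ltW e0)) => //.
    rewrite -[in X in (_ <= X)%E](ger0_norm (ltW e0)) sqr_powR.
    under eq_integral do rewrite sqr_powR.
    by apply: le_trans H1 _; rewrite lee_fin.
  - apply: (Lnorm_le _ (ltW e0)); first by rewrite (lt_trans _ q2).
    under eq_integral do rewrite (ger0_norm (enorm_ge0 _)).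
    have mx : measurable_fun [set: borel_rV R N] (fun x => enorm (grad phi x - radial_field W x) ^+ 2).
      exact: measurable_funX.
    apply: (@le_trans _ _ (\int[leb]_x (d%:E * (enorm (grad phi x - radial_field W x) ^+ 2)%:E))%E).
      apply: ge0_le_integral => //.
      + by move=> x _; rewrite lee_fin powR_ge0.
      + apply/measurable_EFinP.
        have mP : measurable_fun [set: R] (fun t : R => t `^ q) by exact: measurable_powR.
        exact: (measurableT_comp mP md).
      + by apply/measurable_EFinP; apply: measurable_funM.
      + move=> x _; rewrite -EFinM lee_fin.
        rewrite (powR_split (enorm_ge0 _) q2) ler_wpM2r ?sqr_ge0//.
        apply: ge0_ler_powR; rewrite ?nnegrE ?enorm_ge0//.
        by rewrite subr_ge0 ltW.
    rewrite ge0_integralZl//; last 3 first.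
    + exact/measurable_EFinP.
    + by move=> x _; rewrite lee_fin sqr_ge0.
    + by rewrite lee_fin ltW.
    apply: (@le_trans _ _ (d%:E * c%:E)%E); first by rewrite lee_wpmul2l// lee_fin ltW.
    by rewrite -EFinM lee_fin.
have {step} /choice[phi Hphi] := step.
exists phi; split => [k|]; first by have [] := Hphi k.
apply: (@squeeze_cvge _ _ _ _ (cst 0%E) _ (fun k : nat => (2 * k.+1%:R^-1 : R)%:E)).
- apply: nearW => k; have [_ ->] := Hphi k; rewrite andbT; exact: poweR_ge0.
- exact: cvg_cst.
- apply/fine_cvgP; split; first exact: nearW.
  rewrite -[X in _ --> X](mulr0 (2 : R)); apply: cvgM; first exact: cvg_cst.
  exact: cvg_harmonic.
Qed.

End membership.

Section weak_solution.
Variables (R : realType) (N : nat).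
Hypothesis N2 : (2 <= N)%N.
Let N0 : (0 < N)%N. Proof. exact: ltnW. Qed.
Local Notation leb := (lebesgue_rV R N).
Local Notation L1 f := (leb.-integrable setT (EFin \o f)).
Variables (a : R -> R) (p la m : R) (W : R -> R).
Hypothesis p2 : 2 < p.
Hypothesis pW : profile N W.
Hypothesis mW : mass_of N W = m.
Hypothesis W01 : forall r, 0 < r -> 0 <= W r < 1.
Hypothesis W_eq : forall r, 0 < r -> a (W r ^+ 2) * W r =
  flux N (fun s => tail W s `^ (p - 1)) r - la * flux N (tail W) r.
Let u := @radial_profile R N W.
Let v := @radial_field R N W.
Let dW : density_profile W. Proof. by case: pW. Qed.
Let U0 r : 0 <= tail W r. Proof. exact: profile_tail_ge0. Qed.
Let UC r : tail W r <= tail_bound N m. Proof. by apply: (tail_le_bound N0 r pW); rewrite mW. Qed.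

Lemma enorm_radial_field x : enorm (v x) = if x == 0 then 0 else W (enorm x).
Proof.
rewrite /v /radial_field; case: eqP => [->|/eqP x0]; first by rewrite scaler0 enorm0.
have xp : 0 < enorm x.
  by rewrite lt_neqAle enorm_ge0 andbT eq_sym; apply: contra x0 => /eqP /enorm_eq0 ->.
have /andP[w0 _] := W01 xp.
by rewrite enormZ normrN ger0_norm ?divr_ge0 ?(ltW xp)// divfK// gt_eqF.
Qed.

Lemma radial_weak_solution : weak_solution a p la u v.
Proof.
split.
  apply: aeW => x; rewrite enorm_radial_field; case: eqP => [_|/eqP x0]; first exact: ltr01.
  have xp : 0 < enorm x.
    by rewrite lt_neqAle enorm_ge0 andbT eq_sym; apply: contra x0 => /eqP /enorm_eq0 ->.
  by have /andP[] := W01 xp.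
move=> phi tphi; pose F r := tail W r `^ (p - 1).
have cU : continuous (tail W) by exact: continuous_tail.
have cF : continuous F by exact: (continuous_tail_powR N2 p2 pW mW).
have F0 r : 0 <= F r by exact: powR_ge0.
have FC r : F r <= tail_bound N m `^ (p - 1).
  apply: ge0_ler_powR; rewrite ?nnegrE//; first by rewrite subr_ge0 (le_trans _ (ltW p2))// ler1n.
  exact: le_trans (UC r).
(* The identity asks for a nonnegative source, so it is applied to [U^(p-1)] and to [U] separately
   and the two results are combined. *)
have [ik1 if1 E1] := radial_weak_identity N2 cF F0 FC tphi.
have [ik2 if2 E2] := radial_weak_identity N2 cU U0 UC tphi.
have EL x : a (enorm (v x) ^+ 2) * dotv (v x) (grad phi x) =
    flux N F (enorm x) / enorm x * - dotv x (grad phi x) -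
    la * (flux N (tail W) (enorm x) / enorm x * - dotv x (grad phi x)).
  have [->|x0] := eqVneq x 0.
    have d0 (y : 'rV[R]_N) : dotv 0 y = 0 by rewrite -(scale0r 0) dotvZl mul0r.
    by rewrite /v /radial_field scaler0 !d0 oppr0 !mulr0 subrr.
  have xp : 0 < enorm x.
    by rewrite lt_neqAle enorm_ge0 andbT eq_sym; apply: contra x0 => /eqP /enorm_eq0 ->.
  have := W_eq xp; rewrite enorm_radial_field (negbTE x0) -/F.
  rewrite /v /radial_field dotvZl; set D := dotv _ _; set A := a _.
  move: (flux _ _ _) (flux _ _ _) => X Y E.
  have -> : A * (- (W (enorm x) / enorm x) * D) = A * W (enorm x) / enorm x * - D by ring.
  by rewrite E; ring.
have ER x : (`|u x| `^ (p - 2) * u x - la * u x) * phi x =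
    F (enorm x) * phi x - la * (tail W (enorm x) * phi x).
  by rewrite /u /radial_profile ger0_norm// /F powR_split1//; ring.
have iL := L1B ik1 (L1Z la ik2); have iR := L1B if1 (L1Z la if2).
have fL : (fun x => (a (enorm (v x) ^+ 2) * dotv (v x) (grad phi x))%:E) =
    EFin \o (fun x => flux N F (enorm x) / enorm x * - dotv x (grad phi x) -
    la * (flux N (tail W) (enorm x) / enorm x * - dotv x (grad phi x))).
  by apply/funext => x /=; rewrite EL.
have fR : (fun x => ((`|u x| `^ (p - 2) * u x - la * u x) * phi x)%:E) =
    EFin \o (fun x => F (enorm x) * phi x - la * (tail W (enorm x) * phi x)).
  by apply/funext => x /=; rewrite ER.
rewrite fL fR; split; [exact: iL|exact: iR|].
rewrite (L1_EFin iL) (L1_EFin iR) (RintegralT_B ik1 (L1Z la ik2)) (RintegralT_B if1 (L1Z la if2)).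
by rewrite (RintegralT_Z _ ik2) (RintegralT_Z _ if2) E1 E2.
Qed.

Lemma radial_vanishes : vanishes_at_infinity u.
Proof.
move=> e e0; pose C := tail_bound N m.
have C0 : 0 < C by exact: tail_bound_gt0.
exists (C / e + 1) => x xM.
have xp : 0 < enorm x by apply: lt_le_trans xM; rewrite addr_gt0// divr_gt0.
rewrite /u /radial_profile ger0_norm// -(ltr_pM2l xp).
apply: (@le_lt_trans _ _ C); first by apply: (tail_decay N0 N2 pW) => //; rewrite mW.
rewrite -ltr_pdivrMr//; apply: lt_le_trans xM; by rewrite ltrDl.
Qed.

Lemma radial_mass : (\int[leb]_x (`|u x| ^+ 2)%:E = m%:E)%E.
Proof.
have [_ _ iU] := pW; rewrite -mW /mass_of -L1_EFin//.
rewrite (@ge0_integral_radm R N (fun r => (tail W r ^+ 2)%:E)).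
- by apply: eq_integral => x _; rewrite /u /radial_profile ger0_norm.
- by apply/measurable_EFinP; exact: L1_measurable iU.
- by move=> r; rewrite lee_fin sqr_ge0.
Qed.

End weak_solution.

Theorem theorem1p1 (R : realType) (N : nat) (hN : (3 <= N)%N)
  (q : R) (hq : N%:R < q)
  (a : R -> R)
  (a_pos : forall s : R, 0 <= s < 1 -> 0 < a s)
  (a_cont : {within `[0, 1[, continuous a})
  (a_derivable : forall s : R, 0 < s < 1 -> derivable a s 1)
  (a_C1 : forall s : R, 0 < s < 1 -> {for s, continuous (derive1 a)})
  (a_lim : a s @[s --> 1^'-] --> +oo)
  (a_incr : forall s t : R, 0 <= s -> s <= t -> t < 1 -> a s <= a t)
  (rho p : R) (hrho : 0 < rho) (hp : 2 < p < 2 + 4 / N%:R) :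
  exists (u : 'rV[R]_N -> R) (v : 'rV[R]_N -> 'rV[R]_N) (lambda : R),
    [/\ inX q u v,
        (forall x : 'rV[R]_N, 0 <= u x) /\ radial u,
        weak_solution a p lambda u v,
        vanishes_at_infinity u &
        (\int[lebesgue_rV R N]_x (`|u x| ^+ 2)%:E = (rho ^+ 2)%:E)%E].
Proof.
have /andP[p2 p4] := hp; have N2 : (2 <= N)%N by exact: ltnW.
have m0 : 0 < rho ^+ 2 by rewrite exprn_gt0.
have [W [la [pW mW cW W01 W_eq]]] := radial_solution_exists N2 a_pos a_cont a_lim a_incr p2 p4 m0.
have q2 : 2 < q by apply: le_lt_trans hq; rewrite ler_nat.
exists (@radial_profile R N W), (@radial_field R N W), la; split.
- exact: radial_inX.
- split; last by move=> x y E; rewrite /radial_profile E.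
  by move=> x; apply: profile_tail_ge0; case: pW.
- exact: (radial_weak_solution N2 p2 pW mW).
- exact: (radial_vanishes N2 pW mW).
- exact: (radial_mass pW mW).
Qed.
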